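(* Let $\mathcal G$ be a connected, planar, doubly-periodic, tame graph with graph distance $d_{\mathcal G}$, and let $0<\beta<\infty$. Then either there exist finite $A(\beta)$ and $\xi(\beta)>0$ such that for all vertices $x,y$ $$\langle\sigma_x\cdot\sigma_y\rangle^{\mathrm{Vill},\mathcal G}_\beta\le A(\beta)\,e^{-d_{\mathcal G}(x,y)/\xi(\beta)},$$ or else, for every integer $0\le L<\infty$, $$\max_{x\in\mathcal G}\ \sum_{y\in\mathcal G:\ d_{\mathcal G}(x,y)=L}\langle\sigma_x\cdot\sigma_y\rangle^{\mathrm{Vill},\mathcal G}_\beta\ \ge\ 1 .$$
   Context: Doubly-periodic: $\mathcal G$ has an embedding in $\mathbb R^2$ for which the translations by $\mathbb Z^2$ act as graph automorphisms. Tame: under this embedding the vertex set has no accumulation point. Villain model: on a finite graph $(V,E)$ with free boundary conditions at inverse temperature $\beta$, the spins are $\sigma_x=e^{i\theta_x}\in\mathbb S^1$, $\theta\in[-\pi,\pi)^V$, with probability density proportional to $\prod_{\{u,v\}\in E}\sum_{m\in\mathbb Z}\exp\big(-\frac\beta2(\theta_u-\theta_v+2\pi m)^2\big)$, and $\langle\sigma_x\cdot\sigma_y\rangle$ is the expectation of $\cos(\theta_x-\theta_y)$. On an infinite locally finite graph $\mathcal G$, $\langle\sigma_x\cdot\sigma_y\rangle^{\mathrm{Vill},\mathcal G}_\beta$ is the limit of these correlations along increasing finite subgraphs exhausting $\mathcal G$ (the finite-volume correlations are monotone in the volume). *)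

(* Defs.v *)
From HB Require Import structures.
From mathcomp Require Import all_boot all_order all_algebra finmap.
From mathcomp Require Import all_classical all_reals all_analysis.

Set Implicit Arguments.
Unset Strict Implicit.
Unset Printing Implicit Defensive.

Import Order.TTheory GRing.Theory Num.Theory.
Import numFieldNormedType.Exports.

Local Open Scope classical_set_scope.
Local Open Scope ring_scope.

(* A simple graph is a symmetric irreflexive [e : rel V]; V may be infinite. *)

Definition graph_connected (V : choiceType) (e : rel V) : Prop :=
  forall x y : V, exists p : seq V, path e x p /\ last x p = y.

Definition walk_of_length (V : choiceType) (e : rel V) (x y : V) : pred nat :=
  fun n => `[< exists p : seq V, [/\ path e x p, last x p = y & size p = n] >].

(* The value 0 on disconnected pairs is a dummy. *)
Definition graph_dist (V : choiceType) (e : rel V) (x y : V) : nat :=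
  if pselect (exists n, walk_of_length e x y n) is left walk_xy
  then ex_minn walk_xy else 0%N.

Definition graph_aut (V : choiceType) (e : rel V) (phi : V -> V) : Prop :=
  bijective phi /\ forall u v : V, e (phi u) (phi v) = e u v.

Definition simple_arc (R : realType) (p q : R * R) (S : set (R * R)) : Prop :=
  exists g : R -> R * R,
    [/\ {within `[0, 1], continuous g},
        {in `[0, 1] &, injective g},
        g 0 = p,
        g 1 = q
      & S = g @` `[0, 1]].

(* [pos] places the vertices and [arc u v] is the closed curve segment that
   draws the edge {u, v}; the values of [arc] at non-edges are irrelevant. *)
Definition planar_embedding (R : realType) (V : choiceType) (e : rel V)
    (pos : V -> R * R) (arc : V -> V -> set (R * R)) : Prop :=
  [/\ injective pos,
      forall u v, e u v ->
        [/\ simple_arc (pos u) (pos v) (arc u v),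
            arc v u = arc u v
          & arc u v `&` range pos = [set pos u; pos v]]
    & forall u v u' v', e u v -> e u' v' ->
        [set u; v] <> [set u'; v'] -> arc u v `&` arc u' v' `<=` range pos].

Definition translate (R : realType) (z : int * int) (p : R * R) : R * R :=
  (p.1 + z.1%:~R, p.2 + z.2%:~R).

Definition doubly_periodic (R : realType) (V : choiceType) (e : rel V)
    (pos : V -> R * R) (arc : V -> V -> set (R * R)) : Prop :=
  forall z : int * int, exists phi : V -> V,
    [/\ graph_aut e phi,
        forall u, pos (phi u) = translate z (pos u)
      & forall u v, e u v -> arc (phi u) (phi v) = translate z @` arc u v].

Definition tame (R : realType) (V : choiceType) (pos : V -> R * R) : Prop :=
  limit_point (range pos) = set0.

Definition villain_weight (R : realType) (beta t : R) : R :=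
  fine (\esum_(m in [set: int])
    (expR (- (beta / 2) * (t + 2 * pi * m%:~R) ^+ 2))%:E)%E.

(* Each edge {u, v} is counted once, through its orientation increasing for
   [enum_rank]; the choice is immaterial because [villain_weight] is even. *)
Definition villain_density (R : realType) (T : finType) (e : rel T) (beta : R)
    (theta : T -> R) : R :=
  \prod_(p : T * T | e p.1 p.2 && (enum_rank p.1 < enum_rank p.2)%N)
    villain_weight beta (theta p.1 - theta p.2).

(* Iterated Lebesgue integral of [f] over theta_v in [-pi, pi), v in [s], the
   other coordinates of theta being kept fixed. *)
Fixpoint angle_integral (R : realType) (T : eqType) (s : seq T)
    (f : (T -> R) -> R) (theta : T -> R) : R :=
  if s is v :: s' then
    \int[@lebesgue_measure R]_(t in `[- pi, pi[)
      angle_integral s' f (fun w => if w == v then t else theta w)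
  else f theta.

(* Since [enum T] lists all of T, the starting point [fun=> 0] is irrelevant. *)
Definition villain_expectation (R : realType) (T : finType) (e : rel T)
    (beta : R) (f : (T -> R) -> R) : R :=
  angle_integral (enum T) (fun th => f th * villain_density e beta th) (fun=> 0)
  / angle_integral (enum T) (villain_density e beta) (fun=> 0).

Definition villain_corr_fin (R : realType) (T : finType) (e : rel T) (beta : R)
    (x y : T) : R :=
  villain_expectation e beta (fun theta => cos (theta x - theta y)).

Record fin_subgraph (V : choiceType) (e : rel V) := FinSubgraph {
  sg_vertices : {fset V};
  sg_adj : rel V;
  sg_sym : symmetric sg_adj;
  sg_sub : forall u v, sg_adj u v ->
    [&& u \in sg_vertices, v \in sg_vertices & e u v] }.

Definition sg_le (V : choiceType) (e : rel V) (H K : fin_subgraph e) : Prop :=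
  {subset sg_vertices H <= sg_vertices K} /\ subrel (sg_adj H) (sg_adj K).

(* The limit along this filter is the limit of the net of all finite subgraphs
   ordered by inclusion; it implies the same limit along every increasing
   sequence of finite subgraphs that exhausts the graph. *)
Definition exhaustion (V : choiceType) (e : rel V) :
    set_system (fin_subgraph e) :=
  filter_from [set: fin_subgraph e] (fun H => [set K | sg_le H K]).
Arguments exhaustion {V} e.

(* The value 0 is a dummy, used only when x or y is not a vertex of H. *)
Definition villain_corr_sub (R : realType) (V : choiceType) (e : rel V)
    (beta : R) (x y : V) (H : fin_subgraph e) : R :=
  match insub x, insub y with
  | Some a, Some b =>
      villain_corr_fin (fun u v : sg_vertices H => sg_adj H (val u) (val v))
        beta a b
  | _, _ => 0
  end.

Definition villain_corr (R : realType) (V : choiceType) (e : rel V) (beta : R)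
    (x y : V) : R :=
  lim (villain_corr_sub beta x y H @[H --> exhaustion e]).

(* [\esum] is the sum of a family of nonnegative extended reals; it does not
   presuppose that spheres are finite. *)
Definition sphere_sum (R : realType) (V : choiceType) (e : rel V) (beta : R)
    (L : nat) (x : V) : \bar R :=
  (\esum_(y in [set y | graph_dist e x y = L]) (villain_corr e beta x y)%:E)%E.

(* Main.v *)
Require Import Defs.
From mathcomp Require Import all_boot all_order all_algebra finmap.
From mathcomp Require Import all_classical all_reals all_analysis.
From mathcomp Require Import zify lra.

Set Implicit Arguments.
Unset Strict Implicit.
Unset Printing Implicit Defensive.

Import Order.TTheory GRing.Theory Num.Theory.
Import numFieldNormedType.Exports.

Local Open Scope classical_set_scope.
Local Open Scope ring_scope.

(* Expanding every edge weight in its Fourier series, which is again Gaussian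
   (theta identity), turns the correlations into ratios [Z(g) / Z(0)] where
   [Z(g)] is the sum over the integer currents with divergence [g] of the
   Gaussian weights [exp(- n ^ 2 / (2 beta))].
   The rotation [(k, l) -> (k + l, k - l)] on each edge gives
   [Z(g) Z(h) = \sum_p Y_p(g + h) Y_p(g - h)], [p] ranging over the parity
   classes of the currents. By AM-GM this is Ginibre's inequality, hence the
   monotonicity in the volume and the existence of the limit.
   It also reduces Simon's inequality
   [<x, y> <= \sum_(z in S) <x, z> <z, y>], for [S] separating [x] from [y], to
   [Y_p(x - y) <= \sum_(z in S) Y_p(x + y - 2 z)] for each [p]. For the function
   counting the orientations of a finite multigraph with a given divergence,
   this follows by removing the edges of a path from [x] to [S] one at a time,
   since both sides satisfy the same recursion; by the finite Jacobi triple
   product the Gaussian weights on a parity class are limits of positive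
   combinations of such counting functions.
   Finally a sphere of radius [L] separates [x] from the vertices at distance at
   least [L], so iterating Simon's inequality gives exponential decay as soon as
   all sums over spheres of some radius [L] are bounded by some [q < 1]. The
   maximum over [x] is attained because tameness and periodicity leave finitely
   many orbits of vertices. *)

(** * Sums over boxes of integers *)

(** Duplication gives [Z(x - y) Z(0) = \sum_p Y_p(x - y) ^ 2] and [Z(x - z) Z(z - y) = \sum_p Y_p(x
    - y) Y_p(x + y - 2 z)]. The common factor [Y_p(x - y) >= 0] is what allows a comparison class by
    class. An edge whose current ranges over all integers of one parity offers nothing to remove. It
    is replaced by a bundle of [m] parallel edges, [m] of that parity, each carrying current 1 or
    -1. The total current of one bundle has binomial weights, not Gaussian ones, so bundles of
    several sizes are mixed; the mixing coefficients must be nonnegative for an inequality to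
    survive. Currents are kept in finite boxes as long as possible. The duplication identity then
    becomes two inequalities between boxes of different sizes, and limits are taken on the final
    inequalities only. The Fourier expansion of the edge weight is required up to a constant factor
    only, because that factor cancels in the correlations. *)

Lemma ler_sum_inj (R : numDomainType) (I J : eqType) (s : seq I) (t : seq J)
    (h : I -> J) (F : J -> R) :
  uniq s -> {in s &, injective h} -> {in s, forall i, h i \in t} ->
  {in t, forall j, 0 <= F j} ->
  \sum_(i <- s) F (h i) <= \sum_(j <- t) F j.
Proof.
elim: s t => [|i s IH] t /=.
  by move=> _ _ _ F_ge0; rewrite big_nil big_seq sumr_ge0.
case/andP=> iNs uniq_s h_inj h_t F_ge0; rewrite big_cons.
have hi_t : h i \in t by apply: h_t; rewrite mem_head.
rewrite (perm_big _ (perm_to_rem hi_t)) big_cons lerD2l; apply: IH => //.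
- by move=> a b a_s b_s; apply: h_inj; rewrite in_cons ?a_s ?b_s orbT.
- move=> a a_s; have := h_t a; rewrite in_cons a_s orbT => /(_ isT).
  rewrite (perm_mem (perm_to_rem hi_t)) in_cons => /orP[/eqP|//].
  move=> /h_inj; rewrite !in_cons a_s eqxx orbT => /(_ isT isT) a_i.
  by rewrite a_i in a_s; rewrite a_s in iNs.
- by move=> j j_rem; apply: F_ge0; apply: mem_rem j_rem.
Qed.

Lemma ler_sum_sub (R : numDomainType) (I : eqType) (s t : seq I) (F : I -> R) :
  uniq s -> {subset s <= t} -> {in t, forall j, 0 <= F j} ->
  \sum_(i <- s) F i <= \sum_(j <- t) F j.
Proof. by move=> us st F0; apply: (@ler_sum_inj _ _ _ s t id). Qed.

Fixpoint box (M : nat) : seq int :=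
  if M is M'.+1 then M%:Z :: - M%:Z :: box M' else [:: 0].

Lemma mem_box M k : (k \in box M) = (`|k| <= M)%N.
Proof.
elim: M => [|M IH] /=; first by rewrite inE; lia.
by rewrite !in_cons IH; lia.
Qed.

Lemma box_uniq M : uniq (box M).
Proof. by elim: M => [//|M IH] /=; rewrite in_cons !mem_box IH; lia. Qed.

Lemma box_sub M N : (M <= N)%N -> {subset box M <= box N}.
Proof. by move=> MN k; rewrite !mem_box => /leq_trans; apply. Qed.

Lemma big_boxN (V : nmodType) M (F : int -> V) :
  \sum_(k <- box M) F (- k) = \sum_(k <- box M) F k.
Proof.
elim: M => [|M IH] /=; first by rewrite !big_seq1 oppr0.
by rewrite !big_cons IH opprK addrCA.
Qed.

(** [k + l] and [k - l] have the same parity and are bounded by [2 M], so the change of variables is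
    injective into the larger box, in general not onto. *)
Lemma box_dup_le (R : numDomainType) M (F : int -> int -> R) :
  (forall s t, 0 <= F s t) ->
  \sum_(k <- box M) \sum_(l <- box M) F (k + l) (k - l) <=
  \sum_(s <- box M.*2) \sum_(t <- box M.*2)
    (if odd `|s| == odd `|t| then F s t else 0).
Proof.
move=> F_ge0.
pose F' (p : int * int) := if odd `|p.1| == odd `|p.2| then F p.1 p.2 else 0.
pose h (p : int * int) := (p.1 + p.2, p.1 - p.2).
rewrite -(big_allpairs (F:=F')).
have -> : \sum_(k <- box M) \sum_(l <- box M) F (k + l) (k - l) =
          \sum_(p <- [seq (k, l) | k <- box M, l <- box M]) F' (h p).
  rewrite big_allpairs; apply: eq_bigr => k _; apply: eq_bigr => l _.
  by rewrite /F' /h /= ifT//; lia.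
apply: ler_sum_inj.
- by rewrite allpairs_uniq ?box_uniq// => -[a b] [c d].
- by move=> [a b] [c d] _ _ [/= ? ?]; congr (_, _); lia.
- move=> _ /allpairsP[[k l] /= [+ + ->]]; rewrite !mem_box => kM lM.
  by apply/allpairsP; exists (k + l, k - l); rewrite /= !mem_box; split=> //; lia.
- by move=> [s t] _; rewrite /F'; case: ifP.
Qed.

(** The inverse change [k = (s + t) / 2], [l = (s - t) / 2] is integral on pairs of equal parity and
    does not leave the box. *)
Lemma box_dup_ge (R : numDomainType) M (F : int -> int -> R) :
  (forall s t, 0 <= F s t) ->
  \sum_(s <- box M) \sum_(t <- box M)
    (if odd `|s| == odd `|t| then F s t else 0) <=
  \sum_(k <- box M) \sum_(l <- box M) F (k + l) (k - l).
Proof.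
move=> F_ge0.
pose F' (p : int * int) := F (p.1 + p.2) (p.1 - p.2).
pose h (p : int * int) := (((p.1 + p.2) %/ 2)%Z, ((p.1 - p.2) %/ 2)%Z).
pose ev (p : int * int) := odd `|p.1| == odd `|p.2|.
rewrite -(big_allpairs (F:=F')).
have hK p : ev p -> F' (h p) = F p.1 p.2.
  by case: p => s t; rewrite /ev /F' /h /= => e_st; congr F; lia.
have -> : \sum_(s <- box M) \sum_(t <- box M)
    (if odd `|s| == odd `|t| then F s t else 0) =
    \sum_(p <- [seq x <- [seq (s, t) | s <- box M, t <- box M] | ev x]) F' (h p).
  rewrite [RHS]big_filter [RHS]big_mkcond [RHS]big_allpairs.
  apply: eq_bigr => s _; apply: eq_bigr => t _.
  by rewrite /ev /=; case: ifP => // e; rewrite hK.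
apply: ler_sum_inj.
- by rewrite filter_uniq// allpairs_uniq ?box_uniq// => -[a b] [c d].
- move=> [a b] [c d]; rewrite !mem_filter /ev /h /= => /andP[+ _] /andP[+ _].
  by move=> e1 e2 [e3 e4]; congr (_, _); lia.
- move=> p; rewrite mem_filter => /andP[+ /allpairsP[[s t] /= [+ + ->]]].
  rewrite !mem_box /ev /= => e sM tM.
  apply/allpairsP; exists (((s + t) %/ 2)%Z, ((s - t) %/ 2)%Z).
  by rewrite /= !mem_box; split=> //; lia.
- by move=> [s t] _; rewrite /F'.
Qed.

(** * Integer currents *)

Section Flow.
Variables (R : realFieldType) (G : zmodType).
Implicit Types (B : seq int) (D : seq (G * (int -> R))) (g : G).

(* The sum of [\prod_i f_i (n_i)] over the integers [n_i] in [B] such that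
   [\sum_i d_i *~ n_i = g], for [D] the list of the pairs [(d_i, f_i)]. *)
Fixpoint flow_sum B D g : R :=
  if D is (d, f) :: D' then
    \sum_(k <- B) f k * flow_sum B D' (g - d *~ k)
  else (g == 0)%:R.

Definition nonneg D := {in D, forall x k, 0 <= x.2 k}.

Lemma flow_sum_ge0 B D g : nonneg D -> 0 <= flow_sum B D g.
Proof.
elim: D g => [|[d f] D IH] g D0 /=; first exact: ler0n.
apply: sumr_ge0 => k _; apply: mulr_ge0.
  by apply: (D0 (d, f)); rewrite mem_head.
by apply: IH => x xD; apply: D0; rewrite in_cons xD orbT.
Qed.

(** Used with [c = 1] to enlarge the box, and with [c] built from [qfact] to exchange Gaussian
    weights and their approximations, at the cost of one factor [c] per edge. *)
Lemma flow_sum_le (T : eqType) B B' (c : R) (ds : seq T) (dir : T -> G)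
    (f f' : T -> int -> R) g : 0 <= c ->
  uniq B -> {subset B <= B'} ->
  (forall x k, 0 <= f x k) -> (forall x k, 0 <= f' x k) ->
  (forall x k, x \in ds -> k \in B -> f x k <= c * f' x k) ->
  flow_sum B [seq (dir x, f x) | x <- ds] g <=
  c ^+ size ds * flow_sum B' [seq (dir x, f' x) | x <- ds] g.
Proof.
move=> c0 uB BB' f0 f'0; elim: ds g => [|x ds IH] g ff' /=.
  by rewrite expr0 mul1r.
have nn h : (forall x k, 0 <= h x k) -> nonneg [seq (dir x, h x) | x <- ds].
  by move=> h0 _ /mapP[y _ ->] k; apply: h0.
have ff'ds y k : y \in ds -> k \in B -> f y k <= c * f' y k.
  by move=> yds; apply: ff'; rewrite in_cons yds orbT.
apply: (@le_trans _ _ (\sum_(k <- B) c * f' x k *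
   (c ^+ size ds * flow_sum B' [seq (dir x, f' x) | x <- ds] (g - dir x *~ k)))).
  rewrite big_seq [leRHS]big_seq; apply: ler_sum => k kB; apply: ler_pM => //.
  - exact/flow_sum_ge0/nn.
  - by apply: ff'; rewrite ?mem_head.
  - exact: IH.
rewrite exprS mulr_sumr; under eq_bigr do rewrite mulrACA.
apply: ler_sum_sub => // k _; rewrite !mulr_ge0 ?exprn_ge0//.
exact/flow_sum_ge0/nn.
Qed.

Lemma flow_sumN M D g : {in D, forall x k, x.2 (- k) = x.2 k} ->
  flow_sum (box M) D (- g) = flow_sum (box M) D g.
Proof.
elim: D g => [|[d f] D IH] g even_D /=; first by rewrite oppr_eq0.
rewrite -[RHS]big_boxN; apply: eq_bigr => k _; congr (_ * _).
  by have /= -> := even_D (d, f) (mem_head _ _) k.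
rewrite -IH ?mulrNz ?opprB ?opprK 1?addrC//.
by move=> x xD; apply: even_D; rewrite in_cons xD orbT.
Qed.

Lemma flow_sum_flip M d f D g : (forall k, f (- k) = f k) ->
  flow_sum (box M) ((- d, f) :: D) g = flow_sum (box M) ((d, f) :: D) g.
Proof.
move=> even_f /=; rewrite -[RHS]big_boxN; apply: eq_bigr => k _.
by rewrite even_f mulrNz mulNrz.
Qed.

Lemma flow_sum_swap B x y D g :
  flow_sum B (x :: y :: D) g = flow_sum B (y :: x :: D) g.
Proof.
case: x y => [d f] [d' f'] /=.
under eq_bigr do rewrite mulr_sumr; rewrite exchange_big /=.
apply: eq_bigr => l _; rewrite mulr_sumr; apply: eq_bigr => k _.
by rewrite mulrCA addrAC.
Qed.

Lemma flow_sum_cons B d f D D' :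
  flow_sum B D =1 flow_sum B D' ->
  flow_sum B ((d, f) :: D) =1 flow_sum B ((d, f) :: D').
Proof. by move=> e g /=; apply: eq_bigr => k _; rewrite e. Qed.

Lemma flow_sum_mid B D1 x D2 :
  flow_sum B (D1 ++ x :: D2) =1 flow_sum B (x :: D1 ++ D2).
Proof.
elim: D1 => [//|[d f] D1 IH] g; rewrite cat_cons (flow_sum_cons _ _ IH).
exact: flow_sum_swap.
Qed.

End Flow.

(** Meant for [h] the restriction of functions to a subset of the vertices: it detects zero only on
    functions supported there, so [P] records the support along the recursion. *)
Lemma eq_flow_sum_hom (R : realFieldType) (G G' : zmodType) (h : G -> G')
    (T : Type) (ds : seq T) (dir : T -> G) (dir' : T -> G') (f : T -> int -> R)
    (P : G -> Prop) B g :
  (forall x, P x -> (h x == 0) = (x == 0)) ->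
  (forall x d k, P x -> P (x - dir d *~ k)) ->
  (forall x d k, P x -> h (x - dir d *~ k) = h x - dir' d *~ k) ->
  P g ->
  flow_sum B [seq (dir x, f x) | x <- ds] g =
  flow_sum B [seq (dir' x, f x) | x <- ds] (h g).
Proof.
move=> h0 Pdir hdir; elim: ds g => [|x ds IH] g Pg /=; first by rewrite h0.
by apply: eq_bigr => k _; rewrite IH ?hdir//; apply: Pdir.
Qed.
(** The bound is a partial geometric sum; keeping its factor [1 - r ^+ j] makes the induction on [j]
    close. *)
Lemma box_tail (R : realFieldType) (C r : R) (f : int -> R) (N j : nat) :
  0 <= C -> 0 <= r < 1 -> (forall k, (N < `|k|)%N -> `|f k| <= C * r ^+ `|k|) ->
  `|\sum_(k <- box (N + j)) f k - \sum_(k <- box N) f k| <=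
  2 * C * r ^+ N / (1 - r) * (1 - r ^+ j).
Proof.
move=> C0 /andP[r0 r1] fle; have r1' : 0 < 1 - r by rewrite subr_gt0.
elim: j => [|j IH]; first by rewrite addn0 !subrr normr0 mulr0.
rewrite addnS /= !big_cons -[_ - _]addrA -[_ + _ - _ in X in `|_ + X|]addrA.
have f1 : `|f (N + j).+1%:Z| <= C * r ^+ (N + j).+1 by apply: fle; lia.
have f2 : `|f (- (N + j).+1%:Z)| <= C * r ^+ (N + j).+1.
  by rewrite -[X in r ^+ X]/(`|(N + j).+1%:Z|%N) -abszN; apply: fle; lia.
apply: le_trans (ler_normD _ _) _; apply: le_trans (lerD f1 (ler_normD _ _)) _.
apply: le_trans (lerD (lexx _) (lerD f2 IH)) _.
have -> : r ^+ (N + j).+1 = r * (r ^+ N * r ^+ j) by rewrite exprS exprD.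
have -> : 2 * C * r ^+ N / (1 - r) * (1 - r ^+ j.+1) =
   2 * C * r ^+ N / (1 - r) * (1 - r ^+ j) + 2 * (C * (r ^+ N * r ^+ j)).
  have <- : (1 - r)^-1 * (1 - r) * (2 * (C * (r ^+ N * r ^+ j))) =
            2 * (C * (r ^+ N * r ^+ j)) by rewrite mulVf ?mul1r// lt0r_neq0.
  by rewrite exprS; set y := _^-1; lra.
have : C * (r * (r ^+ N * r ^+ j)) <= C * (r ^+ N * r ^+ j).
  by apply: ler_wpM2l => //; rewrite ler_piMl ?mulr_ge0 ?exprn_ge0// ltW.
by set a := C * _; set b := C * _; lra.
Qed.

Lemma box_tail_le (R : realFieldType) (C r : R) (f : int -> R) (N M : nat) :
  0 <= C -> 0 <= r < 1 -> (forall k, (N < `|k|)%N -> `|f k| <= C * r ^+ `|k|) ->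
  (N <= M)%N ->
  `|\sum_(k <- box M) f k - \sum_(k <- box N) f k| <= 2 * C * r ^+ N / (1 - r).
Proof.
move=> C0 r01 fle NM; rewrite -(subnKC NM).
apply: le_trans (box_tail (M - N) C0 r01 fle) _.
move/andP: r01 => [r0 r1].
rewrite ler_piMr ?gerBl ?exprn_ge0// mulr_ge0 ?invr_ge0 ?subr_ge0 ?(ltW r1)//.
by rewrite !mulr_ge0 ?exprn_ge0.
Qed.

(** * Gaussian weights *)

Section Gauss.
Variable R : realType.

Definition gauss (a : R) (k : int) : R := expR (- (a * k%:~R ^+ 2)).

Lemma gauss_ge0 a k : 0 <= gauss a k. Proof. exact: expR_ge0. Qed.
Lemma gauss0 a : gauss a 0 = 1.
Proof. by rewrite /gauss expr2 !mulr0 oppr0 expR0. Qed.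
Lemma gaussN a k : gauss a (- k) = gauss a k.
Proof. by rewrite /gauss rmorphN sqrrN. Qed.

(** The parallelogram identity. It halves the exponent, which is why currents carry [2 * a]
    below. *)
Lemma gauss_dup a k l :
  gauss (2 * a) k * gauss (2 * a) l = gauss a (k + l) * gauss a (k - l).
Proof.
rewrite /gauss -!expRD rmorphD rmorphB /=; congr expR.
by set x : R := k%:~R; set y : R := l%:~R; lra.
Qed.

Lemma gauss_le_geom (a : R) k : 0 < a -> gauss a k <= expR (- a) ^+ `|k|.
Proof.
move=> a0; rewrite -expRM_natr ler_expR mulNr lerN2 ler_wpM2l ?(ltW a0)//.
rewrite [leLHS]pmulrn -rmorphXn /= ler_int; nia.
Qed.

Lemma geom_ratio (a : R) : 0 < a -> 0 <= expR (- a) < 1.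
Proof. by move=> a0; rewrite expR_ge0 -expR0 ltr_expR oppr_lt0. Qed.

Lemma gauss_box_bounded (a : R) : 0 < a ->
  exists C, forall M, \sum_(k <- box M) gauss a k <= C.
Proof.
move=> a0; exists (1 + 2 * 1 * expR (- a) ^+ 0 / (1 - expR (- a))) => M.
have := @box_tail_le _ 1 (expR (- a)) (gauss a) 0 M ler01 (geom_ratio a0).
rewrite /= big_seq1 gauss0 => tail.
have : `|\sum_(k <- box M) gauss a k - 1| <=
  2 * 1 * expR (- a) ^+ 0 / (1 - expR (- a)).
  apply: tail => // k _; rewrite ger0_norm ?gauss_ge0// mul1r.
  exact: gauss_le_geom.
by move/ler_normlP => [_]; lra.
Qed.

End Gauss.

(** * Duplication of Gaussian currents *)

Section Currents.
Variables (R : realType) (G : zmodType) (a : R).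
Hypothesis a_gt0 : 0 < a.
Implicit Types (ds : seq G) (g : G).

Definition cur_box M ds g : R :=
  flow_sum (box M) [seq (d, gauss (2 * a)) | d <- ds] g.

Definition parity (b : bool) (f : int -> R) (k : int) : R :=
  if odd `|k|%N == b then f k else 0.

Definition dup_box M ds (p : seq bool) g : R :=
  flow_sum (box M) [seq (x.1, parity x.2 (gauss a)) | x <- zip ds p] g.

Fixpoint bits n : seq (seq bool) :=
  if n is n'.+1 then map (cons false) (bits n') ++ map (cons true) (bits n')
  else [:: [::]].

Lemma cur_box_ge0 M ds g : 0 <= cur_box M ds g.
Proof.
by apply: flow_sum_ge0 => _ /mapP[d _ ->] k; rewrite /= gauss_ge0.
Qed.

Lemma parity_ge0 b k : 0 <= parity b (gauss a) k.
Proof. by rewrite /parity; case: ifP => // _; exact: gauss_ge0. Qed.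

Lemma dup_box_ge0 M ds p g : 0 <= dup_box M ds p g.
Proof.
by apply: flow_sum_ge0 => _ /mapP[d _ ->] k; exact: parity_ge0.
Qed.

Lemma dup_box_mono M N ds p g : (M <= N)%N -> dup_box M ds p g <= dup_box N ds p g.
Proof.
move=> MN; rewrite -[leRHS]mul1r -(expr1n _ (size (zip ds p))).
apply: flow_sum_le => //.
- exact: box_uniq.
- exact: box_sub.
- by move=> *; apply: parity_ge0.
- by move=> *; apply: parity_ge0.
- by move=> *; rewrite mul1r.
Qed.

Definition dup_sum M ds g h : R :=
  \sum_(p <- bits (size ds)) dup_box M ds p g * dup_box M ds p h.

(** Summing over the parity bit of the first edge leaves the condition that its two currents have
    equal parity. *)
Lemma dup_sum_cons M d ds g h : dup_sum M (d :: ds) g h =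
  \sum_(s <- box M) \sum_(t <- box M)
    (if odd `|s|%N == odd `|t|%N then
      gauss a s * gauss a t * dup_sum M ds (g - d *~ s) (h - d *~ t) else 0).
Proof.
rewrite /dup_sum /= big_cat /= !big_map -big_split /=.
transitivity (\sum_(p <- bits (size ds)) \sum_(s <- box M) \sum_(t <- box M)
    (if odd `|s|%N == odd `|t|%N then
      gauss a s * gauss a t *
      (dup_box M ds p (g - d *~ s) * dup_box M ds p (h - d *~ t)) else 0)).
  apply: eq_bigr => p _; rewrite /dup_box /=.
  rewrite !mulr_suml -big_split; apply: eq_bigr => s _ /=.
  rewrite !mulr_sumr -big_split; apply: eq_bigr => t _ /=.
  rewrite /parity; case: (odd `|s|); case: (odd `|t|);
    rewrite /= ?(mul0r, mulr0, add0r, addr0)//; exact: mulrACA.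
rewrite exchange_big; apply: eq_bigr => s _.
rewrite exchange_big; apply: eq_bigr => t _ /=.
by case: ifP => _; rewrite ?mulr_sumr// big1.
Qed.

Lemma dup_sum_ge0 M ds g h : 0 <= dup_sum M ds g h.
Proof. by apply: sumr_ge0 => p _; apply: mulr_ge0; exact: dup_box_ge0. Qed.

Lemma cur_box_cons M d ds g : cur_box M (d :: ds) g =
  \sum_(k <- box M) gauss (2 * a) k * cur_box M ds (g - d *~ k).
Proof. by []. Qed.

Lemma cur_box_mulE M d ds g h : cur_box M (d :: ds) g * cur_box M (d :: ds) h =
  \sum_(k <- box M) \sum_(l <- box M) gauss a (k + l) * gauss a (k - l) *
    (cur_box M ds (g - d *~ k) * cur_box M ds (h - d *~ l)).
Proof.
rewrite !cur_box_cons mulr_suml; apply: eq_bigr => k _.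
rewrite mulr_sumr; apply: eq_bigr => l _.
by rewrite mulrACA gauss_dup.
Qed.

Lemma dup_shift (d g h : G) k l :
  g - d *~ k + (h - d *~ l) = g + h - d *~ (k + l).
Proof. by rewrite addrACA mulrzDr opprD. Qed.

Lemma dup_shiftB (d g h : G) k l :
  g - d *~ k - (h - d *~ l) = g - h - d *~ (k - l).
Proof. by rewrite mulrzBr !opprD addrACA. Qed.

(* The change of variables [s = k + l], [t = k - l] turns the product of two
   Gaussian currents into a product of two Gaussian currents constrained to
   have the same parity on every edge. *)
Lemma cur_box_dup_le M ds g h :
  cur_box M ds g * cur_box M ds h <= dup_sum M.*2 ds (g + h) (g - h).
Proof.
elim: ds g h => [|d ds IH] g h.
  rewrite /dup_sum /= big_seq1 /cur_box /dup_box /=.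
  have [->|] := eqVneq g 0; last by rewrite mul0r mulr_ge0.
  by rewrite add0r sub0r oppr_eq0; case: (h == 0); rewrite ?(mul0r, mulr0, mul1r).
rewrite cur_box_mulE dup_sum_cons.
pose F s t := gauss a s * gauss a t *
   dup_sum M.*2 ds (g + h - d *~ s) (g - h - d *~ t).
apply: le_trans (box_dup_le M (F := F) _); last first.
  by move=> s t; rewrite /F !mulr_ge0 ?gauss_ge0 ?dup_sum_ge0.
apply: ler_sum => k _; apply: ler_sum => l _.
rewrite /F ler_wpM2l ?mulr_ge0 ?gauss_ge0//.
by rewrite -dup_shift -dup_shiftB; exact: IH.
Qed.

(** Excluding 2-torsion matters in the edgeless case, where [g + h = g - h = 0] has to force
    [g = h = 0]. *)
Lemma cur_box_dup_ge M ds g h :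
  (forall x : G, x + x = 0 -> x = 0) ->
  dup_sum M ds (g + h) (g - h) <= cur_box M ds g * cur_box M ds h.
Proof.
move=> tf; elim: ds g h => [|d ds IH] g h.
  rewrite /dup_sum /= big_seq1 /cur_box /dup_box /=.
  have [e1|] := eqVneq (g + h) 0; last by rewrite mul0r mulr_ge0.
  have [e2|] := eqVneq (g - h) 0; last by rewrite mulr0 mulr_ge0.
  have g0 : g = 0 by apply: tf; rewrite -[RHS]e1 (subr0_eq e2).
  by move: e1; rewrite g0 add0r => ->; rewrite eqxx.
rewrite cur_box_mulE dup_sum_cons.
pose F s t := gauss a s * gauss a t *
   dup_sum M ds (g + h - d *~ s) (g - h - d *~ t).
apply: le_trans (box_dup_ge M (F := F) _) _.
  by move=> s t; rewrite /F !mulr_ge0 ?gauss_ge0 ?dup_sum_ge0.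
apply: ler_sum => k _; apply: ler_sum => l _.
rewrite /F ler_wpM2l ?mulr_ge0 ?gauss_ge0//.
by rewrite -dup_shift -dup_shiftB; exact: IH.
Qed.
End Currents.

(** * Ginibre's inequality and monotonicity in the edges *)

Section InfiniteCurrents.
Variables (R : realType) (G : zmodType) (a : R).
Hypothesis a_gt0 : 0 < a.
Hypothesis double_inj : forall x : G, x + x = 0 -> x = 0.
Implicit Types (ds : seq G) (g h : G).

Local Notation cur_box := (cur_box a).

Definition cur ds g : R := sup (range (fun M => cur_box M ds g)).

Lemma cur_box_mono ds g : {homo cur_box ^~ ds ^~ g : M N / (M <= N)%N >-> M <= N}.
Proof.
move=> M N MN; rewrite -[leRHS]mul1r -(expr1n _ (size ds)).
apply: flow_sum_le => //.
- exact: box_uniq.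
- exact: box_sub.
- by move=> *; apply: gauss_ge0.
- by move=> *; apply: gauss_ge0.
- by move=> *; rewrite mul1r.
Qed.

Lemma cur_box_bounded ds : exists C, forall M g, cur_box M ds g <= C.
Proof.
elim: ds => [|d ds [C hC]]; first by exists 1 => M g; rewrite /cur_box /= lern1 leq_b1.
have [D hD] := gauss_box_bounded (mulr_gt0 (@ltr0Sn R 1) a_gt0).
exists (D * C) => M g; rewrite cur_box_cons.
apply: (@le_trans _ _ (\sum_(k <- box M) gauss (2 * a) k * C)).
  by apply: ler_sum => k _; rewrite ler_wpM2l ?gauss_ge0.
rewrite -mulr_suml ler_wpM2r ?hD// (le_trans _ (hC 0%N 0))//.
exact: cur_box_ge0.
Qed.

Lemma cur_box_cvg ds g : cur_box M ds g @[M --> \oo] --> cur ds g.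
Proof.
apply: nondecreasing_cvgn; first exact: cur_box_mono.
by have [C hC] := cur_box_bounded ds; exists C => _ [M _ <-].
Qed.

Lemma cur_box_le M ds g : cur_box M ds g <= cur ds g.
Proof.
apply: (cvgr_to_ge (@cur_box_cvg ds g)); near=> N; apply: cur_box_mono.
by near: N; exists M.
Unshelve. all: by end_near. Qed.

Lemma cur_le ds g c : (forall M, cur_box M ds g <= c) -> cur ds g <= c.
Proof. by move=> le_c; apply: (cvgr_to_le (@cur_box_cvg ds g)); near=> N. 
Unshelve. all: by end_near. Qed.

Lemma cur_ge0 ds g : 0 <= cur ds g.
Proof. exact: le_trans (cur_box_ge0 a 0 ds g) (cur_box_le _ _ _). Qed.

Lemma cur0_ge1 ds : 1 <= cur ds 0.
Proof.
apply: le_trans (cur_box_le 0 ds 0).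
elim: ds => [|d ds IH]; first by rewrite /cur_box /= eqxx.
by rewrite cur_box_cons big_seq1 gauss0 mul1r mulr0z subr0.
Qed.

Lemma cur0_gt0 ds : 0 < cur ds 0.
Proof. exact: lt_le_trans ltr01 (cur0_ge1 ds). Qed.

Lemma cur_boxN M ds g : cur_box M ds (- g) = cur_box M ds g.
Proof. by apply: flow_sumN => _ /mapP[d _ ->] k /=; exact: gaussN. Qed.


(** In each parity class [2 y z <= y ^ 2 + z ^ 2]; the sums of squares turn back into products of
    currents ([sq]) by the reverse duplication with second divergence 0. *)
Lemma cur_box_ginibre M ds g h :
  2 * (cur_box M ds g * cur_box M ds h) <=
  cur ds 0 * (cur ds (g + h) + cur ds (g - h)).
Proof.
apply: (@le_trans _ _ (2 * dup_sum a M.*2 ds (g + h) (g - h))).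
  by rewrite ler_wpM2l ?cur_box_dup_le.
have sq x : dup_sum a M.*2 ds x x <= cur ds 0 * cur ds x.
  have := cur_box_dup_ge a M.*2 ds x 0 double_inj.
  rewrite addr0 subr0 => /le_trans; apply; rewrite mulrC.
  by apply: ler_pM; rewrite ?cur_box_ge0 ?cur_box_le.
rewrite mulrDr; apply: le_trans (lerD (sq _) (sq _)).
rewrite /dup_sum mulr_sumr -big_split /=; apply: ler_sum => p _.
set y := dup_box _ _ _ _ _; set z := dup_box _ _ _ _ _.
by have := sqr_ge0 (y - z); rewrite !expr2; lra.
Qed.

Lemma cur_ginibre ds g h :
  2 * (cur ds g * cur ds h) <= cur ds 0 * (cur ds (g + h) + cur ds (g - h)).
Proof.
have cv : 2 * (cur_box M ds g * cur_box M ds h) @[M --> \oo] -->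
    2 * (cur ds g * cur ds h).
  by apply: cvgM; [exact: cvg_cst|apply: cvgM; exact: cur_box_cvg].
apply: (cvgr_to_le cv); near=> M; exact: cur_box_ginibre.
Unshelve. all: by end_near. Qed.

(* If [m] is the supremum of [cur ds g / cur ds 0] over [g], Ginibre's
   inequality with [h = g] gives [2 m ^ 2 <= m + 1]. *)
Lemma cur_le0 ds g : cur ds g <= cur ds 0.
Proof.
have [C hC] := cur_box_bounded ds.
have ub : has_ubound (range (cur ds)) by exists C => _ [x _ <-]; exact: cur_le.
pose m := sup (range (cur ds)).
have le_m x : cur ds x <= m by apply: ub_le_sup => //; exists x.
have m0 : 0 < m := lt_le_trans (cur0_gt0 ds) (le_m 0).
have sq x : cur ds x ^+ 2 <= cur ds 0 * m.
  have := cur_ginibre ds x x; rewrite subrr.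
  have : cur ds 0 * (cur ds (x + x) + cur ds 0) <= cur ds 0 * (m + m).
    by rewrite ler_wpM2l ?cur_ge0// lerD.
  by rewrite expr2; lra.
have m2 : m ^+ 2 <= cur ds 0 * m.
  rewrite -ler_sqrt ?sqrtr_sqr ?(gtr0_norm m0) ?mulr_ge0 ?cur_ge0 ?(ltW m0)//.
  apply: ge_sup; first by exists (cur ds 0), 0.
  move=> _ [x _ <-]; rewrite -[leLHS]ger0_norm ?cur_ge0// -sqrtr_sqr.
  by rewrite ler_sqrt ?mulr_ge0 ?cur_ge0 ?(ltW m0).
by apply: le_trans (le_m g) _; rewrite -(ler_pM2r m0).
Qed.

Definition corr ds g := cur ds g / cur ds 0.

Lemma corr_ge0 ds g : 0 <= corr ds g.
Proof. by rewrite divr_ge0 ?cur_ge0. Qed.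

Lemma corr_le1 ds g : corr ds g <= 1.
Proof. by rewrite ler_pdivrMr ?cur0_gt0// mul1r cur_le0. Qed.

Lemma corr0 ds : corr ds 0 = 1.
Proof. by rewrite /corr divff// lt0r_neq0// cur0_gt0. Qed.

Lemma cur_cons_ge M d ds g :
  \sum_(k <- box M) gauss (2 * a) k * cur ds (g - d *~ k) <= cur (d :: ds) g.
Proof.
have cv : \sum_(k <- box M) gauss (2 * a) k * cur_box N ds (g - d *~ k)
    @[N --> \oo] --> \sum_(k <- box M) gauss (2 * a) k * cur ds (g - d *~ k).
  apply: cvg_big => [|k _]; first exact: add_continuous.
  by apply: cvgM; [exact: cvg_cst|exact: cur_box_cvg].
apply: (cvgr_to_le cv); near=> N.
apply: le_trans (cur_box_le N _ _); rewrite cur_box_cons.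
apply: ler_sum_sub; first exact: box_uniq.
  by apply: box_sub; near: N; exists M.
by move=> k _; rewrite mulr_ge0 ?gauss_ge0 ?cur_box_ge0.
Unshelve. all: by end_near. Qed.

(** The current [k] on the new edge has an even weight, so [g - d *~ k] may be averaged with
    [g + d *~ k]; Ginibre's inequality for [g] and [d *~ k] then bounds each term. *)
Lemma corr_cons d ds g : corr ds g <= corr (d :: ds) g.
Proof.
rewrite /corr ler_pdivrMr ?cur0_gt0// mulrAC ler_pdivlMr ?cur0_gt0//.
have cv : cur ds g * cur_box M (d :: ds) 0 @[M --> \oo] -->
          cur ds g * cur (d :: ds) 0.
  by apply: cvgM; [exact: cvg_cst|exact: cur_box_cvg].
apply: (cvgr_to_le cv); near=> M; rewrite cur_box_cons.
apply: (@le_trans _ _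
    (cur ds 0 * \sum_(k <- box M) gauss (2 * a) k * cur ds (g - d *~ k))).
  have -> : \sum_(k <- box M) gauss (2 * a) k * cur ds (g - d *~ k) =
      \sum_(k <- box M) gauss (2 * a) k *
         ((cur ds (g + d *~ k) + cur ds (g - d *~ k)) / 2).
    have e : \sum_(k <- box M) gauss (2 * a) k * cur ds (g + d *~ k) =
             \sum_(k <- box M) gauss (2 * a) k * cur ds (g - d *~ k).
      by rewrite -big_boxN; apply: eq_bigr => k _; rewrite gaussN mulrNz.
    under [RHS]eq_bigr do rewrite mulrA mulrDr.
    by rewrite -mulr_suml big_split /= e; lra.
  rewrite !mulr_sumr; apply: ler_sum => k _.
  rewrite sub0r mulrCA [leRHS]mulrCA ler_wpM2l ?gauss_ge0//.
  apply: (@le_trans _ _ (cur ds g * cur ds (d *~ k))).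
    by rewrite ler_wpM2l ?cur_ge0// cur_boxN cur_box_le.
  by have := cur_ginibre ds g (d *~ k); lra.
by rewrite mulrC ler_wpM2r ?cur_ge0// cur_cons_ge.
Unshelve. all: by end_near. Qed.

Lemma corr_cat ds1 ds2 g : corr ds2 g <= corr (ds1 ++ ds2) g.
Proof. by elim: ds1 => [//|d ds1 IH]; apply: le_trans IH (corr_cons _ _ _). Qed.

End InfiniteCurrents.
(** * Simon's inequality *)

Section Dipoles.
Variable V : choiceType.
Implicit Types (u v w x y z : V) (chi : V -> int).

Definition dirac_int x : V -> int := fun v => (v == x)%:Z.
Definition dipole (p : V * V) : V -> int := dirac_int p.1 - dirac_int p.2.

Lemma fun_int_double_inj chi : chi + chi = 0 -> chi = 0.
Proof.
move=> chi2; apply/funext => v.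
by have := congr1 (@^~ v) chi2; rewrite /= /GRing.add /= /GRing.zero /=; lia.
Qed.

Lemma dipoleN u v : dipole (v, u) = - dipole (u, v).
Proof. by rewrite /dipole opprB. Qed.

End Dipoles.

Ltac fun_int :=
  apply/funext => ?; rewrite /dipole /dirac_int ?fctE /=; lia.

Section Orientations.
Variables (R : realFieldType) (V : choiceType).
Implicit Types (u v w x y z : V) (chi : V -> int) (K : seq (V * V)).

(* The number of orientations of the multigraph [K] whose divergence is [chi]. *)
Fixpoint orientations K chi : R :=
  if K is p :: K' then
    orientations K' (chi - dipole p) + orientations K' (chi + dipole p)
  else (chi == 0)%:R.

Lemma orientations_ge0 K chi : 0 <= orientations K chi.
Proof. by elim: K chi => [|p K IH] chi /=; rewrite ?ler0n ?addr_ge0. Qed.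

Lemma orientationsN K chi : orientations K (- chi) = orientations K chi.
Proof.
elim: K chi => [|p K IH] chi /=; first by rewrite oppr_eq0.
have -> : - chi - dipole p = - (chi + dipole p) by fun_int.
have -> : - chi + dipole p = - (chi - dipole p) by fun_int.
by rewrite !IH addrC.
Qed.

(** Removal is by position, so that parallel edges are removed separately. *)
Fixpoint picks (T : Type) (s : seq T) : seq (T * seq T) :=
  if s is x :: s' then (x, s') :: [seq (p.1, x :: p.2) | p <- picks s']
  else [::].

Lemma picks_mem (T : eqType) (s : seq T) p : p \in picks s ->
  [/\ p.1 \in s, (size p.2 < size s)%N & {subset p.2 <= s}].
Proof.
elim: s p => [//|x s IH] p /=; rewrite in_cons => /orP[/eqP->|] /=.
  by split=> [||z zs]; rewrite ?in_cons ?eqxx ?zs ?orbT.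
move=> /mapP[r /IH[r1 r2 r3] ->] /=; split; rewrite ?in_cons ?r1 ?orbT//.
by move=> z; rewrite !in_cons => /orP[->//|/r3->]; rewrite orbT.
Qed.

(** Counts orientations with a marked edge leaving [v]: deleting that edge lowers the divergence by
    1 at [v] and raises it by 1 at the other end. *)
Definition unorient K v chi : R :=
  \sum_(p <- picks K | p.1.1 == v)
    orientations p.2 (chi - dirac_int v + dirac_int p.1.2) +
  \sum_(p <- picks K | p.1.2 == v)
    orientations p.2 (chi - dirac_int v + dirac_int p.1.1).

Definition degree K v : nat := \sum_(p <- K) ((p.1 == v) + (p.2 == v)).

Lemma unorient_cons p K v chi : unorient (p :: K) v chi =
  (if p.1 == v then orientations K (chi - dirac_int v + dirac_int p.2) else 0) +
  (if p.2 == v then orientations K (chi - dirac_int v + dirac_int p.1) else 0) +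
  (unorient K v (chi - dipole p) + unorient K v (chi + dipole p)).
Proof.
have e w : chi - dirac_int v + dirac_int w - dipole p =
           chi - dipole p - dirac_int v + dirac_int w.
  by fun_int.
have e' w : chi - dirac_int v + dirac_int w + dipole p =
            chi + dipole p - dirac_int v + dirac_int w.
  by fun_int.
rewrite /unorient /= !big_cons !big_map /=.
under eq_bigr do rewrite e e'; rewrite big_split /=.
under [X in _ + (if _ then _ + X else X)]eq_bigr do rewrite e e'.
rewrite [X in _ + (if _ then _ + X else X)]big_split /=.
by do 2!case: ifP => _; lra.
Qed.

Lemma dipole_at p v : dipole p v = (p.1 == v)%:Z - (p.2 == v)%:Z.
Proof. by rewrite [p.1 == v]eq_sym [p.2 == v]eq_sym. Qed.

(* Double counting the pairs formed by an orientation and an edge leaving [v]: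
   there are [(degree K v + chi v) / 2] such edges. *)
Lemma degree_orientations K v chi : {in K, forall p, p.1 != p.2} ->
  ((degree K v)%:Z + chi v)%:~R * orientations K chi = 2 * unorient K v chi.
Proof.
elim: K chi => [|p K IH] chi loopless.
  rewrite /unorient /= !big_nil /degree big_nil add0r addr0 mulr0.
  by case: eqVneq => [->|_]; rewrite ?mulr0// mul0r.
have loopless' : {in K, forall q, q.1 != q.2}.
  by move=> q qK; apply: loopless; rewrite in_cons qK orbT.
have {}IH chi' := IH chi' loopless'.
have uw : p.1 != p.2 := loopless p (mem_head _ _).
have IH1 := IH (chi - dipole p); have IH2 := IH (chi + dipole p).
have e1 : chi - dirac_int p.1 + dirac_int p.2 = chi - dipole p by fun_int.
have e2 : chi - dirac_int p.2 + dirac_int p.1 = chi + dipole p by fun_int.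
rewrite unorient_cons /degree big_cons -/(degree K v).
rewrite -[orientations (p :: K) chi]/(orientations K (chi - dipole p) +
   orientations K (chi + dipole p)).
move: IH1 IH2; set U1 := unorient _ _ _; set U2 := unorient _ _ _.
have -> : (chi - dipole p) v = chi v - dipole p v by [].
have -> : (chi + dipole p) v = chi v + dipole p v by [].
rewrite dipole_at.
have [uv|uv] := eqVneq p.1 v.
  have -> : (p.2 == v) = false by rewrite -uv eq_sym (negbTE uw).
  rewrite -uv e1; set A := orientations K (chi - _); set B := orientations K _.
  by rewrite /= !(PoszD, rmorphD, rmorphN) /=; lra.
have [wv|wv] := eqVneq p.2 v.
  rewrite -wv e2; set A := orientations K (chi - _); set B := orientations K _.
  by rewrite /= !(PoszD, rmorphD, rmorphN) /=; lra.
set A := orientations K (chi - _); set B := orientations K _.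
by rewrite /= !(PoszD, rmorphD, rmorphN) /=; lra.
Qed.

Variables (S : seq V) (A : pred V) (y : V).
Hypothesis (yNA : ~~ A y) (SNA : {in S, forall z, ~~ A z}).

Definition separated (p : V * V) :=
  [&& p.1 != p.2, A p.1 ==> A p.2 || (p.2 \in S) & A p.2 ==> A p.1 || (p.1 \in S)].

Let target v z := dirac_int v + dirac_int y - dirac_int z - dirac_int z.

Let source_step v w : dirac_int v - dirac_int y - dirac_int v + dirac_int w =
  dirac_int w - dirac_int y.
Proof. by clear; fun_int. Qed.

Let target_step v w z : target v z - dirac_int v + dirac_int w = target w z.
Proof. by clear yNA SNA; rewrite /target; fun_int. Qed.

(** Induction on the number of edges. For [v] in [A] all the divergences involved equal 1 at [v], so
    double counting multiplies both sides by the same [degree K v + 1]. Deleting the marked edge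
    replaces [v] by its neighbour in all of them, and by separation this neighbour lies in [A] or in
    [S]. *)
Lemma orientations_separated K v : all separated K -> A v || (v \in S) ->
  orientations K (dirac_int v - dirac_int y) <=
  \sum_(z <- S) orientations K (target v z).
Proof.
have [n] := ubnP (size K); elim: n K v => // n IH K v; rewrite ltnS => Kn sepK.
(* At [v] in [S] the term [z = v] suffices: it is the left-hand side with all orientations
   reversed. *)
have [vS _|vNS] := boolP (v \in S).
  rewrite (perm_big _ (perm_to_rem vS)) big_cons /target.
  have -> : dirac_int v + dirac_int y - dirac_int v - dirac_int v =
            - (dirac_int v - dirac_int y) by clear; fun_int.
  rewrite orientationsN lerDl.
  by rewrite sumr_ge0// => z _; exact: orientations_ge0.
rewrite orbF => Av.
have loopless : {in K, forall p, p.1 != p.2}.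
  by move=> p /(allP sepK) /and3P[].
have c_gt0 : 0 < ((degree K v)%:Z + 1)%:~R :> R by rewrite ltr0z; lia.
have chi1 z : z != v -> y != v -> target v z v = 1.
  move=> zv yv; rewrite /target.
  have -> : (dirac_int v + dirac_int y - dirac_int z - dirac_int z) v =
    (v == v)%:Z + (v == y)%:Z - (v == z)%:Z - (v == z)%:Z by [].
  by rewrite eqxx ![v == _]eq_sym (negbTE zv) (negbTE yv).
have yv : y != v by apply: contraNneq yNA => ->.
have chi0 : (dirac_int v - dirac_int y) v = 1.
  have -> : (dirac_int v - dirac_int y) v = (v == v)%:Z - (v == y)%:Z by [].
  by rewrite eqxx eq_sym (negbTE yv).
rewrite -(ler_pM2l c_gt0) -{1}chi0 degree_orientations// mulr_sumr.
have -> : \sum_(z <- S) ((degree K v)%:Z + 1)%:~R * orientations K (target v z)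
   = 2 * \sum_(z <- S) unorient K v (target v z).
  rewrite mulr_sumr big_seq [RHS]big_seq; apply: eq_bigr => z zS.
  rewrite -{1}(chi1 z)// ?degree_orientations//.
  by apply: contraNneq (SNA zS) => ->.
rewrite ler_wpM2l// /unorient big_split /= lerD// exchange_big /=;
  rewrite big_seq_cond [leRHS]big_seq_cond; apply: ler_sum => -[[u w] K'] /=;
  move=> /andP[/picks_mem[/= /(allP sepK) /and3P[/= _ s1 s2] lt_K' sub_K'] /eqP ev].
- rewrite source_step; under eq_bigr do rewrite target_step.
  apply: IH; first exact: leq_trans lt_K' Kn.
    by apply/allP => p /sub_K' /(allP sepK).
  by move: s1; rewrite ev Av.
- rewrite source_step; under eq_bigr do rewrite target_step.
  apply: IH; first exact: leq_trans lt_K' Kn.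
    by apply/allP => p /sub_K' /(allP sepK).
  by move: s2; rewrite ev Av.
Qed.

End Orientations.

(** * Positive combinations of orientation counts *)

Section Cone.
Variables (R : realFieldType) (V : choiceType) (ok : pred (V * V)).
Implicit Types F : (V -> int) -> R.

(** The inequality between orientation counts is linear in the counting function, hence passes to
    this cone by induction. *)
Inductive cone : ((V -> int) -> R) -> Prop :=
| cone_orientations K of all ok K : cone (orientations R K)
| cone_lin b c F F' of 0 <= b & 0 <= c & cone F & cone F' :
    cone (fun chi => b * F chi + c * F' chi).

Lemma cone_scale b F : 0 <= b -> cone F -> cone (fun chi => b * F chi).
Proof.
move=> b0 cF; rewrite (_ : (fun _ => _) = (fun chi => b * F chi + 0 * F chi)).
  exact: cone_lin.
by apply/funext => chi; rewrite mul0r addr0.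
Qed.

Lemma cone_edge p F : ok p -> cone F ->
  cone (fun chi => F (chi - dipole p) + F (chi + dipole p)).
Proof.
move=> okp; elim=> [K okK|b c {}F F' b0 c0 _ IH _ IH'].
  by apply: (@cone_orientations (p :: K)); rewrite /= okp.
rewrite (_ : (fun _ => _) = (fun chi =>
   b * (F (chi - dipole p) + F (chi + dipole p)) +
   c * (F' (chi - dipole p) + F' (chi + dipole p)))); first exact: cone_lin.
by apply/funext => chi; lra.
Qed.

End Cone.

Lemma cone_separated (R : realFieldType) (V : choiceType) (S : seq V) (A : pred V)
    (y x : V) (F : (V -> int) -> R) :
  ~~ A y -> {in S, forall z, ~~ A z} -> cone (separated S A) F ->
  A x || (x \in S) ->
  F (dirac_int x - dirac_int y) <=
  \sum_(z <- S) F (dirac_int x + dirac_int y - dirac_int z - dirac_int z).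
Proof.
move=> yA SA cF xA; elim: cF => [K sepK|b c {}F F' b0 c0 _ IH _ IH'].
  exact: orientations_separated sepK xA.
rewrite big_split /= -!mulr_sumr lerD// ler_wpM2l//.
Qed.

(** * The finite Jacobi triple product *)

Section Mixture.
Variables (R : realType) (a : R).
Hypothesis a_gt0 : 0 < a.

(** [q] is the nome of the triple product: if [X] is the shift by [2 d], the weight [gauss a (2 j)]
    of [X ^ j] is [q ^ (j ^ 2)]. The base of the q-factorials is [b = q ^ 2]. *)
Let q : R := expR (- (4 * a)).
Let b : R := expR (- (8 * a)).

Let q_sqr : q ^+ 2 = b.
Proof. by rewrite -expRM_natr; congr expR; lra. Qed.

Let b_ge0 : 0 <= b. Proof. exact: expR_ge0. Qed.

Let b_lt1 : b < 1.
Proof. by rewrite -expR0 ltr_expR oppr_lt0 mulr_gt0. Qed.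

Definition qfact n : R := \prod_(i < n) (1 - b ^+ i.+1).

Let qfactS n : qfact n.+1 = qfact n * (1 - b ^+ n.+1).
Proof. by rewrite /qfact big_ord_recr. Qed.

Let bX_lt1 n : b ^+ n.+1 < 1.
Proof. by rewrite exprn_ilt1. Qed.

Lemma qfact_gt0 n : 0 < qfact n.
Proof.
elim: n => [|n IH]; first by rewrite /qfact big_ord0.
by rewrite qfactS mulr_gt0// subr_gt0.
Qed.

Lemma qfact_noninc : {homo qfact : m n / (m <= n)%N >-> n <= m}.
Proof.
apply: homo_leq => [x|x y z xy yz|n]; [exact: lexx|exact: le_trans yz xy|].
by rewrite qfactS ler_piMr ?(ltW (qfact_gt0 n))// gerBl exprn_ge0.
Qed.

(** Weierstrass's bound: a product of factors [1 - b ^ i] is at least 1 minus the sum of the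
    [b ^ i], here a geometric sum over [k < i <= k + j]. *)
Let qfact_tail k j :
  qfact k * (1 - (b ^+ k.+1 - b ^+ (k + j).+1) / (1 - b)) <= qfact (k + j).
Proof.
have b1 : 0 < 1 - b by rewrite subr_gt0.
elim: j => [|j IH]; first by rewrite addn0 subrr mul0r subr0 mulr1.
rewrite addnS qfactS -addnS.
apply: (@le_trans _ _ (qfact k * (1 - (b ^+ k.+1 - b ^+ (k + j).+1) / (1 - b))
   * (1 - b ^+ (k + j).+1))); last first.
  by rewrite addnS ler_wpM2r// subr_ge0 ltW.
rewrite -mulrA ler_wpM2l ?(ltW (qfact_gt0 k))// addnS.
set x := (b ^+ k.+1 - b ^+ (k + j).+1) / (1 - b); set y := b ^+ (k + j).+1.
have -> : (b ^+ k.+1 - b ^+ (k + j).+2) / (1 - b) = x + y.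
  apply: (mulIf (lt0r_neq0 b1)); rewrite divfK ?lt0r_neq0//.
  rewrite [b ^+ (k + j).+2]exprS -/y.
  have : x * (1 - b) = b ^+ k.+1 - y by rewrite divfK ?lt0r_neq0.
  by lra.
have x0 : 0 <= x.
  rewrite /x divr_ge0 ?(ltW b1)// subr_ge0 -addSn exprD ler_piMr ?exprn_ge0//.
  by rewrite exprn_ile1// ltW.
have y0 : 0 <= y by rewrite exprn_ge0.
by have := mulr_ge0 x0 y0; lra.
Qed.

Lemma qfact_cvg : exists2 l : R, 0 < l & qfact n @[n --> \oo] --> l.
Proof.
have b1 : 0 < 1 - b by rewrite subr_gt0.
(* From such a [k] on, the remaining factors multiply to at least 1/2, which keeps the limit
   positive. *)
have [k hk] : exists k, b ^+ k.+1 / (1 - b) <= 2^-1.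
  have /cvgr0Pnorm_lt/(_ ((1 - b) / 2)) : b ^+ n @[n --> \oo] --> 0.
    by apply: cvg_expr; rewrite ger0_norm.
  rewrite divr_gt0// => /(_ isT) [k _ hk]; exists k.
  have := hk k.+1 (leqnSn k); rewrite ger0_norm ?exprn_ge0// => /ltW.
  by rewrite ler_pdivrMr// mulrC.
have lb j : qfact k / 2 <= qfact j.
  apply: (@le_trans _ _ (qfact (k + j))); last exact/qfact_noninc/leq_addl.
  apply: le_trans (qfact_tail k j); rewrite ler_wpM2l ?(ltW (qfact_gt0 k))//.
  have : (b ^+ k.+1 - b ^+ (k + j).+1) / (1 - b) <= b ^+ k.+1 / (1 - b).
    by rewrite ler_wpM2r ?invr_ge0 ?(ltW b1)// gerBl exprn_ge0.
  by lra.
have cv : cvgn qfact.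
  apply: nonincreasing_is_cvgn; first exact: qfact_noninc.
  by exists (qfact k / 2) => _ [j _ <-].
exists (limn qfact) => //.
apply: (@lt_le_trans _ _ (qfact k / 2)); first by rewrite divr_gt0 ?qfact_gt0.
by apply: limr_ge => //; near=> j.
Unshelve. all: by end_near. Qed.

Section Operator.
Variables (G : zmodType) (d : G).

(* A factor [1 + q ^ (2 i) + q ^ i (X + 1/X)] of the Jacobi triple product is
   [(1 - q ^ i) ^ 2 + q ^ i (X ^ (1/2) + X ^ (-1/2)) ^ 2]. *)
Fixpoint mix (m : nat) (F : G -> R) : G -> R :=
  match m with
  | 0 => F
  | 1 => fun g => gauss a 1 / (1 - b) * (F (g - d) + F (g + d))
  | m'.+2 => fun g =>
     ((1 + q ^+ m'.+1 ^+ 2) * mix m' F g +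
      q ^+ m'.+1 * (mix m' F (g - d *~ 2) + mix m' F (g + d *~ 2))) /
     ((1 - b ^+ m'.+1) * (1 - b ^+ m'.+2))
  end.

(** A Gaussian weight times the q-binomial coefficient of base [b] stripped of its numerator
    [qfact m]. For fixed [2 i - m] and large [m] the denominator is almost constant. *)
Definition mixw (m i : nat) : R :=
  gauss a (i%:Z * 2 - m%:Z) / (qfact i * qfact (m - i)).

Let gauss_shift (t : int) (n c : nat) : t = n%:Z + 1 - c%:Z *+ 2 ->
  gauss a t * b ^+ c = q ^+ n * gauss a (t - 2).
Proof.
move=> tE; rewrite /gauss /b /q -!expRM_natr -!expRD; congr expR.
rewrite tE !(rmorphD, rmorphN, rmorphMn) /= -!pmulrn; lra.
Qed.

(** The two-step recursion of the q-binomial coefficients, denominators cleared. The three summands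
    come from the indices [j - 1], [j - 2] and [j] of the previous product; where a truncated
    predecessor would be wrong, a factor [1 - b ^ 0] vanishes. *)
Let mix_coef m j : (j <= m.+2)%N ->
  (1 - b ^+ m.+1) * (1 - b ^+ m.+2) =
  (1 + b ^+ m.+1) * (1 - b ^+ j) * (1 - b ^+ (m.+2 - j)) +
  b ^+ (m.+2 - j) * (1 - b ^+ j) * (1 - b ^+ j.-1) +
  b ^+ j * (1 - b ^+ (m.+2 - j)) * (1 - b ^+ (m.+2 - j).-1).
Proof.
case: j => [|j] jm; first by rewrite subn0 expr0 /=; lra.
case c : (m.+2 - j.+1)%N => [|c'].
  have -> : j = m.+1 by lia.
  by rewrite expr0 /=; lra.
have -> : m.+1 = (j + c').+1 by lia.
by rewrite /= !exprS !exprD; lra.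
Qed.

Let cancel4 (u A B x y : R) : x != 0 -> y != 0 ->
  u / (A * x * (B * y)) * x * y = u / (A * B).
Proof.
move=> x0 y0; rewrite (mulrACA A) [(_ * (x * y))^-1]invfM mulrA -[LHS]mulrA.
by rewrite divfK ?mulf_neq0.
Qed.

Lemma mixE m F g : mix m F g =
  \sum_(i < m.+1) mixw m i * F (g - d *~ (i%:Z * 2 - m%:Z)).
Proof.
have qf0 n : qfact n != 0 by rewrite lt0r_neq0 ?qfact_gt0.
have b0 n : 1 - b ^+ n.+1 != 0 by rewrite lt0r_neq0// subr_gt0.
have qf00 : qfact 0 = 1 by rewrite /qfact big_ord0.
suff : forall m, (forall g, mix m F g =
    \sum_(i < m.+1) mixw m i * F (g - d *~ (i%:Z * 2 - m%:Z))) /\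
    (forall g, mix m.+1 F g =
    \sum_(i < m.+2) mixw m.+1 i * F (g - d *~ (i%:Z * 2 - m.+1%:Z))).
  by move=> /(_ m)[].
elim=> [|{}m [IH IH1]]; split=> // {}g.
- rewrite big_ord1 /mixw !qf00 /= subr0 mul0r gauss0 mulr0z subr0.
  by rewrite mulr1 divr1 mul1r.
- rewrite big_ord_recl big_ord1 /mixw /= !subSS !subn0 qf00 mul0r sub0r.
  rewrite [1 * 2 - 1 : int](_ : _ = 1)// gaussN mulrNz mulr1z opprK.
  rewrite qfactS qf00 mul1r mulr1 expr1; lra.
pose w j := mixw m.+2 j * F (g - d *~ (j%:Z * 2 - m.+2%:Z)).
pose X j := (1 + b ^+ m.+1) * (1 - b ^+ j) * (1 - b ^+ (m.+2 - j)) * w j.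
pose Y j := b ^+ (m.+2 - j) * (1 - b ^+ j) * (1 - b ^+ j.-1) * w j.
pose Z j := b ^+ j * (1 - b ^+ (m.+2 - j)) * (1 - b ^+ (m.+2 - j).-1) * w j.
have qX : q ^+ m.+1 ^+ 2 = b ^+ m.+1 by rewrite -q_sqr -!exprM mulnC.
rewrite -[LHS]/(((1 + q ^+ m.+1 ^+ 2) * mix m F g +
      q ^+ m.+1 * (mix m F (g - d *~ 2) + mix m F (g + d *~ 2))) /
     ((1 - b ^+ m.+1) * (1 - b ^+ m.+2))).
apply: (mulIf (mulf_neq0 (b0 m) (b0 m.+1))).
rewrite divfK ?mulf_neq0// mulr_suml.
transitivity (\sum_(i < m.+3) X i + \sum_(i < m.+3) Y i + \sum_(i < m.+3) Z i);
  last first.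
  rewrite -!big_split /=; apply: eq_bigr => j _.
  rewrite (mix_coef (j := j)); last by rewrite -ltnS.
  by rewrite /X /Y /Z -/(w j); set wj := w j; lra.
have im (i : 'I_m.+1) : (i <= m)%N by rewrite -ltnS.
have XE (i : 'I_m.+1) : X i.+1 =
    (1 + q ^+ m.+1 ^+ 2) * (mixw m i * F (g - d *~ (i%:Z * 2 - m%:Z))).
  rewrite /X /w /mixw (_ : m.+2 - i.+1 = (m - i).+1)%N; last by have := im i; lia.
  rewrite (_ : i.+1%:Z * 2 - m.+2%:Z = i%:Z * 2 - m%:Z); last by lia.
  rewrite !qfactS qX; set u := gauss _ _; set f := F _.
  rewrite -(cancel4 u (qfact i) (qfact (m - i)) (b0 i) (b0 (m - i)%N)).
  by set v := u / _; lra.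
have YE (i : 'I_m.+1) : Y i.+2 = q ^+ m.+1 *
    (mixw m i * F (g - d *~ 2 - d *~ (i%:Z * 2 - m%:Z))).
  rewrite /Y /w /mixw (_ : m.+2 - i.+2 = m - i)%N; last by [].
  have <- : g - d *~ (i.+2%:Z * 2 - m.+2%:Z) =
            g - d *~ 2 - d *~ (i%:Z * 2 - m%:Z).
    by rewrite -addrA -opprD -mulrzDr; congr (_ - _ *~ _); lia.
  have := @gauss_shift (i.+2%:Z * 2 - m.+2%:Z) m.+1 (m - i)%N.
  rewrite (_ : i.+2%:Z * 2 - m.+2%:Z - 2 = i%:Z * 2 - m%:Z); last by lia.
  have -> : i.+2%:Z * 2 - m.+2%:Z = m.+1%:Z + 1 - (m - i)%:Z *+ 2.
    by have := im i; lia.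
  move=> /(_ erefl); rewrite !qfactS; set u := gauss _ _; set u' := gauss _ _.
  set f := F _ => shift.
  have -> : q ^+ m.+1 * (u' / (qfact i * qfact (m - i)) * f) =
            b ^+ (m - i) * (u / (qfact i * qfact (m - i)) * f).
    by rewrite !mulrA -shift; lra.
  rewrite -(cancel4 u (qfact i) (qfact (m - i)) (b0 i) (b0 i.+1)) /=.
  rewrite (_ : qfact i * (1 - b ^+ i.+1) * (1 - b ^+ i.+2) * qfact (m - i) =
    qfact i * (1 - b ^+ i.+1) * (qfact (m - i) * (1 - b ^+ i.+2))); last by lra.
  by lra.
have ZE (i : 'I_m.+1) : Z i = q ^+ m.+1 *
    (mixw m i * F (g + d *~ 2 - d *~ (i%:Z * 2 - m%:Z))).
  rewrite /Z /w /mixw (_ : m.+2 - i = (m - i).+2)%N; last by have := im i; lia.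
  have <- : g - d *~ (i%:Z * 2 - m.+2%:Z) =
            g + d *~ 2 - d *~ (i%:Z * 2 - m%:Z).
    rewrite (_ : i%:Z * 2 - m.+2%:Z = i%:Z * 2 - m%:Z - 2); last by lia.
    by rewrite [in LHS]mulrzBr opprB addrA.
  have := @gauss_shift (- (i%:Z * 2 - m.+2%:Z)) m.+1 i.
  rewrite (_ : - (i%:Z * 2 - m.+2%:Z) - 2 = - (i%:Z * 2 - m%:Z)); last by lia.
  have -> : - (i%:Z * 2 - m.+2%:Z) = m.+1%:Z + 1 - i%:Z *+ 2 by lia.
  have -> : i%:Z * 2 - m.+2%:Z = - (m.+1%:Z + 1 - i%:Z *+ 2) by lia.
  move=> /(_ erefl); rewrite !gaussN !qfactS; set u := gauss _ _; set u' := gauss _ _.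
  set f := F _ => shift.
  have -> : q ^+ m.+1 * (u' / (qfact i * qfact (m - i)) * f) =
            b ^+ i * (u / (qfact i * qfact (m - i)) * f).
    by rewrite !mulrA -shift; lra.
  rewrite -(cancel4 u (qfact i) (qfact (m - i)) (b0 (m - i)%N) (b0 (m - i).+1)) /=.
  rewrite (_ : qfact i * (qfact (m - i) * (1 - b ^+ (m - i).+1) *
      (1 - b ^+ (m - i).+2)) = qfact i * (1 - b ^+ (m - i).+1) *
      (qfact (m - i) * (1 - b ^+ (m - i).+2))); last by lra.
  by lra.
(* The boundary terms contain a factor [1 - b ^ 0], so each of the three sums reduces to the range
   of the previous product. *)
have -> : \sum_(i < m.+3) X i = \sum_(i < m.+1) X i.+1.
  have X0 : X 0 = 0 by rewrite /X expr0 subrr mulr0 !mul0r.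
  have Xm : X m.+2 = 0 by rewrite /X subnn expr0 subrr mulr0 mul0r.
  rewrite big_ord_recl big_ord_recr /= X0 [X (bump _ _)]Xm add0r addr0.
  exact: eq_bigr.
have -> : \sum_(i < m.+3) Y i = \sum_(i < m.+1) Y i.+2.
  have Y0 : Y 0 = 0 by rewrite /Y expr0 subrr mulr0 !mul0r.
  have Y1 : Y 1 = 0 by rewrite /Y /= expr0 subrr mulr0 mul0r.
  rewrite 2!big_ord_recl /= Y0 [Y (bump _ _)]Y1 !add0r.
  exact: eq_bigr.
have -> : \sum_(i < m.+3) Z i = \sum_(i < m.+1) Z i.
  have Z1 : Z m.+2 = 0 by rewrite /Z subnn expr0 subrr mulr0 !mul0r.
  have Z2 : Z m.+1 = 0 by rewrite /Z subSnn /= expr0 subrr mulr0 mul0r.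
  rewrite 2!big_ord_recr /= Z1 Z2 !addr0.
  exact: eq_bigr.
rewrite (eq_bigr _ (fun i _ => XE i)) (eq_bigr _ (fun i _ => YE i)).
rewrite (eq_bigr _ (fun i _ => ZE i)).
by rewrite -!mulr_sumr !IH; lra.
Qed.

End Operator.
End Mixture.

(** * Comparison of the mixtures with the Gaussian parity classes *)

Section MixtureCone.
Variables (R : realType) (a : R).
Hypothesis a_gt0 : 0 < a.

(** [mixw] indexed by the current [k = 2 i - m] it is attached to. *)
Definition mixz (m : nat) (k : int) : R :=
  if (odd `|k| == odd m) && (`|k| <= m)%N then
    mixw a m `|((k + m%:Z) %/ 2)%Z| else 0.

Lemma mix_box (G : zmodType) (d : G) M m F g : (m <= M)%N ->
  \sum_(k <- box M) mixz m k * F (g - d *~ k) = mix a d m F g.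
Proof.
move=> mM; rewrite mixE//.
transitivity (\sum_(k <- [seq i%:Z * 2 - m%:Z | i <- iota 0 m.+1])
    mixz m k * F (g - d *~ k)).
  rewrite (bigID (fun k => (odd `|k| == odd m) && (`|k| <= m)%N)) [LHS]/=.
  rewrite [X in _ + X]big1 ?addr0; last first.
    by move=> k kN; rewrite /mixz (negbTE kN) mul0r.
  rewrite -big_filter; apply: perm_big; apply: uniq_perm.
  - by rewrite filter_uniq// box_uniq.
  - by rewrite map_inj_uniq ?iota_uniq// => i j; lia.
  move=> k; rewrite mem_filter mem_box; apply/idP/mapP.
    move=> /andP[/andP[e km] _]; exists `|((k + m%:Z) %/ 2)%Z|%N; last by lia.
    by rewrite mem_iota; lia.
  by move=> [i]; rewrite mem_iota => im ->; lia.
rewrite big_map -[iota _ _]/(index_iota 0 m.+1) big_mkord.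
apply: eq_bigr => i _; congr (_ * _); have := ltn_ord i; rewrite /mixz => im.
rewrite ifT; last by lia.
by congr mixw; lia.
Qed.

Lemma mixz_ge0 m k : 0 <= mixz m k.
Proof.
rewrite /mixz; case: ifP => // _; rewrite /mixw divr_ge0 ?gauss_ge0//.
by rewrite mulr_ge0// ltW// qfact_gt0.
Qed.

Lemma mixz_le l m k : 0 < l -> (forall n, l <= qfact a n) ->
  mixz m k <= (l ^+ 2)^-1 * parity (odd m) (gauss a) k.
Proof.
move=> l0 le_q; rewrite /mixz /parity.
case: ifP => [/andP[e km]|_]; last first.
  by rewrite mulr_ge0 ?invr_ge0 ?sqr_ge0//; case: ifP => // _; exact: gauss_ge0.
rewrite ifT; last exact: e.
rewrite /mixw (_ : _ * 2 - m%:Z = k); last by lia.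
rewrite mulrC ler_wpM2r ?gauss_ge0// lef_pV2 ?posrE ?mulr_gt0 ?qfact_gt0//.
by rewrite expr2 ler_pM// ltW.
Qed.

(** For [k] at distance at least [2 n] from the ends of the support, both [qfact] in the denominator
    have index at least [n], and [qfact] is nonincreasing. *)
Lemma parity_le_mixz n m k : (n.*2 + `|k| <= m)%N ->
  parity (odd m) (gauss a) k <= qfact a n ^+ 2 * mixz m k.
Proof.
move=> nm; rewrite /mixz /parity; case: ifP => [e|_]; last first.
  by rewrite /= mulr0.
rewrite ifT; last by lia.
rewrite /mixw (_ : _ * 2 - m%:Z = k); last by lia.
set u := qfact a `|_|%N; set v := qfact a (m - _).
have u0 : 0 < u by exact: qfact_gt0.
have v0 : 0 < v by exact: qfact_gt0.
rewrite mulrCA; apply: ler_peMr; first exact: gauss_ge0.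
rewrite ler_pdivlMr ?mulr_gt0// mul1r expr2.
by apply: ler_pM; rewrite ?(ltW u0) ?(ltW v0)//; apply: qfact_noninc => //; lia.
Qed.

Variables (V : choiceType) (ok : pred (V * V)).

Lemma cone_mix p m F : ok p -> cone ok F -> cone ok (mix a (dipole p) m F).
Proof.
move=> okp cF; have b1 n : 0 < 1 - expR (- (8 * a)) ^+ n.+1.
  by rewrite subr_gt0 exprn_ilt1 ?expR_ge0// -expR0 ltr_expR oppr_lt0 mulr_gt0.
suff : forall m, cone ok (mix a (dipole p) m F) /\ cone ok (mix a (dipole p) m.+1 F).
  by move=> /(_ m)[].
elim=> [|{}m [IH IH1]]; split=> //.
  apply: cone_scale; last exact: cone_edge.
  by rewrite divr_ge0 ?gauss_ge0// ltW// -[X in 1 - X]expr1.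
set q := expR (- (4 * a)) ^+ m.+1; set H := mix _ _ m F in IH.
set c := ((1 - expR (- (8 * a)) ^+ m.+1) * (1 - expR (- (8 * a)) ^+ m.+2))^-1.
have c0 : 0 <= c by rewrite invr_ge0 mulr_ge0// ltW.
(* In this form both coefficients are nonnegative and the second term adds two copies of the edge
   [p] to the multigraphs. *)
rewrite (_ : mix _ _ _ _ = (fun chi => ((1 - q) ^+ 2 * c) * H chi + (q * c) *
   (H (chi - dipole p - dipole p) + H (chi - dipole p + dipole p) +
   (H (chi + dipole p - dipole p) + H (chi + dipole p + dipole p))))).
  apply: cone_lin => //.
  - by rewrite mulr_ge0 ?sqr_ge0.
  - by rewrite mulr_ge0 ?exprn_ge0 ?expR_ge0.
  - exact: cone_edge okp (cone_edge okp IH).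
apply/funext => chi; rewrite subrK addrK.
have -> : chi - dipole p - dipole p = chi - dipole p *~ 2.
  by rewrite -addrA -opprD.
have -> : chi + dipole p + dipole p = chi + dipole p *~ 2 by rewrite -addrA.
rewrite -[LHS]/(((1 + q ^+ 2) * H chi + q * (H (chi - dipole p *~ 2) +
   H (chi + dipole p *~ 2))) * c).
by set x := H (_ - _); set y := H (_ + _ *~ 2); lra.
Qed.

(** [m.*2 + b] unit currents have a sum of parity [b], so the parity bit of an edge selects the size
    of the product that approximates its class. *)
Definition mix_sum M m (E : seq (V * V)) (p : seq bool) (g : V -> int) : R :=
  flow_sum (box M) [seq (dipole x.1, mixz (m.*2 + nat_of_bool x.2)) | x <- zip E p] g.

Lemma cone_mix_sum M m E p : all ok E -> (m.*2 < M)%N ->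
  cone ok (mix_sum M m E p).
Proof.
move=> okE mM; rewrite /mix_sum; elim: E p okE => [|e E IH] p okE.
  by case: p => [|b p]; apply: (@cone_orientations _ _ _ [::]).
case: p => [|b p]; first by apply: (@cone_orientations _ _ _ [::]).
move: okE => /= /andP[oke okE].
rewrite (_ : (fun g => _) = mix a (dipole e) (m.*2 + b) (mix_sum M m E p)).
  by apply: cone_mix => //; exact: IH.
apply/funext => g /=; rewrite -(@mix_box _ _ M)//.
by case: b => /=; lia.
Qed.

Lemma zip_map_dipole (f : bool -> int -> R) (E : seq (V * V)) p :
  [seq (x.1, f x.2) | x <- zip (map (@dipole V) E) p] =
  [seq (dipole x.1, f x.2) | x <- zip E p].
Proof.
elim: E p => [|e E IH] p; first by case: p.
by case: p => [|b p] //=; rewrite IH.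
Qed.

Lemma odd_double_bool m (b : bool) : odd (m.*2 + b) = b.
Proof. by rewrite oddD odd_double oddb. Qed.

Lemma dup_box_le_mix_sum M N n E p g : (n.*2 + M <= N.*2)%N ->
  dup_box a M (map (@dipole V) E) p g <=
  (qfact a n ^+ 2) ^+ size (zip E p) * mix_sum (N.*2.+1) N E p g.
Proof.
move=> nMN; rewrite /dup_box (zip_map_dipole (fun b => parity b (gauss a))).
apply: flow_sum_le.
- exact: sqr_ge0.
- exact: box_uniq.
- by apply: box_sub; lia.
- by move=> *; exact: parity_ge0.
- by move=> *; exact: mixz_ge0.
- move=> [e b] k _; rewrite mem_box => kM /=.
  rewrite -[X in parity X](odd_double_bool N); apply: parity_le_mixz.
  by lia.
Qed.

Lemma mix_sum_le_dup_box M m l E p g : 0 < l -> (forall n, l <= qfact a n) ->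
  mix_sum M m E p g <=
  ((l ^+ 2)^-1) ^+ size (zip E p) * dup_box a M (map (@dipole V) E) p g.
Proof.
move=> l0 le_q; rewrite /dup_box (zip_map_dipole (fun b => parity b (gauss a))).
apply: flow_sum_le => //.
- by rewrite invr_ge0 sqr_ge0.
- exact: box_uniq.
- by move=> *; exact: mixz_ge0.
- by move=> *; exact: parity_ge0.
- move=> [e b] k _ _ /=; rewrite -[X in parity X](odd_double_bool m).
  exact: mixz_le.
Qed.

End MixtureCone.

Lemma size_bits n p : p \in bits n -> size p = n.
Proof.
elim: n p => [|n IH] p /=; first by rewrite inE => /eqP->.
by rewrite mem_cat => /orP[] /mapP[p' /IH <- ->].
Qed.

(** * Simon's inequality for Gaussian currents *)

Section Simon.
Variables (R : realType) (V : choiceType) (a : R).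
Hypothesis a_gt0 : 0 < a.
Variables (S : seq V) (A : pred V) (E : seq (V * V)) (x y : V).
Hypotheses (yNA : ~~ A y) (SNA : {in S, forall z, ~~ A z}).
Hypotheses (sepE : all (separated S A) E) (xA : A x || (x \in S)).

Let D := map (@dipole V) E.
Let c (u v : V) := cur a D (dirac_int u - dirac_int v).

Lemma cur_simon : cur a D 0 * c x y <= \sum_(z <- S) c x z * c z y.
Proof.
have dup := @fun_int_double_inj V.
have cb := @cur_box_cvg R _ a a_gt0 D.
have cv : cur_box a M D 0 * cur_box a M D (dirac_int x - dirac_int y)
   @[M --> \oo] --> cur a D 0 * c x y by apply: cvgM; exact: cb.
apply: (cvgr_to_le cv); near=> M.
have [l l0 ql] := qfact_cvg a_gt0.
have le_q n : l <= qfact a n.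
  apply: (cvgr_to_le ql); near=> k; apply: (qfact_noninc a_gt0).
  by near: k; exists n.
(* The total loss in passing from Gaussian weights to mixtures and back. It tends to 1, so [n] goes
   to infinity while the box [M] is still fixed. *)
pose kap n := ((qfact a n ^+ 2) * (l ^+ 2)^-1) ^+ size E.
have kap1 : kap n * \sum_(z <- S) c x z * c z y @[n --> \oo] -->
    \sum_(z <- S) c x z * c z y.
  rewrite -[X in _ --> X]mul1r; apply: cvgM; last exact: cvg_cst.
  have -> : 1 = ((l ^+ 2) * (l ^+ 2)^-1) ^+ size E.
    by rewrite divff ?expr1n// expf_neq0// lt0r_neq0.
  apply: (@continuous_cvg _ _ _ _ _ _ (fun z : R => z ^+ size E)).
    exact: exprn_continuous.
  apply: cvgM; last exact: cvg_cst.
  by apply: (@continuous_cvg _ _ _ _ _ _ (fun z : R => z ^+ 2)) => //;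
    exact: exprn_continuous.
apply: (cvgr_to_ge kap1); near=> n.
set chi := dirac_int x - dirac_int y.
pose chi' z := dirac_int x + dirac_int y - dirac_int z - dirac_int z.
(* The products have size [2 N] or [2 N + 1]: they leave a margin [2 n] around the box [M.*2], and
   their support fits in the box [N']. *)
pose N := (n + M)%N; pose N' := N.*2.+1.
have split_chi z : dirac_int x - dirac_int z + (dirac_int z - dirac_int y) = chi.
  by rewrite /chi; clear; fun_int.
have split_chi' z : dirac_int x - dirac_int z - (dirac_int z - dirac_int y) = chi' z.
  by rewrite /chi'; clear; fun_int.
have step p : p \in bits (size D) ->
    dup_box a M.*2 D p chi <= kap n * \sum_(z <- S) dup_box a N' D p (chi' z).
  move=> /size_bits; rewrite size_map => sp.
  have sz : size (zip E p) = size E by rewrite size1_zip// sp.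
  apply: le_trans (@dup_box_le_mix_sum _ _ a_gt0 _ M.*2 N n E p _ _) _.
    by rewrite /N; lia.
  rewrite sz /kap [X in _ <= X * _]exprMn -mulrA.
  rewrite ler_wpM2l ?exprn_ge0 ?(ltW (qfact_gt0 a_gt0 n))//.
  apply: le_trans (cone_separated yNA SNA (cone_mix_sum a_gt0 p sepE _) xA) _ => //.
  rewrite mulr_sumr; apply: ler_sum => z _; rewrite -sz.
  exact: mix_sum_le_dup_box.
apply: (@le_trans _ _ (dup_sum a M.*2 D chi chi)).
  have := cur_box_dup_le a M D chi 0.
  have -> : chi + 0 = chi := addr0 chi;
  by rewrite mulrC.
(* Only one of the two equal factors is bounded by [step]; the other is kept, in a larger box, to
   complete the products [Y_p(x - y) Y_p(x + y - 2 z)]. *)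
apply: (@le_trans _ _ (kap n * \sum_(z <- S) dup_sum a N' D chi (chi' z))).
  rewrite /dup_sum exchange_big /= mulr_sumr.
  rewrite big_seq [leRHS]big_seq; apply: ler_sum => p pD.
  rewrite -mulr_sumr mulrCA.
  apply: ler_pM; rewrite ?dup_box_ge0 ?step//.
  by apply: dup_box_mono => //; rewrite /N' /N; lia.
have kap0 : 0 <= kap n.
  by rewrite exprn_ge0// mulr_ge0 ?invr_ge0 ?sqr_ge0.
rewrite ler_wpM2l//; apply: ler_sum => z _.
rewrite -(split_chi z) -(split_chi' z).
apply: le_trans (cur_box_dup_ge a _ _ _ _ dup) _.
by apply: ler_pM; rewrite ?cur_box_ge0 ?cur_box_le.
Unshelve. all: by end_near. Qed.

End Simon.
(** * The theta identity *)

Section Trigonometry.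
Variable R : realType.
Implicit Types u v x : R.

Lemma sin_mvt v : 0 <= v -> exists2 c, 0 <= c <= v & sin v = cos c * v.
Proof.
move=> v0; have [|c] := @MVT_segment R sin cos 0 v v0.
  by apply: continuous_subspaceT => x; exact: continuous_sin.
by rewrite in_itv /= sin0 !subr0 => cv ->; exists c.
Qed.

Lemma sin_sqr_le v : sin v ^+ 2 <= v ^+ 2.
Proof.
wlog v0 : v / 0 <= v => [th|].
  have [/th//|/ltW v0] := leP 0 v.
  by have := th (- v); rewrite sinN !sqrrN oppr_ge0; apply.
have [c _ ->] := sin_mvt v0; by rewrite exprMn ler_piMl ?sqr_ge0.
Qed.

Lemma sin_sqr_ge v : v ^+ 2 * (1 - v ^+ 2) <= sin v ^+ 2.
Proof.
wlog v0 : v / 0 <= v => [th|].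
  have [/th//|/ltW v0] := leP 0 v.
  by have := th (- v); rewrite sinN !sqrrN oppr_ge0; apply.
have [c /andP[c0 cv] ->] := sin_mvt v0.
rewrite exprMn mulrC ler_wpM2r ?sqr_ge0// cos2sin2 lerB// (le_trans (sin_sqr_le c))//.
by rewrite ler_sqr.
Qed.

Lemma sin_sqr_ge_half v : `|v| <= pi / 4 -> v ^+ 2 / 2 <= sin v ^+ 2.
Proof.
wlog v0 : v / 0 <= v => [th|].
  have [/th//|/ltW v0] := leP 0 v.
  by have := th (- v); rewrite sinN normrN !sqrrN oppr_ge0; apply.
rewrite ger0_norm// => v4; have [c /andP[c0 cv] ->] := sin_mvt v0.
rewrite exprMn mulrC ler_wpM2r ?sqr_ge0//.
have : 0 <= cos (c *+ 2).
  rewrite mulr2n; have := pi_ge0 R; move=> p0; apply: cos_ge0_pihalf; lra.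
by rewrite cos_mulr2n mulr2n; lra.
Qed.

Lemma sum_pascal n (h : nat -> R) : \sum_(i < n.+2) 'C(n.+1, i)%:R * h i =
  \sum_(i < n.+1) 'C(n, i)%:R * (h i + h i.+1).
Proof.
rewrite big_ord_recl /= bin0.
under eq_bigr do rewrite /bump /= add1n binS natrD mulrDl.
rewrite big_split /= addrA.
have -> : 1%:R * h 0 + \sum_(i < n.+1) 'C(n, i.+1)%:R * h i.+1 =
    \sum_(i < n.+2) 'C(n, i)%:R * h i by rewrite [RHS]big_ord_recl /= bin0.
rewrite big_ord_recr /= (bin_small (ltnSn n)) mul0r addr0 -big_split /=.
by apply: eq_bigr => i _; rewrite mulrDr.
Qed.

(** The factor [cos x] lets the induction run over the reals, through [2 cos u cos x = cos (x + u) +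
    cos (x - u)]. *)
Lemma cos_pow_expansion n u x : (2 * cos u) ^+ n * cos x =
  \sum_(i < n.+1) 'C(n, i)%:R * cos (x + (n%:R - 2 * i%:R) * u).
Proof.
elim: n x => [|n IH] x.
  by rewrite big_ord1 expr0 bin0 !mul1r mulr0 subr0 mul0r addr0.
rewrite (sum_pascal n (fun i => cos (x + (n.+1%:R - 2 * i%:R) * u))).
transitivity ((2 * cos u) ^+ n * cos (x + u) + (2 * cos u) ^+ n * cos (x - u)).
  rewrite cosD cosB exprS; lra.
rewrite !IH -big_split; apply: eq_bigr => i _ /=; rewrite -mulrDr.
congr (_ * (cos _ + cos _)); rewrite -!natr1; lra.
Qed.

Definition cbin (m : nat) (k : int) : R := 'C(m.*2, m + `|k|)%:R.

Lemma cos_pow_box m u : (2 * cos u) ^+ m.*2 =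
  \sum_(k <- box m) cbin m k * cos (k%:~R * (2 * u)).
Proof.
rewrite -[LHS]mulr1 -[X in _ * X]cos0 cos_pow_expansion.
transitivity (\sum_(k <- [seq m%:Z - i%:Z | i <- iota 0 m.*2.+1])
    cbin m k * cos (k%:~R * (2 * u))); last first.
  apply: perm_big; apply: uniq_perm; rewrite ?box_uniq//.
    by rewrite map_inj_uniq ?iota_uniq// => i j; lia.
  move=> k; rewrite mem_box; apply/mapP/idP.
    by move=> [i]; rewrite mem_iota => im ->; lia.
  by move=> km; exists `|m%:Z - k|%N; rewrite ?mem_iota; lia.
rewrite big_map -[iota _ _]/(index_iota 0 m.*2.+1) big_mkord.
apply: eq_bigr => i _; have := ltn_ord i; rewrite ltnS => im; congr (_ * cos _).
  rewrite /cbin; congr _%:R; have [mi|mi] := leqP m i.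
    by congr binomial; lia.
  by rewrite -bin_sub//; congr binomial; lia.
have -> : m.*2%:R = m%:R * 2 :> R by rewrite -muln2 natrM.
by rewrite rmorphB /= -!pmulrn; lra.
Qed.

(** The Dirichlet kernel, multiplied by its denominator so that [sin (x / 2) = 0] is no
    exception. *)
Lemma sum_cos_box r x y : 2 * sin (x / 2) * \sum_(j <- box r) cos (y + j%:~R * x) =
  2 * cos y * sin ((r.*2.+1)%:R * x / 2).
Proof.
elim: r => [|r IH]; first by rewrite big_seq1 mul0r addr0 mul1r; lra.
rewrite [box _]/= !big_cons !mulrDr IH.
set t := x / 2; have xE : x = 2 * t by rewrite /t; lra.
pose n := r%:R : R.
have -> : cos (y + (Posz r.+1)%:~R * x) = cos (y + (2 * n + 2) * t).
  by congr cos; rewrite -pmulrn -natr1 xE /n; lra.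
have -> : cos (y + (- Posz r.+1)%:~R * x) = cos (y - (2 * n + 2) * t).
  by congr cos; rewrite rmorphN /= -pmulrn -natr1 xE /n; lra.
have -> : (r.*2.+1)%:R * x / 2 = (2 * n + 2) * t - t.
  by rewrite -natr1 -muln2 natrM xE /n; lra.
have -> : (r.+1.*2.+1)%:R * x / 2 = (2 * n + 2) * t + t.
  by rewrite -natr1 -muln2 natrM -[r.+1%:R]natr1 xE /n; lra.
by rewrite cosD cosB sinB sinD; lra.
Qed.

Lemma sin_natpi n : sin (n%:R * pi) = 0 :> R.
Proof.
elim: n => [|n IH]; first by rewrite mul0r sin0.
by rewrite -natr1 mulrDl mul1r sinD IH sinpi; lra.
Qed.

Lemma cos_natpi_sqr n : cos (n%:R * pi) ^+ 2 = 1 :> R.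
Proof. by rewrite cos2sin2 sin_natpi expr0n subr0. Qed.

Lemma cos_2intpi x (k : int) : cos (x + k%:~R * (2 * pi)) = cos x.
Proof.
have pos n y : cos (y + n%:R * (2 * pi)) = cos y.
  elim: n => [|n IH]; first by rewrite mul0r addr0.
  rewrite -natr1 mulrDl mul1r addrA -IH.
  by have := cosD2pi (y + n%:R * (2 * pi)); rewrite -[pi *+ 2]mulr_natl.
case: k => n; first exact: pos.
rewrite NegzE rmorphN /= -[in RHS](subrK (n.+1%:~R * (2 * pi)) x) mulNr.
by rewrite pos.
Qed.

Lemma sum_roots_unity r (k : int) (y : R) :
  \sum_(j <- box r) cos (y + j%:~R * (k%:~R * (2 * pi) / (r.*2.+1)%:R)) =
  if ((r.*2.+1)%:Z %| k)%Z then (r.*2.+1)%:R * cos y else 0.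
Proof.
set l := r.*2.+1; have l0 : l%:R != 0 :> R by rewrite pnatr_eq0.
case: ifPn => [/dvdzP[s ->]|lk].
  have -> : \sum_(j <- box r) cos (y + j%:~R * ((s * l%:Z)%:~R * (2 * pi) / l%:R)) =
     \sum_(j <- box r) cos y.
    apply: eq_bigr => j _; rewrite -(cos_2intpi y (j * s)) !rmorphM /= -pmulrn.
    by congr (cos (y + _)); rewrite [_ * (2 * pi)]mulrAC mulfK//; lra.
  rewrite big_const_seq count_predT iter_addr_0 mulr_natl; congr (_ *+ _).
  by rewrite /l; elim: (r) => [//|n IH] /=; rewrite IH doubleS.
set x := _ / l%:R.
have := sum_cos_box r x y.
have -> : l%:R * x / 2 = k%:~R * pi.
  by rewrite /x mulrCA divff// mulr1; lra.
have -> : sin (k%:~R * pi) = 0 :> R.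
  case: (k) => n; first exact: sin_natpi.
  by rewrite NegzE rmorphN mulNr sinN sin_natpi oppr0.
rewrite mulr0 => /eqP; rewrite mulf_eq0 => /orP[|/eqP//].
rewrite mulf_eq0 pnatr_eq0 /= => /eqP s0; exfalso.
(* Modulo [pi] the angle [x / 2 = k pi / l] equals [rho pi / l], which lies strictly between 0 and
   [pi], so its sine cannot vanish. *)
pose rho := (k %% l%:Z)%Z.
have rho_gt0 : 0 < rho.
  rewrite lt0r modz_ge0//; apply/andP; split=> //.
  by apply: contra lk => /eqP rho0; apply/dvdz_mod0P.
have rho_lt : rho < l by rewrite /rho (@ltz_pmod k l).
have kE : k = (k %/ l%:Z)%Z * l + rho by rewrite /rho -divz_eq.
pose p : R := pi / l%:R.
have lp : l%:R * p = pi by rewrite /p mulrCA divff// mulr1.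
have p_gt0 : 0 < p by rewrite divr_gt0 ?pi_gt0// ltr0n.
have xE : x / 2 = (k %/ l%:Z)%Z%:~R * pi + rho%:~R * p.
  have -> : x / 2 = k%:~R * p by rewrite /x /p; lra.
  by rewrite {1}kE rmorphD rmorphM /= -pmulrn -lp; lra.
move: s0; rewrite xE sinD; set s := (_ %/ _)%Z.
have -> : sin (s%:~R * pi) = 0 :> R.
  case: (s) => n; first exact: sin_natpi.
  by rewrite NegzE rmorphN mulNr sinN sin_natpi oppr0.
have : cos (s%:~R * pi) ^+ 2 = 1 :> R.
  case: (s) => n; first exact: cos_natpi_sqr.
  by rewrite NegzE rmorphN mulNr cosN cos_natpi_sqr.
have : 0 < sin (rho%:~R * p).
  apply: sin_gt0_pi; rewrite mulr_gt0 ?ltr0z//= -[ltRHS]lp ltr_pM2r//.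
  by rewrite -[l%:R]/(l%:Z%:~R) ltr_int.
move=> sp c2 /eqP; rewrite mul0r add0r mulf_eq0 (gt_eqF sp) orbF => /eqP c0.
by move: c2; rewrite c0 expr0n /= => /eqP; rewrite eq_sym oner_eq0.
Qed.
End Trigonometry.

(** * Averaged cosine powers and central binomial coefficients *)

Section Averaging.
Variable R : realType.

Lemma cbin_small m k : (m < `|k|)%N -> cbin R m k = 0.
Proof. by move=> mk; rewrite /cbin bin_small//; lia. Qed.

(** Averaging over the [2 r + 1] translates keeps only the frequencies divisible by [2 r + 1]. On
    the right the terms with [|k| (2 r + 1) > m] are zero. *)
Lemma average_cos_pow r m (t : R) :
  \sum_(j <- box r) (2 * cos ((t + j%:~R * (2 * pi)) / (2 * (r.*2.+1)%:R))) ^+ m.*2 =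
  (r.*2.+1)%:R *
  \sum_(k <- box m) cbin R m (k * (r.*2.+1)%:Z) * cos (k%:~R * t).
Proof.
set l := r.*2.+1; have l0 : l%:R != 0 :> R by rewrite pnatr_eq0.
under eq_bigr do rewrite cos_pow_box.
rewrite exchange_big /=.
transitivity (\sum_(k <- box m) cbin R m k *
   (if (l%:Z %| k)%Z then l%:R * cos (k%:~R * t / l%:R) else 0)).
  apply: eq_bigr => k _; rewrite -mulr_sumr -sum_roots_unity -/l.
  congr (_ * _); apply: eq_bigr => j _; congr cos.
  have -> : 2 * ((t + j%:~R * (2 * pi)) / (2 * l%:R)) =
            (t + j%:~R * (2 * pi)) / l%:R.
    by rewrite invfM; lra.
  lra.
transitivity (\sum_(k <- [seq k <- box m | (l%:Z %| k)%Z])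
    cbin R m k * (l%:R * cos (k%:~R * t / l%:R))).
  rewrite big_filter [RHS]big_mkcond; apply: eq_bigr => k _.
  by case: ifP; rewrite // mulr0.
transitivity (\sum_(k <- [seq k * l%:Z | k <- box m & (`|(k * l%:Z)%R| <= m)%N])
    cbin R m k * (l%:R * cos (k%:~R * t / l%:R))).
  apply: perm_big; apply: uniq_perm.
  - by rewrite filter_uniq// box_uniq.
  - rewrite map_inj_uniq ?filter_uniq ?box_uniq// => i j.
    by apply: mulIf; rewrite /l.
  move=> k; rewrite mem_filter mem_box; apply/andP/mapP.
    move=> [/dvdzP[s ->] sm]; exists s => //.
    by rewrite mem_filter mem_box sm /=; move: sm; rewrite abszM; nia.
  move=> [s]; rewrite mem_filter => /andP[sm _] ->.
  by rewrite dvdz_mull.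
rewrite big_map big_filter mulr_sumr.
rewrite [RHS](bigID (fun k => (`|(k * l%:Z)%R| <= m)%N)) /=.
rewrite [X in _ + X]big1 ?addr0; last first.
  by move=> k; rewrite -ltnNge => km; rewrite cbin_small// mul0r mulr0.
apply: eq_bigr => k _; rewrite mulrCA; congr (_ * (_ * cos _)).
by rewrite rmorphM /= -pmulrn mulrAC mulfK.
Qed.

Lemma cbin_ratio m i : (m + i.+1)%:R * cbin R m i.+1 =
  (m%:R - i%:R) * cbin R m i.
Proof.
have [im|im] := ltnP m i.
  by rewrite !cbin_small ?mulr0//; lia.
rewrite /cbin -natrB// -!natrM; congr _%:R.
have := mul_bin_left m.*2 (m + i).
rewrite addnS => ->; congr (_ * _)%N; lia.
Qed.

Lemma cbin_gt0 m : 0 < cbin R m 0.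
Proof. by rewrite /cbin ltr0n bin_gt0; lia. Qed.

Lemma cbin_ge0 m k : 0 <= cbin R m k.
Proof. exact: ler0n. Qed.

Lemma cbin_abs m k : cbin R m k = cbin R m `|k|%N.
Proof. by rewrite /cbin; congr 'C(_, _)%:R; lia. Qed.

(** The ratio of successive coefficients is [1 - (2 i + 1) / (m + i + 1)], at most
    [exp (- (2 i + 1) / (m + n))], and the first [i] odd numbers add up to [i ^ 2]. *)
Lemma cbin_ub m n i : (0 < m)%N -> (i <= n)%N ->
  cbin R m i <= cbin R m 0 * expR (- (i%:R ^+ 2 / (m + n)%:R)).
Proof.
move=> m0; elim: i => [|i IH] i_n.
  by rewrite expr0n mul0r oppr0 expR0 mulr1.
have mn0 : 0 < (m + n)%:R :> R by rewrite ltr0n; lia.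
have mi0 : 0 < (m + i.+1)%:R :> R by rewrite ltr0n; lia.
rewrite -(ler_pM2l mi0) cbin_ratio.
have {}IH := IH (ltnW i_n).
have [im|mi] := leqP i m; last first.
  rewrite (@le_trans _ _ 0)// ?mulr_ge0 ?cbin_ge0 ?expR_ge0 ?ler0n//.
  by rewrite mulr_le0_ge0 ?cbin_ge0// subr_le0 ler_nat ltnW.
apply: (@le_trans _ _ ((m%:R - i%:R) *
   (cbin R m 0 * expR (- (i%:R ^+ 2 / (m + n)%:R))))).
  by rewrite ler_wpM2l// subr_ge0 ler_nat.
rewrite mulrCA [leRHS]mulrCA ler_wpM2l ?cbin_ge0//.
have -> : - (i.+1%:R ^+ 2 / (m + n)%:R) = - (i%:R ^+ 2 / (m + n)%:R) +
    - ((2 * i%:R + 1) / (m + n)%:R) :> R by rewrite -natr1; lra.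
rewrite expRD mulrC [leRHS]mulrCA ler_wpM2l ?expR_ge0//.
have mi : m%:R - i%:R = (m + i.+1)%:R * (1 - (2 * i%:R + 1) / (m + i.+1)%:R) :> R.
  by rewrite mulrBr mulr1 mulrCA divff ?lt0r_neq0// mulr1 natrD -natr1; lra.
rewrite mi ler_wpM2l ?(ltW mi0)//.
apply: le_trans (expR_ge1Dx _); rewrite lerD2l lerN2.
apply: ler_wpM2l; first by rewrite addr_ge0// mulr_ge0.
by rewrite lef_pV2 ?posrE// ler_nat; lia.
Qed.

(** The inverse ratio [1 + (2 i + 1) / (m - i)] is bounded by an exponential, using
    [m - i >= m + 1 - n] for [i < n]. *)
Lemma cbin_lb m n i : (i <= n)%N -> (n <= m)%N ->
  cbin R m 0 * expR (- (i%:R ^+ 2 / (m.+1 - n)%:R)) <= cbin R m i.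
Proof.
move=> + n_m; elim: i => [|i IH] i_n.
  by rewrite expr0n mul0r oppr0 expR0 mulr1.
have mn0 : 0 < (m.+1 - n)%:R :> R by rewrite ltr0n; lia.
have mi0 : 0 < (m + i.+1)%:R :> R by rewrite ltr0n; lia.
have {}IH := IH (ltnW i_n).
have im : 0 < m%:R - i%:R :> R by rewrite subr_gt0 ltr_nat; lia.
rewrite -(ler_pM2l mi0) cbin_ratio.
apply: (@le_trans _ _ ((m%:R - i%:R) *
   (cbin R m 0 * expR (- (i%:R ^+ 2 / (m.+1 - n)%:R))))); last first.
  by rewrite ler_wpM2l// ltW.
rewrite mulrCA [leRHS]mulrCA ler_wpM2l ?cbin_ge0//.
have -> : - (i.+1%:R ^+ 2 / (m.+1 - n)%:R) = - (i%:R ^+ 2 / (m.+1 - n)%:R) +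
    - ((2 * i%:R + 1) / (m.+1 - n)%:R) :> R by rewrite -natr1; lra.
rewrite expRD mulrCA [leRHS]mulrC ler_wpM2l ?expR_ge0//.
rewrite expRN ler_pdivrMr ?expR_gt0//.
apply: (@le_trans _ _ ((m%:R - i%:R) * (1 + (2 * i%:R + 1) / (m%:R - i%:R)))).
  by rewrite mulrDr mulr1 mulrCA divff ?lt0r_neq0// mulr1 natrD -natr1; lra.
rewrite ler_wpM2l ?(ltW im)//; apply: le_trans (expR_ge1Dx _).
rewrite lerD2l; apply: ler_wpM2l; first by rewrite addr_ge0// mulr_ge0.
by rewrite lef_pV2 ?posrE// -natrB ?ler_nat; lia.
Qed.

Section Tannery.
Variables (f : nat -> int -> R) (g : int -> R) (N : nat -> nat) (C r : R).
Hypotheses (C0 : 0 <= C) (r01 : 0 <= r < 1).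

Lemma box_sum_cvg (h : int -> R) : (forall k, `|h k| <= C * r ^+ `|k|) ->
  cvgn (fun M => \sum_(k <- box M) h k).
Proof.
move=> hle; apply/cauchy_cvgP/cauchy_exP => e e0.
have /cvgr0Pnorm_lt/(_ (e / (2 * C / (1 - r) + 1))) : r ^+ n @[n --> \oo] --> 0.
  by case/andP: r01 => r0 r1; apply: cvg_expr; rewrite ger0_norm.
have c0 : 0 <= 2 * C / (1 - r).
  by case/andP: r01 => r0 r1; rewrite divr_ge0 ?mulr_ge0// subr_ge0 ltW.
have c1 : 0 < 2 * C / (1 - r) + 1 by lra.
rewrite divr_gt0// => /(_ isT)[n _ hn].
exists (\sum_(k <- box n) h k); exists n => // M /= nM.
rewrite -ball_normE /= distrC.
apply: le_lt_trans (box_tail_le C0 r01 (fun k _ => hle k) nM) _.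
have := hn n (leqnn n) => /=; rewrite ger0_norm ?exprn_ge0//; last by case/andP: r01.
rewrite ltr_pdivlMr// => small; apply: (le_lt_trans _ small).
have rn : 0 <= r ^+ n by rewrite exprn_ge0//; case/andP: r01.
by rewrite mulrDr mulr1; lra.
Qed.

Hypothesis f_le : forall n k, `|f n k| <= C * r ^+ `|k|.
Hypothesis fg : forall k, f n k @[n --> \oo] --> g k.
Hypothesis N_cvg : forall J, \forall n \near \oo, (J <= N n)%N.

(** Dominated convergence over growing boxes: the terms in a fixed box converge one by one, and the
    geometric majorant bounds the rest uniformly in [n]. *)
Lemma tannery (l : R) : (\sum_(k <- box M) g k) @[M --> \oo] --> l ->
  (\sum_(k <- box (N n)) f n k) @[n --> \oo] --> l.
Proof.
move=> gl; apply/cvgrPdist_le => e e0.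
have c0 : 0 <= 2 * C / (1 - r).
  by case/andP: r01 => r0 r1; rewrite divr_ge0 ?mulr_ge0// subr_ge0 ltW.
have c1 : 0 < 2 * C / (1 - r) + 1 by lra.
have e3 : 0 < e / 3 by rewrite divr_gt0.
have /cvgr0Pnorm_lt/(_ (e / 3 / (2 * C / (1 - r) + 1))) : r ^+ n @[n --> \oo] --> 0.
  by case/andP: r01 => r0 r1; apply: cvg_expr; rewrite ger0_norm.
rewrite divr_gt0// => /(_ isT)[J1 _ hJ1].
move/cvgrPdist_le : (gl) => /(_ _ e3)[J2 _ hJ2].
pose J := maxn J1 J2.
have rJ : 2 * C * r ^+ J / (1 - r) <= e / 3.
  have := hJ1 J (leq_maxl _ _) => /=.
  rewrite ger0_norm ?exprn_ge0//; last by case/andP: r01.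
  rewrite ltr_pdivlMr// => /ltW small; apply: (le_trans _ small).
  have rn : 0 <= r ^+ J by rewrite exprn_ge0//; case/andP: r01.
  by rewrite mulrDr mulr1; lra.
have lJ := hJ2 J (leq_maxr _ _).
have fgJ : (\sum_(k <- box J) f n k) @[n --> \oo] --> \sum_(k <- box J) g k.
  by apply: cvg_big => [|k _]; [exact: add_continuous|exact: fg].
move/cvgrPdist_le : fgJ => /(_ _ e3) fgJ.
near=> n.
have h1 : `|\sum_(k <- box J) g k - \sum_(k <- box J) f n k| <= e / 3 by near: n.
have h2 : `|\sum_(k <- box (N n)) f n k - \sum_(k <- box J) f n k| <= e / 3.
  apply: le_trans rJ; apply: box_tail_le => //.
  by near: n; exact: N_cvg.
have -> : l - \sum_(k <- box (N n)) f n k = (l - \sum_(k <- box J) g k) +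
  ((\sum_(k <- box J) g k - \sum_(k <- box J) f n k) -
   (\sum_(k <- box (N n)) f n k - \sum_(k <- box J) f n k)) by lra.
apply: le_trans (ler_normD _ _) _.
have h3 := ler_normB (\sum_(k <- box J) g k - \sum_(k <- box J) f n k)
  (\sum_(k <- box (N n)) f n k - \sum_(k <- box J) f n k).
by move: lJ => /=; lra.
Unshelve. all: by end_near. Qed.

End Tannery.
End Averaging.

(** * The Villain weight as a limit of sums over boxes *)

Lemma sum_le_esum (R : realType) (T : choiceType) (D : set T) (f : T -> R)
    (s : seq T) : uniq s -> (forall x, x \in s -> D x) ->
  ((\sum_(x <- s) f x)%:E <= \esum_(x in D) (f x)%:E)%E.
Proof.
move=> us sD; apply: esum_ge; exists [set` s].
  by split=> [|x /= xs]; [exact: finite_seq|exact: sD].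
by rewrite -fsbig_seq// sumEFin.
Qed.

Lemma esum_le_seq (R : realType) (T : choiceType) (D : set T) (f : T -> R) (l : R) :
  (forall s : seq T, uniq s -> (forall x, x \in s -> D x) ->
    \sum_(x <- s) f x <= l) ->
  ((\esum_(x in D) (f x)%:E)%E <= l%:E)%E.
Proof.
move=> le_l; apply: ge_ereal_sup => _ [X [finX XD] <-].
rewrite fsbig_finite//= sumEFin lee_fin; apply: le_l => [|x]; first exact: fset_uniq.
by rewrite in_fset_set// inE => /XD.
Qed.

Lemma esum_box (R : realType) (f : int -> R) (l : R) :
  (forall k, 0 <= f k) -> (\sum_(k <- box M) f k) @[M --> \oo] --> l ->
  (\esum_(k in [set: int]) (f k)%:E)%E = l%:E.
Proof.
move=> f0 fl; apply/eqP; rewrite eq_le; apply/andP; split.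
  apply: esum_le_seq => s us _.
  apply: (cvgr_to_ge fl); exists (\max_(k <- s) `|k|%N) => // M /= sM.
  apply: ler_sum_sub => // k ks; rewrite mem_box; apply: leq_trans sM.
  by rewrite (big_rem k ks) leq_maxl.
case E : (\esum_(k in _) _)%E => [e| |]; rewrite ?leey//.
  rewrite lee_fin; apply: (cvgr_to_le fl); near=> M; rewrite -lee_fin -E.
  by apply: sum_le_esum => //; exact: box_uniq.
have : (0 <= \esum_(k in [set: int]) (f k)%:E)%E.
  by apply: esum_ge0 => k _; rewrite lee_fin.
by rewrite E.
Unshelve. all: by end_near. Qed.

Section Theta.
Variables (R : realType) (beta : R).
Hypothesis beta_gt0 : 0 < beta.

Let term (t : R) (k : int) : R := expR (- (beta / 2) * (t + 2 * pi * k%:~R) ^+ 2).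

Lemma villain_weight_periodic t (k : int) :
  villain_weight beta (t + 2 * pi * k%:~R) = villain_weight beta t.
Proof.
rewrite /villain_weight; congr fine.
rewrite [RHS](@reindex_esum R _ _ [set: int] _ (fun m => k + m)).
  apply: eq_esum => m _; congr (expR (_ * _ ^+ 2))%:E.
  by rewrite rmorphD /=; lra.
split=> [//|m n _ _|m _]; first exact: addrI.
by exists (m - k) => //; rewrite addrC subrK.
Qed.

Let sqr_ge t (k : int) : `|t| <= pi -> `|k|%N%:R <= (t + 2 * pi * k%:~R) ^+ 2 :> R.
Proof.
move=> tpi; have p2 := pi_ge2 R.
have [->|k0] := eqVneq k 0; first by rewrite sqr_ge0.
have k1 : 1 <= `|k|%N%:R :> R by rewrite ler1n absz_gt0.
have kE : `|k%:~R| = `|k|%N%:R :> R by rewrite -intr_norm -abszE -pmulrn.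
have : `|k|%N%:R <= `|t + 2 * pi * k%:~R|.
  have := ler_normD (t + 2 * pi * k%:~R) (- t).
  rewrite addrAC subrr add0r normrN normrM kE ger0_norm ?mulr_ge0//; last lra.
  have : 2 * `|k|%N%:R <= pi * `|k|%N%:R :> R by rewrite ler_wpM2r//; lra.
  have : pi * 1 <= pi * `|k|%N%:R :> R by rewrite ler_wpM2l//; lra.
  lra.
rewrite -[X in _ -> _ <= X]real_normK ?num_real// => H; apply: le_trans (H) _.
by rewrite expr2 ler_peMl//; lra.
Qed.

Let ratio : R := expR (- (beta / 4)).
Let ratio01 : 0 <= ratio < 1.
Proof. by apply: geom_ratio; rewrite divr_gt0. Qed.

(** The rate [beta / 4] is half that of the Villain terms because [cos_pow_le] yields no better; the
    same majorant then serves the cosine powers and their limits. *)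
Lemma villain_term_le t (k : int) : `|t| <= pi ->
  expR (- (beta / 4 * (t + 2 * pi * k%:~R) ^+ 2)) <= 1 * expR (- (beta / 4)) ^+ `|k|.
Proof.
move=> tpi; rewrite mul1r -expRM_natr ler_expR mulNr lerN2.
by rewrite ler_wpM2l ?sqr_ge// divr_ge0// ltW.
Qed.

Lemma villain_weight_cvg t : `|t| <= pi ->
  (\sum_(k <- box M) term t k) @[M --> \oo] --> villain_weight beta t.
Proof.
move=> tpi.
have cv : cvgn (fun M => \sum_(k <- box M) term t k).
  apply: (box_sum_cvg (@ler01 R) ratio01) => k; rewrite ger0_norm ?expR_ge0//.
  apply: le_trans (villain_term_le k tpi); rewrite ler_expR.
  by have := mulr_ge0 (ltW beta_gt0) (sqr_ge0 (t + 2 * pi * k%:~R)); lra.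
rewrite /villain_weight (esum_box _ cv)//= => k; exact: expR_ge0.
Qed.

Lemma villain_weight_gt0 : 0 < villain_weight beta 0.
Proof.
have t0 : `|0 : R| <= pi by rewrite normr0 pi_ge0.
apply: (lt_le_trans (expR_gt0 (- (beta / 2) * (0 + 2 * pi * 0%:~R) ^+ 2))).
apply: (cvgr_to_ge (villain_weight_cvg t0)); near=> M.
have : \sum_(k <- [:: 0]) term 0 k <= \sum_(k <- box M) term 0 k.
  apply: ler_sum_sub => // [k|k _]; last exact: expR_ge0.
  by rewrite inE => /eqP->; rewrite mem_box.
by rewrite big_seq1.
Unshelve. all: by end_near. Qed.

End Theta.
Section PolyaLength.
Variable R : realType.

Definition polya_len (r : nat) : R := (r.*2.+1)%:R.

Lemma polya_len_ge1 r : 1 <= polya_len r.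
Proof. by rewrite /polya_len ler1n. Qed.

Lemma polya_len_inv_cvg : (polya_len r)^-1 @[r --> \oo] --> 0.
Proof.
apply: (squeeze_cvgr _ (cvg_cst 0) cvg_harmonic); near=> r.
rewrite invr_ge0 ler0n /= /harmonic lef_pV2 ?posrE ?ltr0n// ler_nat; lia.
Unshelve. all: by end_near. Qed.

End PolyaLength.

(* Polya's proof of the theta identity: in [average_cos_pow] take
   [m = 2 beta (2 r + 1) ^ 2], up to rounding, and let [r] tend to infinity;
   the powers of cosines tend to the terms of [villain_weight] and the ratios
   of binomial coefficients to its Fourier coefficients. *)
Section Polya.
Variables (R : realType) (beta : R).
Hypothesis beta_gt0 : 0 < beta.

Local Notation l := (polya_len R).
(** [cos (x / (2 l)) ^ (2 m)] behaves like [exp (- m x ^ 2 / (4 l ^ 2))], which asks for [m] close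
    to [2 beta l ^ 2]. Rounding up gives the lower bound on [m] used for decay. *)
Definition polya_deg (r : nat) : nat := (Num.truncn (2 * beta * l r ^+ 2)).+1.
Local Notation m := polya_deg.

Let l_gt0 r : 0 < l r. Proof. exact: lt_le_trans ltr01 (polya_len_ge1 R r). Qed.
Let l_neq0 r : l r != 0. Proof. by rewrite lt0r_neq0. Qed.

Lemma polya_deg_bounds r : 2 * beta * l r ^+ 2 <= (m r)%:R <= 2 * beta * l r ^+ 2 + 1.
Proof.
have : 0 <= 2 * beta * l r ^+ 2 by rewrite !mulr_ge0// ltW.
move/truncn_itv => /andP[h1 h2]; rewrite /polya_deg (ltW h2) /=.
by rewrite -natr1 lerD2r.
Qed.

Let linv_cvg : (l r)^-1 @[r --> \oo] --> 0 := @polya_len_inv_cvg R.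

Let ml_cvg : (m r)%:R / l r ^+ 2 @[r --> \oo] --> 2 * beta.
Proof.
have up : 2 * beta + (l r)^-1 * (l r)^-1 @[r --> \oo] --> 2 * beta.
  rewrite -[X in _ --> X]addr0; apply: cvgD; first exact: cvg_cst.
  by rewrite -(mulr0 0); apply: cvgM.
apply: (squeeze_cvgr _ (cvg_cst (2 * beta)) up); near=> r.
have /andP[h1 h2] := polya_deg_bounds r; have l2 : 0 < l r ^+ 2 by rewrite exprn_gt0.
rewrite ler_pdivlMr// h1 /= ler_pdivrMr// mulrDl (le_trans h2)// lerD2l.
by rewrite expr2 mulrACA mulVf// mul1r.
Unshelve. all: by end_near. Qed.

Let cos_half (u : R) : cos u = 1 - 2 * sin (u / 2) ^+ 2.
Proof.
have -> : cos u = cos (u / 2 *+ 2) by congr cos; rewrite mulr2n; lra.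
by rewrite cos_mulr2n mulr2n cos2sin2; lra.
Qed.

Let expR_ge_sub (s : R) : 1 - s <= expR (- s).
Proof. exact: expR_ge1Dx. Qed.

Let expR_le_sub (s : R) : 0 <= s < 1 -> expR (- (s / (1 - s))) <= 1 - s.
Proof.
move=> /andP[s0 s1]; have s1' : 0 < 1 - s by rewrite subr_gt0.
rewrite expRN -[leRHS]invrK lef_pV2 ?posrE ?expR_gt0 ?invr_gt0//.
apply: le_trans (expR_ge1Dx _).
by rewrite -(ler_pM2r s1') mulVf ?lt0r_neq0// mulrDl divfK ?lt0r_neq0//; lra.
Qed.

(** With [S = 2 sin ^ 2 (x / (4 l))], the cosine [1 - S] lies between [exp (- S / (1 - S))] and
    [exp (- S)], and [2 m S] tends to [beta x ^ 2 / 2]. *)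
Lemma cos_pow_cvg (x : R) : cos (x / (2 * l r)) ^+ (m r).*2 @[r --> \oo] -->
  expR (- (beta / 2) * x ^+ 2).
Proof.
pose v r := x / 4 * (l r)^-1; pose S r := 2 * sin (v r) ^+ 2.
have cosE r : cos (x / (2 * l r)) = 1 - S r.
  rewrite cos_half /S /v; congr (1 - 2 * sin _ ^+ 2).
  by rewrite invfM; move: (l r) => L; lra.
have v0 : v r @[r --> \oo] --> 0.
  by rewrite -[X in _ --> X](mulr0 (x / 4)); apply: cvgM => //; exact: cvg_cst.
have lv r : l r ^+ 2 * v r ^+ 2 = x ^+ 2 / 16.
  have -> : l r ^+ 2 * v r ^+ 2 = (l r * (l r)^-1) ^+ 2 * (x ^+ 2 / 16).
    by rewrite /v; move: (l r) => L; lra.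
  by rewrite divff// expr1n mul1r.
have lS : l r ^+ 2 * S r @[r --> \oo] --> x ^+ 2 / 8.
  have lo : x ^+ 2 / 8 * (1 - v r ^+ 2) @[r --> \oo] --> x ^+ 2 / 8.
    rewrite -[X in _ --> X]mulr1; apply: cvgM; first exact: cvg_cst.
    rewrite -[X in _ --> X]subr0; apply: cvgB; first exact: cvg_cst.
    by rewrite -(mulr0 0); under eq_fun do rewrite expr2; apply: cvgM.
  apply: (squeeze_cvgr _ lo (cvg_cst _)); near=> r; rewrite /S.
  have l2 : 0 <= l r ^+ 2 by rewrite exprn_ge0// ltW.
  have h2 := ler_wpM2l l2 (sin_sqr_le (v r)).
  have h1 := ler_wpM2l l2 (sin_sqr_ge (v r)); move: h1 h2.
  rewrite lv [X in X <= _ -> _]mulrA lv.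
  move: (l r ^+ 2) (sin (v r) ^+ 2) (v r ^+ 2) => L s w h1 h2.
  by apply/andP; split; lra.
have S0 : S r @[r --> \oo] --> 0.
  have -> : (fun r => S r) = (fun r => (l r ^+ 2 * S r) * ((l r)^-1 * (l r)^-1)).
    apply/funext => r; rewrite mulrAC -invfM -expr2 divff ?mul1r//.
    by rewrite expf_neq0.
  rewrite -(mulr0 (x ^+ 2 / 8)); apply: cvgM => //.
  by rewrite -[X in _ --> X](mulr0 0); apply: cvgM.
have P : (m r)%:R * S r @[r --> \oo] --> beta * x ^+ 2 / 4.
  have -> : (fun r => (m r)%:R * S r) =
            (fun r => ((m r)%:R / l r ^+ 2) * (l r ^+ 2 * S r)).
    by apply/funext => r; rewrite [RHS]mulrA divfK// expf_neq0.
  have -> : beta * x ^+ 2 / 4 = 2 * beta * (x ^+ 2 / 8) by lra.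
  exact: cvgM.
have e1 : expR (- (2 * ((m r)%:R * S r))) @[r --> \oo] -->
    expR (- (beta / 2) * x ^+ 2).
  apply: continuous_cvg; first exact: continuous_expR.
  have -> : - (beta / 2) * x ^+ 2 = - (2 * (beta * x ^+ 2 / 4)) by lra.
  by apply: cvgN; apply: cvgM => //; exact: cvg_cst.
have e2 : expR (- (2 * ((m r)%:R * S r) / (1 - S r))) @[r --> \oo] -->
    expR (- (beta / 2) * x ^+ 2).
  apply: continuous_cvg; first exact: continuous_expR.
  have -> : - (beta / 2) * x ^+ 2 = - (2 * (beta * x ^+ 2 / 4) / (1 - 0)).
    by rewrite subr0; lra.
  apply: cvgN; apply: cvgM; first by apply: cvgM => //; exact: cvg_cst.
  apply: cvgV; first by rewrite subr0 oner_neq0.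
  by apply: cvgB => //; exact: cvg_cst.
apply: (squeeze_cvgr _ e2 e1).
have S1 : \forall r \near \oo, S r < 1.
  by apply: (cvgr_lt _ S0); exact: ltr01.
near=> r.
have Sr : 0 <= S r < 1 by rewrite /S mulr_ge0 ?sqr_ge0//=; near: r.
have S1r : 0 <= 1 - S r by case/andP: Sr => _ /ltW; lra.
rewrite cosE; apply/andP; split.
  have -> : - (2 * ((m r)%:R * S r) / (1 - S r)) = - (S r / (1 - S r)) * (m r).*2%:R.
    by rewrite -muln2 natrM; lra.
  by rewrite expRM_natr; apply: lerXn2r; rewrite ?nnegrE ?expR_ge0// expR_le_sub.
have -> : - (2 * ((m r)%:R * S r)) = - S r * (m r).*2%:R.
  by rewrite -muln2 natrM; lra.
by rewrite expRM_natr; apply: lerXn2r; rewrite ?nnegrE ?expR_ge0.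
Unshelve. all: by end_near. Qed.

(** The hypotheses give [|x| <= pi l], so [v = x / (4 l)] stays within [pi / 4], where
    [sin ^ 2 v >= v ^ 2 / 2]. This last bound turns the rate [beta / 2] into [beta / 4]. *)
Lemma cos_pow_le r (t : R) (j : int) : `|t| <= pi -> (`|j| <= r)%N ->
  `|cos ((t + j%:~R * (2 * pi)) / (2 * l r)) ^+ (m r).*2| <=
  expR (- (beta / 4 * (t + 2 * pi * j%:~R) ^+ 2)).
Proof.
move=> tpi jr; set x := t + j%:~R * (2 * pi).
have -> : t + 2 * pi * j%:~R = x by rewrite /x; lra.
have xl : `|x| <= pi * l r.
  apply: le_trans (ler_normD _ _) _.
  have : `|j%:~R * (2 * pi)| <= r%:R * (2 * pi) :> R.
    rewrite normrM [X in _ * X]ger0_norm ?mulr_ge0 ?pi_ge0//.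
    rewrite ler_wpM2r ?mulr_ge0 ?pi_ge0// -intr_norm -abszE -pmulrn ler_nat//.
  have -> : l r = r%:R * 2 + 1 by rewrite /polya_len -[LHS]natr1 -muln2 natrM.
  by move: tpi; set p := pi; lra.
clearbody x; pose v := x / 4 * (l r)^-1.
have v4 : `|v| <= pi / 4.
  rewrite /v normrM [X in _ * X]ger0_norm ?invr_ge0 ?(ltW (l_gt0 r))//.
  rewrite ler_pdivrMr// normrM [X in _ * X]ger0_norm ?invr_ge0//.
  by move: xl; lra.
have uE : x / (2 * l r) / 2 = v by rewrite /v invfM; move: (l r) => L; lra.
have c0 : 0 <= cos (x / (2 * l r)).
  apply: cos_ge0_pihalf.
  have -> : x / (2 * l r) = 2 * v by rewrite -uE [RHS]mulrC divfK.
  by move: v4; rewrite ler_norml; set p := pi; lra.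
rewrite ger0_norm ?exprn_ge0//.
apply: (@le_trans _ _ (expR (- (2 * sin v ^+ 2)) ^+ (m r).*2)).
  apply: lerXn2r; rewrite ?nnegrE ?expR_ge0//.
  by rewrite cos_half uE expR_ge_sub.
rewrite -expRM_natr ler_expR -muln2 natrM mulNr lerN2.
have := sin_sqr_ge_half v4 => sv.
apply: (@le_trans _ _ (v ^+ 2 * ((m r)%:R * 2))); last first.
  by apply: ler_wpM2r; [rewrite mulr_ge0|lra].
have /andP[h1 _] := polya_deg_bounds r.
have lv : l r ^+ 2 * v ^+ 2 = x ^+ 2 / 16.
  have -> : l r ^+ 2 * v ^+ 2 = (l r * (l r)^-1) ^+ 2 * (x ^+ 2 / 16).
    by rewrite /v; move: (l r) => L; lra.
  by rewrite divff// expr1n mul1r.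
have := ler_wpM2l (sqr_ge0 v) h1.
have -> : v ^+ 2 * (2 * beta * l r ^+ 2) = 2 * beta * (x ^+ 2 / 16).
  by rewrite -lv; lra.
lra.
Qed.

(** For [i = |k| l] the exponents [i ^ 2 / (m + i)] and [i ^ 2 / (m + 1 - i)] of the two bounds both
    tend to [k ^ 2 / (2 beta)]. *)
Lemma cbin_cvg (k : int) :
  cbin R (m r) (k * (r.*2.+1)%:Z) / cbin R (m r) 0 @[r --> \oo] -->
  gauss (2 * beta)^-1 k.
Proof.
set K := `|k|%N; pose i r := (K * r.*2.+1)%N.
have iE r : (i r)%:R = K%:R * l r by rewrite natrM.
have cE r : cbin R (m r) (k * (r.*2.+1)%:Z) = cbin R (m r) (i r).
  by rewrite cbin_abs abszM.
have gE : gauss (2 * beta)^-1 k = expR (- (K%:R ^+ 2 / (2 * beta))).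
  rewrite /gauss [_^-1 * _]mulrC; suff -> : k%:~R ^+ 2 = K%:R ^+ 2 :> R by [].
  by rewrite -[LHS]real_normK ?num_real// -intr_norm -abszE -pmulrn.
have b2 : 2 * beta != 0 by rewrite lt0r_neq0// mulr_gt0.
have Kl : K%:R * (l r)^-1 @[r --> \oo] --> 0.
  by rewrite -[X in _ --> X](mulr0 K%:R); apply: cvgM => //; exact: cvg_cst.
have sqE r d : (i r)%:R ^+ 2 / d = K%:R ^+ 2 / (d / l r ^+ 2).
  by rewrite iE exprMn invf_div [RHS]mulrA.
have e1 : expR (- ((i r)%:R ^+ 2 / (m r + i r)%:R)) @[r --> \oo] -->
    gauss (2 * beta)^-1 k.
  rewrite gE; apply: continuous_cvg; first exact: continuous_expR.
  apply: cvgN; under eq_fun do rewrite sqE.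
  apply: cvgM; first exact: cvg_cst.
  apply: cvgV => //.
  have -> : (fun r => (m r + i r)%:R / l r ^+ 2) =
            (fun r => (m r)%:R / l r ^+ 2 + K%:R * (l r)^-1).
    apply/funext => r; rewrite natrD iE mulrDl expr2 invfM; congr (_ + _).
    by rewrite -mulrA mulVKf.
  by rewrite -[X in _ --> X]addr0; apply: cvgD.
have im : \forall r \near \oo, (i r <= m r)%N.
  have : \forall r \near \oo, K%:R * (l r)^-1 < 2 * beta.
    by apply: (cvgr_lt _ Kl); rewrite mulr_gt0.
  apply: filterS => r h; rewrite -(ler_nat R) iE.
  have /andP[+ _] := polya_deg_bounds r; apply: le_trans.
  by rewrite expr2 mulrA ler_wpM2r ?(ltW (l_gt0 r))// -ler_pdivrMr// ltW.
have e2 : expR (- ((i r)%:R ^+ 2 / ((m r).+1 - i r)%:R)) @[r --> \oo] -->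
    gauss (2 * beta)^-1 k.
  rewrite gE; apply: continuous_cvg; first exact: continuous_expR.
  apply: cvgN; under eq_fun do rewrite sqE.
  apply: cvgM; first exact: cvg_cst.
  apply: cvgV => //.
  have lim : (m r)%:R / l r ^+ 2 + (l r)^-1 * (l r)^-1 - K%:R * (l r)^-1
      @[r --> \oo] --> 2 * beta.
    rewrite -[X in _ --> X]subr0 -[X in _ --> X - _]addr0.
    apply: cvgB => //; apply: cvgD => //.
    by rewrite -[X in _ --> X](mulr0 0); apply: cvgM.
  apply: cvg_trans lim; apply: near_eq_cvg.
  apply: filterS im => r im.
  rewrite natrB; last exact: leqW.
  rewrite -natr1 iE mulrDl mulrDl mulNr expr2 invfM mul1r; congr (_ + _ - _).
  by rewrite -mulrA mulVKf.
apply: (squeeze_cvgr _ e2 e1); apply: filterS im => r im.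
have c0 := cbin_gt0 R (m r).
rewrite cE ler_pdivlMr// ler_pdivrMr// ![expR _ * _]mulrC.
by rewrite cbin_lb// cbin_ub.
Qed.

Let ratio : R := expR (- (4 * beta + 2)^-1).

(** The constant in [ratio] comes from [2 m <= (4 beta + 2) l ^ 2], a consequence of [l >= 1],
    together with [|k| <= k ^ 2]. *)
Lemma cbin_le r (k : int) :
  cbin R (m r) (k * (r.*2.+1)%:Z) / cbin R (m r) 0 <= ratio ^+ `|k|.
Proof.
have c0 := cbin_gt0 R (m r); rewrite ler_pdivrMr// [leRHS]mulrC.
have [km|km] := leqP (`|k| * r.*2.+1)%N (m r); last first.
  rewrite cbin_small; last by rewrite abszM.
  by rewrite mulr_ge0 ?exprn_ge0 ?expR_ge0 ?cbin_ge0.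
rewrite cbin_abs abszM.
apply: le_trans (cbin_ub R (n := m r) _ km) _ => //.
rewrite ler_wpM2l ?cbin_ge0// /ratio -expRM_natr ler_expR mulNr lerN2.
have b0 : 0 < 4 * beta + 2 by have := beta_gt0; lra.
have m0 : 0 < (m r + m r)%:R :> R by rewrite ltr0n.
rewrite ler_pdivlMr// -mulrA ler_pdivrMl// [leLHS]mulrC.
have /andP[_ h2] := polya_deg_bounds r.
have l2 : 1 <= l r ^+ 2 by rewrite exprn_ege1 ?polya_len_ge1.
have K2 : `|k|%N%:R <= `|k|%N%:R ^+ 2 :> R by rewrite -natrX ler_nat; nia.
have h3 : (m r + m r)%:R <= (4 * beta + 2) * l r ^+ 2 by rewrite natrD; lra.
apply: (@le_trans _ _ (((4 * beta + 2) * l r ^+ 2) * `|k|%N%:R ^+ 2)).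
  by apply: ler_pM => //; exact: ler0n.
by rewrite natrM -/(l r); move: (l r) => L; lra.
Qed.
End Polya.
Section ThetaIdentity.
Variables (R : realType) (beta : R).
Hypothesis beta_gt0 : 0 < beta.

Local Notation lam := (gauss (2 * beta)^-1).
Local Notation m := (polya_deg beta).

Definition fourier_box (M : nat) (t : R) : R :=
  \sum_(k <- box M) lam k * cos (k%:~R * t).

Let lam_le (k : int) (t : R) :
  `|lam k * cos (k%:~R * t)| <= 1 * expR (- (2 * beta)^-1) ^+ `|k|.
Proof.
rewrite normrM ger0_norm ?gauss_ge0// mul1r -[leRHS]mulr1.
apply: ler_pM; rewrite ?gauss_ge0 ?cos_max//.
by apply: gauss_le_geom; rewrite invr_gt0 mulr_gt0.
Qed.

Let lam01 : 0 <= expR (- (2 * beta)^-1) < 1.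
Proof. by apply: geom_ratio; rewrite invr_gt0 mulr_gt0. Qed.

Lemma fourier_box_cvg t : cvgn (fourier_box ^~ t).
Proof. by apply: (box_sum_cvg (@ler01 R) lam01) => k; exact: lam_le. Qed.

Lemma fourier_box_uniform t M : `|limn (fourier_box ^~ t) - fourier_box M t| <=
  2 * 1 * expR (- (2 * beta)^-1) ^+ M / (1 - expR (- (2 * beta)^-1)).
Proof.
have cv : `|fourier_box N t - fourier_box M t| @[N --> \oo] -->
          `|limn (fourier_box ^~ t) - fourier_box M t|.
  by apply: cvg_norm; apply: cvgB; [exact: fourier_box_cvg|exact: cvg_cst].
apply: (cvgr_to_le cv); exists M => // N /= MN.
by apply: box_tail_le => // k _; exact: lam_le.
Qed.

Let polya_sum (t : R) (r : nat) : R :=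
  \sum_(j <- box r) cos ((t + j%:~R * (2 * pi)) / (2 * polya_len R r)) ^+ (m r).*2.

Let polya_sumE t r : polya_sum t r =
  polya_len R r * cbin R (m r) 0 / 2 ^+ (m r).*2 *
  \sum_(k <- box (m r)) cbin R (m r) (k * (r.*2.+1)%:Z) / cbin R (m r) 0 *
                        cos (k%:~R * t).
Proof.
have c0 : cbin R (m r) 0 != 0 by rewrite lt0r_neq0// cbin_gt0.
have p0 : 2 ^+ (m r).*2 != 0 :> R by rewrite expf_neq0.
apply: (mulfI p0).
transitivity (polya_len R r * \sum_(k <- box (m r))
    cbin R (m r) (k * (r.*2.+1)%:Z) * cos (k%:~R * t)).
  rewrite -average_cos_pow /polya_sum mulr_sumr.
  by apply: eq_bigr => j _; rewrite exprMn.
rewrite [RHS]mulrA [2 ^+ _ * _]mulrC divfK// -mulrA; congr (_ * _).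
rewrite mulr_sumr; apply: eq_bigr => k _.
by rewrite mulrA [cbin R (m r) 0 * _]mulrC divfK.
Qed.

Let polya_sum_cvg t : `|t| <= pi ->
  polya_sum t r @[r --> \oo] --> villain_weight beta t.
Proof.
move=> tpi.
(* The geometric bound on the cosine powers holds only for [|j| <= r]; extension by 0 makes it hold
   for all [j]. *)
pose f r (j : int) := if (`|j| <= r)%N then
  cos ((t + j%:~R * (2 * pi)) / (2 * polya_len R r)) ^+ (m r).*2 else 0.
have -> : polya_sum t = (fun r => \sum_(j <- box r) f r j).
  apply/funext => r; rewrite /polya_sum big_seq [RHS]big_seq.
  by apply: eq_bigr => j; rewrite mem_box /f => ->.
apply: (tannery (@ler01 R) (geom_ratio (_ : 0 < beta / 4)) _ _ _
    (villain_weight_cvg beta_gt0 tpi)).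
- by rewrite divr_gt0.
- move=> r j; rewrite /f; case: ifP => [jr|_]; last first.
    by rewrite normr0 mul1r exprn_ge0 ?expR_ge0.
  apply: le_trans (cos_pow_le beta_gt0 tpi jr) _.
  exact: (villain_term_le beta_gt0 j tpi).
- move=> j; have -> : t + 2 * pi * j%:~R = t + j%:~R * (2 * pi) by lra.
  have lim := @cos_pow_cvg R beta beta_gt0 (t + j%:~R * (2 * pi)).
  apply: cvg_trans lim; apply: near_eq_cvg.
  by exists `|j|%N => // r /= jr; rewrite /f jr.
- by move=> J; exists J.
Qed.

Let right_sum_cvg t :
  \sum_(k <- box (m r)) cbin R (m r) (k * (r.*2.+1)%:Z) / cbin R (m r) 0 *
     cos (k%:~R * t) @[r --> \oo] --> limn (fourier_box ^~ t).
Proof.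
have b0 : 0 < (4 * beta + 2)^-1 by rewrite invr_gt0; have := beta_gt0; lra.
have gl : \sum_(k <- box M) lam k * cos (k%:~R * t) @[M --> \oo] -->
   limn (fourier_box ^~ t) := fourier_box_cvg (t := t).
pose f r (k : int) := cbin R (m r) (k * (r.*2.+1)%:Z) / cbin R (m r) 0 *
   cos (k%:~R * t).
apply: (tannery (f := f) (@ler01 R) (geom_ratio b0) _ _ _ gl).
- move=> r k; rewrite normrM mul1r -[leRHS]mulr1.
  rewrite ger0_norm ?divr_ge0 ?cbin_ge0//.
  by apply: ler_pM; rewrite ?divr_ge0 ?cbin_ge0 ?cos_max ?cbin_le.
- by move=> k; apply: cvgM; [exact: cbin_cvg|exact: cvg_cst].
- move=> J.
  have : \forall r \near \oo, J%:R * (polya_len R r)^-1 < 2 * beta.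
    have := @polya_len_inv_cvg R => /(cvgM (cvg_cst (J%:R : R))).
    by rewrite mulr0 => /cvgr_lt; apply; rewrite mulr_gt0.
  apply: filterS => r h; rewrite -(ler_nat R).
  have /andP[+ _] := polya_deg_bounds beta_gt0 r; apply: le_trans.
  have l1 := polya_len_ge1 R r.
  have := h; rewrite -ltr_pdivlMr ?invr_gt0 ?(lt_le_trans ltr01)// invrK.
  move=> /ltW/le_trans; apply.
  rewrite expr2 mulrA; apply: ler_peMr => //.
  by rewrite !mulr_ge0 ?(ltW beta_gt0) ?(le_trans ler01 l1).
Qed.

Let fourier0_ge1 : 1 <= limn (fourier_box ^~ 0).
Proof.
apply: (cvgr_to_ge (@fourier_box_cvg 0)); near=> M.
have : \sum_(k <- [:: 0]) lam k * cos (k%:~R * 0) <= fourier_box M 0.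
  apply: ler_sum_sub => // [k|k _].
    by rewrite inE => /eqP->; rewrite mem_box.
  by rewrite mulr0 cos0 mulr1 gauss_ge0.
by rewrite big_seq1 gauss0 mulr0 cos0 mulr1.
Unshelve. all: by end_near. Qed.

(** The prefactor [kap r] does not depend on [t], so its limit is read off at [t = 0], where the
    Fourier series is at least 1. *)
Let villain_weight_small t : `|t| <= pi ->
  villain_weight beta t =
  villain_weight beta 0 / limn (fourier_box ^~ 0) * limn (fourier_box ^~ t).
Proof.
move=> tpi; have z : `|0 : R| <= pi by rewrite normr0 pi_ge0.
have f0 : limn (fourier_box ^~ 0) != 0.
  by rewrite lt0r_neq0// (lt_le_trans ltr01).
pose kap r := polya_len R r * cbin R (m r) 0 / 2 ^+ (m r).*2.
pose S t r := \sum_(k <- box (m r)) cbin R (m r) (k * (r.*2.+1)%:Z) /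
   cbin R (m r) 0 * cos (k%:~R * t).
have S0 : S 0 r @[r --> \oo] --> limn (fourier_box ^~ 0) := @right_sum_cvg 0.
have kapc : kap r @[r --> \oo] --> villain_weight beta 0 / limn (fourier_box ^~ 0).
  have : polya_sum 0 r / S 0 r @[r --> \oo] -->
      villain_weight beta 0 / limn (fourier_box ^~ 0).
    by apply: cvgM; [exact: polya_sum_cvg|exact: cvgV].
  apply: cvg_trans; apply: near_eq_cvg.
  have : \forall r \near \oo, 0 < S 0 r.
    by apply: (cvgr_gt _ S0); exact: lt_le_trans ltr01 fourier0_ge1.
  by apply: filterS => r Sr; rewrite polya_sumE -/(S 0 r) mulfK ?lt0r_neq0.
apply: (@cvg_unique _ (@Rhausdorff R) _ _ _ _ (polya_sum_cvg tpi)).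
have -> : polya_sum t = (fun r => kap r * S t r).
  by apply/funext => r; exact: polya_sumE.
by apply: cvgM => //; exact: right_sum_cvg.
Qed.

Theorem villain_weight_fourier : exists2 c : R, 0 < c &
  forall t, villain_weight beta t = c * limn (fourier_box ^~ t).
Proof.
exists (villain_weight beta 0 / limn (fourier_box ^~ 0)) => [|t].
  by rewrite divr_gt0 ?villain_weight_gt0// (lt_le_trans ltr01).
pose k := Num.floor ((t + pi) / (2 * pi)).
pose s := t - 2 * pi * k%:~R.
have p2 : 0 < 2 * pi :> R by rewrite mulr_gt0 ?pi_gt0.
have tE : t = s + 2 * pi * k%:~R by rewrite /s; lra.
rewrite tE villain_weight_periodic villain_weight_small; last first.
  have := floor_itv ((t + pi) / (2 * pi)); rewrite -/k.
  rewrite ler_pdivlMr// ltr_pdivrMr// rmorphD /= => /andP[h1 h2].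
  by rewrite ler_norml /s; apply/andP; split; lra.
suff -> : fourier_box ^~ (s + 2 * pi * k%:~R) = fourier_box ^~ s by [].
apply/funext => M; apply: eq_bigr => j _; congr (_ * _).
rewrite -[RHS](cos_2intpi _ (j * k)); congr cos.
by rewrite rmorphM /=; lra.
Qed.

End ThetaIdentity.
(** * Angle integrals *)

Section CircleIntegral.
Variable R : realType.
Local Notation mu := (@lebesgue_measure R).

Lemma continuous_circle_integrable (f : R -> R) : continuous f ->
  mu.-integrable `[- pi, pi[ (EFin \o f).
Proof.
move=> cf; apply: (@integrableS _ _ _ mu `[- pi, pi]).
- exact: measurable_itv.
- exact: measurable_itv.
- by apply: subset_itvl; rewrite bnd_simp.
apply: continuous_compact_integrable; first exact: segment_compact.
exact: continuous_subspaceT.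
Qed.

Lemma circle_integral_cst (c : R) : \int[mu]_(t in `[- pi, pi[) c = 2 * pi * c.
Proof.
rewrite Rintegral_cst; last exact: measurable_itv.
have := @lebesgue_measure_itv R `[- pi, pi[; rewrite /= lte_fin gtrN ?pi_gt0//= => ->.
by rewrite /= opprK; lra.
Qed.

Lemma circle_integral_cos (n : int) (p : R) :
  \int[mu]_(t in `[- pi, pi[) cos (n%:~R * t + p) =
  if n == 0 then 2 * pi * cos p else 0.
Proof.
case: eqVneq => [->|n0].
  by under eq_Rintegral do rewrite mul0r add0r; exact: circle_integral_cst.
have nR : n%:~R != 0 :> R by rewrite intr_eq0.
have cf : continuous (fun t : R => cos (n%:~R * t + p)).
  move=> t; apply: (@continuous_comp _ _ _ (fun t : R => n%:~R * t + p)); last first.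
    exact: continuous_cos.
  by apply: cvgD; [apply: cvgM => //; exact: cvg_cst|exact: cvg_cst].
rewrite Rintegral_itv_bndo_bndc; last exact: continuous_circle_integrable.
pose F (t : R) := n%:~R^-1 * sin (n%:~R * t + p).
have dF (t : R) : is_derive t 1 F (cos (n%:~R * t + p)).
  rewrite /F; apply: trigger_derive.
  by rewrite addr0 /GRing.scale /= mulr1 mulrCA mulVf// mulr1.
rewrite /Rintegral (@continuous_FTC2 _ _ F).
- rewrite /F /= -mulrBr.
  have -> : n%:~R * pi + p = (n%:~R * - pi + p) + n%:~R * (2 * pi) by lra.
  have per x : sin (x + n%:~R * (2 * pi)) = sin x :> R.
    rewrite -[x + _](subrK (pi / 2)) sinDpihalf -[in RHS](subrK (pi / 2) x) sinDpihalf.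
    by rewrite addrAC cos_2intpi.
  by rewrite per subrr mulr0.
- by rewrite gtrN// pi_gt0.
- exact: continuous_subspaceT.
- have cF : continuous F.
    move=> t; apply: differentiable_continuous; apply/derivable1_diffP.
    exact: ex_derive.
  split; first by move=> t _; exact: ex_derive.
    by apply: cvg_at_right_filter; exact: cF.
  by apply: cvg_at_left_filter; exact: cF.
- by move=> t _; rewrite derive1E; exact: derive_val.
Qed.

Lemma circle_integral_dist (f g : R -> R) (eps : R) : continuous f -> continuous g ->
  (forall t, `|f t - g t| <= eps) ->
  `|\int[mu]_(t in `[- pi, pi[) f t - \int[mu]_(t in `[- pi, pi[) g t| <=
  2 * pi * eps.
Proof.
move=> cf cg fg; have If := continuous_circle_integrable cf.
have Ig := continuous_circle_integrable cg.
have cfg : continuous (fun t => f t - g t).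
  by move=> t; apply: cvgB; [exact: cf|exact: cg].
have mI : measurable (`[- pi, pi[ : set R) by exact: measurable_itv.
rewrite -RintegralB// (le_trans (le_normr_Rintegral _ _))//.
  exact: continuous_circle_integrable.
rewrite -circle_integral_cst; apply: le_Rintegral => //.
- apply: continuous_circle_integrable => t; apply: cvg_norm; exact: cfg.
- by apply: continuous_circle_integrable => t; exact: cvg_cst.
Qed.

End CircleIntegral.

(** * Trigonometric polynomials on the torus *)

Section TrigPoly.
Variables (R : realType) (T : finType).
Local Notation mu := (@lebesgue_measure R).
Implicit Types (th : T -> R) (chi : T -> int) (P : seq (R * (T -> int))).

Definition phase chi th : R := \sum_(v : T) (chi v)%:~R * th v.

Definition set_angle th (v : T) (t : R) : T -> R :=
  fun w => if w == v then t else th w.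

Definition trig_eval P th : R := \sum_(p <- P) p.1 * cos (phase p.2 th).

Lemma phase0 th : phase 0 th = 0.
Proof. by rewrite /phase big1// => v _; rewrite mul0r. Qed.

Lemma phaseB chi chi' th : phase (chi - chi') th = phase chi th - phase chi' th.
Proof.
rewrite /phase -sumrB; apply: eq_bigr => v _.
by rewrite -mulrBl -rmorphB.
Qed.

Lemma phase_mulz chi (k : int) th : phase (chi *~ k) th = k%:~R * phase chi th.
Proof.
rewrite /phase mulr_sumr; apply: eq_bigr => v _.
have natE n : (chi *+ n) v = chi v *+ n.
  by elim: n => [|n IH] //; rewrite !mulrS -IH.
have -> : (chi *~ k) v = chi v *~ k.
  case: k => n; first by rewrite -!pmulrn natE.
  by rewrite NegzE !mulrNz -!pmulrn -[LHS]/(- ((chi *+ n.+1) v)) natE.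
by rewrite mulrzz rmorphM /=; lra.
Qed.

Lemma phase_dirac x th : phase (dirac_int x) th = th x.
Proof.
rewrite /phase (bigD1 x)//= big1 ?addr0; first by rewrite /dirac_int eqxx mul1r.
by move=> v /negbTE vx; rewrite /dirac_int vx mul0r.
Qed.

Lemma phase_dipole p th : phase (dipole p) th = th p.1 - th p.2.
Proof. by rewrite /dipole phaseB !phase_dirac. Qed.

Lemma phase_set_angle chi th v t :
  phase chi (set_angle th v t) = (chi v)%:~R * t + phase chi (set_angle th v 0).
Proof.
rewrite /phase (bigD1 v)//= [in RHS](bigD1 v)//= /set_angle eqxx mulr0 add0r.
by congr (_ + _); apply: eq_bigr => w /negbTE ->.
Qed.

Lemma phase_set_angle0 chi th v t : chi v = 0 ->
  phase chi (set_angle th v t) = phase chi th.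
Proof.
move=> c0; apply: eq_bigr => w _; rewrite /set_angle.
by case: eqVneq => [->|//]; rewrite c0 !mul0r.
Qed.

Lemma trig_eval_continuous P th v :
  continuous (fun t => trig_eval P (set_angle th v t)).
Proof.
elim: P => [|p P IH] t.
  rewrite (_ : (fun _ => _) = fun=> 0); first exact: cvg_cst.
  by apply/funext => u; rewrite /trig_eval big_nil.
rewrite (_ : (fun _ => _) = fun u =>
    p.1 * cos ((p.2 v)%:~R * u + phase p.2 (set_angle th v 0)) +
    trig_eval P (set_angle th v u)); last first.
  by apply/funext => u; rewrite /trig_eval big_cons phase_set_angle.
apply: cvgD; last exact: IH.
apply: cvgM; first exact: cvg_cst.
apply: (@continuous_comp _ _ _ (fun t : R => (p.2 v)%:~R * t + _)); last first.
  exact: continuous_cos.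
by apply: cvgD; [apply: cvgM => //; exact: cvg_cst|exact: cvg_cst].
Qed.

Lemma trig_eval_integral P th v :
  \int[mu]_(t in `[- pi, pi[) trig_eval P (set_angle th v t) =
  2 * pi * trig_eval [seq p <- P | p.2 v == 0] th.
Proof.
elim: P => [|p P IH].
  under eq_Rintegral do rewrite /trig_eval big_nil.
  by rewrite circle_integral_cst /trig_eval big_nil.
have cp Q := continuous_circle_integrable (@trig_eval_continuous Q th v).
have e t : trig_eval (p :: P) (set_angle th v t) =
  trig_eval [:: p] (set_angle th v t) + trig_eval P (set_angle th v t).
  by rewrite /trig_eval big_cons big_seq1.
under eq_Rintegral do rewrite e.
rewrite RintegralD; [|exact: measurable_itv|exact: cp|exact: cp].
rewrite IH.
have -> : \int[mu]_(t in `[- pi, pi[) trig_eval [:: p] (set_angle th v t) =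
    2 * pi * (if p.2 v == 0 then p.1 * cos (phase p.2 th) else 0).
  under eq_Rintegral do rewrite /trig_eval big_seq1 phase_set_angle.
  rewrite RintegralZl//; last first.
    apply: continuous_circle_integrable => t.
    apply: (@continuous_comp _ _ _ (fun t : R => (p.2 v)%:~R * t + _)); last first.
      exact: continuous_cos.
    by apply: cvgD; [apply: cvgM => //; exact: cvg_cst|exact: cvg_cst].
  rewrite circle_integral_cos; case: eqVneq => [pv|_]; last by rewrite !mulr0.
  by rewrite phase_set_angle0//; lra.
rewrite -mulrDr /=; case: ifP => _; rewrite /trig_eval ?big_cons//.
by rewrite add0r.
Qed.

Lemma angle_integral_trig s P th : angle_integral s (trig_eval P) th =
  (2 * pi) ^+ size s * trig_eval [seq p <- P | all (fun v => p.2 v == 0) s] th.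
Proof.
elim: s th => [|v s IH] th /=; first by rewrite expr0 mul1r filter_predT.
under eq_Rintegral do rewrite IH.
rewrite RintegralZl//; last first.
  apply: continuous_circle_integrable; exact: trig_eval_continuous.
rewrite trig_eval_integral mulrA -exprSr -filter_predI.
by congr (_ * trig_eval _ _); apply: eq_filter => p /=.
Qed.

(** Uniform approximability implies continuity in each angle and is inherited by the inner
    integrals, as iterated integration requires. *)
Definition trig_approx (f : (T -> R) -> R) :=
  forall eps : R, 0 < eps -> exists P, forall th, `|f th - trig_eval P th| <= eps.

Lemma trig_approx_continuous f th v : trig_approx f ->
  continuous (fun t => f (set_angle th v t)).
Proof.
move=> tf t; apply/cvgrPdist_le => e e0.
have e3 : 0 < e / 3 by rewrite divr_gt0.
have [P hP] := tf _ e3.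
have /cvgrPdist_le/(_ _ e3) := @trig_eval_continuous P th v t.
apply: filterS => u h.
have h1 := hP (set_angle th v t); have h2 := hP (set_angle th v u).
move: h h1 h2; set a := trig_eval _ _; set b := trig_eval _ _.
set c := f _; set d := f _; rewrite !ler_norml => /andP[? ?] /andP[? ?] /andP[? ?].
by apply/andP; split; lra.
Qed.

(** The two claims go together: comparing outer integrals needs the inner ones to be continuous,
    which follows from their approximability. *)
Lemma angle_integral_approx s f : trig_approx f ->
  trig_approx (angle_integral s f) /\
  forall P (eps : R), (forall th, `|f th - trig_eval P th| <= eps) ->
  forall th, `|angle_integral s f th - angle_integral s (trig_eval P) th| <=
    (2 * pi) ^+ size s * eps.
Proof.
move=> tf.
have pos n : 0 < (2 * pi) ^+ n :> R by rewrite exprn_gt0// mulr_gt0 ?pi_gt0.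
elim: s => [|v s [IHa IHb]] /=.
  by split=> // P eps h th; rewrite expr0 mul1r.
have dist P (eps : R) : (forall th, `|f th - trig_eval P th| <= eps) ->
    forall th, `|angle_integral (v :: s) f th -
                 angle_integral (v :: s) (trig_eval P) th| <=
    (2 * pi) ^+ (size s).+1 * eps.
  move=> h th; rewrite exprS -mulrA.
  apply: circle_integral_dist.
  - exact: trig_approx_continuous.
  - rewrite (_ : (fun _ => _) = fun t => (2 * pi) ^+ size s *
        trig_eval [seq p <- P | all (fun v => p.2 v == 0) s] (set_angle th v t)).
      2: by apply/funext => t; rewrite -angle_integral_trig.
    move=> t; apply: cvgM; first exact: cvg_cst.
    exact: trig_eval_continuous.
  - by move=> t; exact: IHb.
split=> // eps eps0.
have [P hP] := tf (eps / (2 * pi) ^+ (size s).+1) (divr_gt0 eps0 (pos _)).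
pose Q := [seq ((2 * pi) ^+ (size s).+1 * p.1, p.2) |
  p <- [seq p <- P | all (fun v => p.2 v == 0) (v :: s)]].
exists Q => th; have -> : trig_eval Q th = angle_integral (v :: s) (trig_eval P) th.
  rewrite angle_integral_trig /trig_eval big_map mulr_sumr.
  by apply: eq_bigr => p _; rewrite mulrA.
by have := dist _ _ hP th; rewrite mulrC divfK// lt0r_neq0.
Qed.

Lemma angle_integral_enum f P eps th : trig_approx f ->
  (forall th, `|f th - trig_eval P th| <= eps) ->
  `|angle_integral (enum T) f th -
    (2 * pi) ^+ #|T| * \sum_(p <- P | p.2 == 0) p.1| <= (2 * pi) ^+ #|T| * eps.
Proof.
move=> tf h; have [_ /(_ P eps h th)] := angle_integral_approx (enum T) tf.
rewrite -cardE angle_integral_trig -cardE.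
suff -> : trig_eval [seq p <- P | all (fun v => p.2 v == 0) (enum T)] th =
  \sum_(p <- P | p.2 == 0) p.1 by [].
rewrite /trig_eval big_filter; apply: eq_big => p.
  apply/allP/eqP => [h0|-> //]; apply/funext => v; apply/eqP/h0.
  by rewrite mem_enum.
move/allP => h0; have -> : p.2 = 0.
  by apply/funext => v; apply/eqP/h0; rewrite mem_enum.
by rewrite phase0 cos0 mulr1.
Qed.

End TrigPoly.

(** * Villain integrals as sums over currents *)

Section VillainCurrents.
Variables (R : realType) (T : finType) (beta : R).
Hypothesis beta_gt0 : 0 < beta.
Implicit Types (th : T -> R) (chi : T -> int) (E : seq (T * T)).

(* Chosen so that [gauss (2 * dual_temp) n = exp (- n ^ 2 / (2 beta))]. *)
Definition dual_temp : R := (4 * beta)^-1.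
Local Notation a := dual_temp.
Local Notation F := (fourier_box beta).

Lemma dual_temp_gt0 : 0 < a.
Proof. by rewrite invr_gt0 mulr_gt0. Qed.

Lemma dual_tempE : (2 * beta)^-1 = 2 * a.
Proof. by rewrite /a !invfM; lra. Qed.

(** [c] is the mean of [f] over the torus, read off from a list in which frequencies may repeat. *)
Definition trig_mean (f : (T -> R) -> R) (c : R) := exists2 P,
  forall th, f th = trig_eval P th & \sum_(p <- P | p.2 == 0) p.1 = c.

Lemma trig_mean_sum (B : seq int) (w : int -> R) (f : int -> (T -> R) -> R)
    (c : int -> R) : (forall k, trig_mean (f k) (c k)) ->
  trig_mean (fun th => \sum_(k <- B) w k * f k th) (\sum_(k <- B) w k * c k).
Proof.
move=> fc; elim: B => [|k B [P hP cP]].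
  exists [::]; last by rewrite !big_nil.
  by move=> th; rewrite /trig_eval !big_nil.
have [Q hQ cQ] := fc k; exists ([seq (w k * p.1, p.2) | p <- Q] ++ P).
  move=> th; rewrite big_cons hP hQ /trig_eval big_cat big_map mulr_sumr.
  by congr (_ + _); apply: eq_bigr => p _; rewrite mulrA.
by rewrite big_cat big_map big_cons -cP -cQ mulr_sumr.
Qed.

(** The weights are even, so the sine products cancel and each product of cosines becomes a single
    cosine. *)
Lemma cos_fourier_box M x y : cos x * F M y =
  \sum_(k <- box M) gauss (2 * a) k * cos (x - k%:~R * y).
Proof.
rewrite /F dual_tempE.
have odd0 : \sum_(k <- box M) gauss (2 * a) k * sin (k%:~R * y) = 0.
  apply/eqP; rewrite -[_ == 0](mulrn_eq0 _ 2) mulr2n.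
  rewrite -{1}big_boxN -big_split big1// => k _ /=.
  by rewrite gaussN rmorphN mulNr sinN mulrN addNr.
transitivity (\sum_(k <- box M) (gauss (2 * a) k * cos (k%:~R * y) * cos x +
    gauss (2 * a) k * sin (k%:~R * y) * sin x)).
  by rewrite big_split /= -!mulr_suml odd0 mul0r addr0 mulrC.
by apply: eq_bigr => k _; rewrite cosB; lra.
Qed.

(** Each edge factor shifts the frequency by a multiple of its dipole, exactly as in the recursion
    of [flow_sum]; frequency zero remains when the divergence is [chi]. *)
Lemma trig_mean_prod M E chi : trig_mean
  (fun th => cos (phase chi th) * \prod_(p <- E) F M (th p.1 - th p.2))
  (cur_box a M (map (@dipole T) E) chi).
Proof.
elim: E chi => [|e E IH] chi.
  exists [:: (1, chi)].
    by move=> th; rewrite big_nil mulr1 /trig_eval big_seq1 mul1r.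
  by rewrite big_cons big_nil /cur_box /=; case: ifP; rewrite ?addr0.
have := trig_mean_sum (box M) (gauss (2 * a)) (fun k => IH (chi - dipole e *~ k)).
move=> [P hP cP]; exists P => [th|]; last by rewrite cP.
rewrite -hP big_cons mulrA -phase_dipole cos_fourier_box mulr_suml.
by apply: eq_bigr => k _; rewrite (phaseB chi) phase_mulz mulrA.
Qed.

Definition edge_list (e : rel T) : seq (T * T) :=
  [seq p <- index_enum _ | e p.1 p.2 && (enum_rank p.1 < enum_rank p.2)%N].

Lemma villain_densityE (e : rel T) th : villain_density e beta th =
  \prod_(p <- edge_list e) villain_weight beta (th p.1 - th p.2).
Proof. by rewrite /villain_density big_filter. Qed.

Let ratio : R := expR (- (2 * beta)^-1).
Let ratio01 : 0 <= ratio < 1.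
Proof. by apply: geom_ratio; rewrite invr_gt0 mulr_gt0. Qed.
Let K : R := 2 / (1 - ratio).
Let K0 : 0 <= K.
Proof. by case/andP: ratio01 => _ ?; rewrite divr_ge0// subr_ge0 ltW. Qed.

Let F_bound M t : `|F M t| <= 1 + K.
Proof.
have := @box_tail_le R 1 ratio (fun k => gauss (2 * beta)^-1 k * cos (k%:~R * t)) 0 M.
rewrite big_seq1 gauss0 mul1r mul0r cos0 -/(F M t) => tail.
have h : `|F M t - 1| <= K.
  apply: le_trans (tail ler01 ratio01 _ (leq0n _)) _; last first.
    by rewrite expr0 !mulr1.
  move=> k _; rewrite normrM ger0_norm ?gauss_ge0// mul1r -[leRHS]mulr1.
  apply: ler_pM; rewrite ?gauss_ge0 ?cos_max//.
  by apply: gauss_le_geom; rewrite invr_gt0 mulr_gt0.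
rewrite -[F M t](subrK 1) (le_trans (ler_normD _ _))// normr1 addrC lerD2l.
exact: h.
Qed.

Let G t : R := limn (F ^~ t).

Let G_bound t : `|G t| <= 1 + K.
Proof.
have := @fourier_box_cvg R beta beta_gt0 t => /cvg_norm cv.
by apply: (cvgr_to_le cv); near=> M; exact: F_bound.
Unshelve. all: by end_near. Qed.

Let prod_dist M E th : `|\prod_(p <- E) G (th p.1 - th p.2) -
    \prod_(p <- E) F M (th p.1 - th p.2)| <=
  (size E)%:R * (1 + K) ^+ size E * (K * ratio ^+ M).
Proof.
have d0 : 0 <= K * ratio ^+ M by rewrite mulr_ge0// exprn_ge0//; case/andP: ratio01.
have K1 : 1 <= 1 + K by rewrite lerDl.
have K1' : 0 <= 1 + K by rewrite (le_trans ler01).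
have dist t : `|G t - F M t| <= K * ratio ^+ M.
  by have := fourier_box_uniform beta_gt0 t M; rewrite mulr1 -/ratio /K -mulrAC.
elim: E => [|p E IH]; first by rewrite !big_nil subrr normr0 mul0r mul0r.
rewrite !big_cons; set g := G _; set f := F M _.
set PG := \prod_(_ <- _) _ in IH *; set PF := \prod_(_ <- _) _ in IH *.
have PF_bound : `|PF| <= (1 + K) ^+ size E.
  rewrite /PF normr_prod; elim: (E) => [|q E' IH']; first by rewrite big_nil expr0.
  by rewrite big_cons /= exprS ler_pM// prodr_ge0.
have -> : g * PG - f * PF = g * (PG - PF) + (g - f) * PF by lra.
apply: le_trans (ler_normD _ _) _; rewrite !normrM /= -natr1.
have h1 : `|g| * `|PG - PF| <=
    (1 + K) * ((size E)%:R * (1 + K) ^+ size E * (K * ratio ^+ M)).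
  by apply: ler_pM => //; exact: G_bound.
have h2 : `|g - f| * `|PF| <= K * ratio ^+ M * (1 + K) ^+ size E.
  by apply: ler_pM => //; exact: dist.
have h3 : K * ratio ^+ M * (1 + K) ^+ size E <=
    (1 + K) * (K * ratio ^+ M * (1 + K) ^+ size E).
  by rewrite ler_peMl// mulr_ge0// exprn_ge0.
rewrite exprS; move: h1 h2 h3; set u := (1 + K) ^+ size E; set w := K * _; lra.
Qed.

(** What matters is that [c] is the same for all [chi]: it cancels in the correlations. *)
Lemma villain_integral (e : rel T) : exists2 c : R, 0 < c & forall chi th,
  angle_integral (enum T) (fun th => cos (phase chi th) * villain_density e beta th)
    th = c * cur a (map (@dipole T) (edge_list e)) chi.
Proof.
have [c c0 hc] := villain_weight_fourier beta_gt0.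
set E := edge_list e; set D := map _ E.
have p2 : 0 < (2 * pi) ^+ #|T| :> R by rewrite exprn_gt0// mulr_gt0 ?pi_gt0.
exists ((2 * pi) ^+ #|T| * c ^+ size E) => [|chi th].
  by rewrite mulr_gt0// exprn_gt0.
set f := fun th => _.
have fE th' : f th' = c ^+ size E * (cos (phase chi th') *
     \prod_(p <- E) G (th' p.1 - th' p.2)).
  rewrite /f villain_densityE -/E mulrCA; congr (_ * _).
  rewrite (eq_bigr _ (fun p _ => hc _)) big_split /=; congr (_ * _).
  by rewrite big_const_seq count_predT -Monoid.iteropE.
pose del M : R := c ^+ size E * ((size E)%:R * (1 + K) ^+ size E * (K * ratio ^+ M)).
have approx M : exists2 P, forall th', `|f th' - trig_eval P th'| <= del M &
    \sum_(p <- P | p.2 == 0) p.1 = c ^+ size E * cur_box a M D chi.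
  have [P hP cP] := trig_mean_prod M E chi.
  exists [seq (c ^+ size E * p.1, p.2) | p <- P]; last first.
    by rewrite big_map -mulr_sumr cP.
  move=> th'; rewrite fE.
  have -> : trig_eval [seq (c ^+ size E * p.1, p.2) | p <- P] th' =
      c ^+ size E * trig_eval P th'.
    by rewrite /trig_eval big_map mulr_sumr; apply: eq_bigr => p _; rewrite mulrA.
  rewrite -hP -!mulrBr !normrM ger0_norm ?exprn_ge0 ?(ltW c0)//.
  rewrite ler_wpM2l ?exprn_ge0 ?(ltW c0)//.
  by apply: le_trans (prod_dist M E th'); rewrite ler_piMl ?cos_max.
have del0 : del M @[M --> \oo] --> 0.
  rewrite /del -[X in _ --> X](mulr0 (c ^+ size E)); apply: cvgM; first exact: cvg_cst.
  rewrite -[X in _ --> X](mulr0 ((size E)%:R * (1 + K) ^+ size E)).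
  apply: cvgM; first exact: cvg_cst.
  rewrite -[X in _ --> X](mulr0 K); apply: cvgM; first exact: cvg_cst.
  by case/andP: ratio01 => r0 r1; apply: cvg_expr; rewrite ger0_norm.
have tf : trig_approx f.
  move=> eps eps0; move/cvgrPdist_le : del0 => /(_ _ eps0)[M _ /(_ M (leqnn M))].
  rewrite /= sub0r normrN => dM; have [P hP _] := approx M; exists P => th'.
  exact: le_trans (hP th') (le_trans (ler_norm _) dM).
set I := angle_integral _ _ _; set n := (2 * pi) ^+ #|T| in p2 *.
have lim1 : n * (c ^+ size E * cur_box a M D chi) @[M --> \oo] --> I.
  apply/cvgrPdist_le => e' e'0.
  have lim0 : n * del M @[M --> \oo] --> 0.
    by rewrite -[X in _ --> X](mulr0 n); apply: cvgM => //; exact: cvg_cst.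
  move/cvgrPdist_le : lim0 => /(_ _ e'0); apply: filterS => M.
  rewrite sub0r normrN => dM; have [P hP cP] := approx M.
  have := angle_integral_enum th tf hP; rewrite cP => /le_trans; apply.
  exact: le_trans (ler_norm _) dM.
apply: (@cvg_unique _ (@Rhausdorff R) _ _ _ _ lim1).
rewrite -mulrA; apply: cvgM; first exact: cvg_cst.
by apply: cvgM; [exact: cvg_cst|exact/cur_box_cvg/dual_temp_gt0].
Qed.

Lemma villain_corr_finE (e : rel T) x y : villain_corr_fin e beta x y =
  corr a (map (@dipole T) (edge_list e)) (dirac_int x - dirac_int y).
Proof.
have [c c0 hc] := villain_integral e.
have c1 : c != 0 by rewrite lt0r_neq0.
rewrite /villain_corr_fin /villain_expectation.
have -> : (fun th => cos (th x - th y) * villain_density e beta th) =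
  (fun th => cos (phase (dirac_int x - dirac_int y) th) * villain_density e beta th).
  by apply/funext => th; rewrite phaseB !phase_dirac.
have -> : angle_integral (enum T) (villain_density e beta) (fun=> 0) =
    c * cur a (map (@dipole T) (edge_list e)) 0.
  rewrite -(hc 0 (fun=> 0)); suff e1 : villain_density e beta =
    (fun th => cos (phase 0 th) * villain_density e beta th) by rewrite [in LHS]e1.
  by apply/funext => th; rewrite phase0 cos0 mul1r.
by rewrite hc /corr -mulf_div divff// mul1r.
Qed.
End VillainCurrents.
(** * Infinite volume *)

Section EdgeLists.
Variables (R : realType) (V : choiceType) (a : R).
Hypothesis a_gt0 : 0 < a.
Implicit Types (E : seq (V * V)) (g : V -> int).

Local Notation D := (map (@dipole V)).

Definition flip (p : V * V) := (p.2, p.1).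

(** Each unordered edge occurs at most once, in one orientation. A loop equals its own flip, so the
    second condition excludes loops too. *)
Definition simple_edges E := uniq E /\ forall p, p \in E -> flip p \notin E.

Definition sub_edges E E' := forall p, p \in E -> (p \in E') || (flip p \in E').

Let cur_box_mid M E p E' g :
  cur_box a M (D (E ++ p :: E')) g = cur_box a M (D (p :: E ++ E')) g.
Proof. by rewrite /cur_box !(map_cat, map_cons); exact: flow_sum_mid. Qed.

Let cur_box_flip M p E g :
  cur_box a M (D (flip p :: E)) g = cur_box a M (D (p :: E)) g.
Proof.
case: p => u v; rewrite /cur_box !map_cons /flip (dipoleN u v).
by apply: flow_sum_flip => k; exact: gaussN.
Qed.

(** Each edge of [E] is brought to the front of [E'], reversed if necessary; as [E] is simple, its
    other edges are still found in the rest of [E']. *)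
Let cur_box_extend E E' : simple_edges E -> sub_edges E E' ->
  exists E'', forall M g, cur_box a M (D E') g = cur_box a M (D (E ++ E'')) g.
Proof.
elim: E E' => [|p E IH] E' [uE aE] subE; first by exists E'.
have pE : p \in p :: E := mem_head _ _.
move: uE => /= /andP[pNE uE].
have [E1 [E2 E'E]] : exists E1 E2, forall M g,
    cur_box a M (D E') g = cur_box a M (D (p :: E1 ++ E2)) g /\
    (forall q, q \in E' -> [|| q == p, q == flip p, q \in E1 | q \in E2]).
  have [pE'|fpE'] := orP (subE _ pE).
    case/splitPr: pE' => E1 E2; exists E1, E2 => M g.
    split; first exact: cur_box_mid.
    by move=> q; rewrite mem_cat in_cons => /or3P[]->; rewrite ?orbT.
  case/splitPr: fpE' => E1 E2; exists E1, E2 => M g.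
  split; first by rewrite cur_box_mid cur_box_flip.
  by move=> q; rewrite mem_cat in_cons => /or3P[]->; rewrite ?orbT.
have [|q qE|E'' hE''] := IH (E1 ++ E2).
- split=> // q qE; have := aE q; rewrite !in_cons qE orbT => /(_ isT).
  by rewrite negb_or => /andP[].
- have := subE q; rewrite in_cons qE orbT => /(_ isT).
  have qp : q != p by apply: contraNneq pNE => <-.
  have qfp : q != flip p.
    apply/eqP => qfp; have := aE p pE; rewrite in_cons negb_or -qfp qE.
    by rewrite andbF.
  have fqp : flip q != p.
    by apply: contraNneq qfp => <-; case: (q).
  have fqfp : flip q != flip p.
    by apply: contraNneq qp; rewrite /flip; case: (q) (p) => [u v] [u' v'] [-> ->].
  have mem r : r != p -> r != flip p -> r \in E' -> r \in E1 ++ E2.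
    move=> rp rfp rE'; have [_ /(_ r rE')] := E'E 0%N 0.
    by rewrite (negbTE rp) (negbTE rfp) mem_cat.
  by move=> /orP[/mem->|/mem->]; rewrite ?orbT.
exists E'' => M g; have [-> _] := E'E M g.
rewrite /cur_box /=; apply: flow_sum_cons => g'; exact: hE''.
Qed.

Lemma corr_sub_edges E E' g : simple_edges E -> sub_edges E E' ->
  corr a (D E) g <= corr a (D E') g.
Proof.
move=> sE sub; have [E'' hE''] := cur_box_extend sE sub.
have curE g' : cur a (D E') g' = cur a (D (E'' ++ E)) g'.
  have permE M : cur_box a M (D (E ++ E'')) g' = cur_box a M (D (E'' ++ E)) g'.
    elim: (E'') (E) g' => [|p F IH] F' g'; first by rewrite cats0.
    rewrite cur_box_mid /cur_box /=; apply: flow_sum_cons => g''.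
    exact: IH.
  rewrite /cur; suff -> : (fun M => cur_box a M (D E') g') =
    (fun M => cur_box a M (D (E'' ++ E)) g') by [].
  by apply/funext => M; rewrite hE'' permE.
rewrite /corr !curE -/(corr a (D (E'' ++ E)) g) map_cat.
by apply: corr_cat => //; exact: fun_int_double_inj.
Qed.

End EdgeLists.

Section EdgeImages.
Variables (R : realType) (a : R) (U V : choiceType) (f : U -> V).
Hypothesis f_inj : injective f.

Let fp (p : U * U) := (f p.1, f p.2).

Lemma dirac_int_image u u' : dirac_int (f u) (f u') = dirac_int u u'.
Proof. by rewrite /dirac_int (inj_eq f_inj). Qed.

Lemma cur_image (E : seq (U * U)) (g : V -> int) :
  (forall v, (forall u, f u <> v) -> g v = 0) ->
  cur a (map (@dipole V) (map fp E)) g = cur a (map (@dipole U) E) (g \o f).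
Proof.
move=> g0; rewrite /cur; suff -> : (fun M => cur_box a M (map (@dipole V) (map fp E)) g)
   = (fun M => cur_box a M (map (@dipole U) E) (g \o f)) by [].
apply/funext => M; rewrite /cur_box -!map_comp.
pose P (h : V -> int) := forall v, (forall u, f u <> v) -> h v = 0.
have mulzE (W : choiceType) (h : W -> int) k v : (h *~ k) v = h v * k.
  have natE n : (h *+ n) v = h v * n%:Z.
    elim: n => [|n IH]; first by rewrite mulr0.
    by rewrite mulrS -[LHS]/(h v + (h *+ n) v) IH; lia.
  case: k => n; first by rewrite -pmulrn natE.
  by rewrite NegzE mulrNz -pmulrn -[LHS]/(- ((h *+ n.+1) v)) natE; lia.
apply: (@eq_flow_sum_hom _ _ _ (fun h : V -> int => h \o f) _ E
   (@dipole V \o fp) (@dipole U) (fun=> gauss (2 * a)) P) => //.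
- move=> h Ph; apply/eqP/eqP => [hf|->//]; apply/funext => v.
  have [[u <-]|nv] := pselect (exists u, f u = v); first exact: (congr1 (@^~ u) hf).
  by apply: Ph => u fu; apply: nv; exists u.
- move=> h d k Ph v nv; rewrite -[LHS]/(h v - ((dipole (fp d)) *~ k) v) Ph// mulzE.
  rewrite dipole_at /=; case: eqP => [e|_]; first by case: (nv d.1).
  by case: eqP => [e|_]; [case: (nv d.2)|lia].
- move=> h d k Ph; apply/funext => u.
  rewrite -[LHS]/(h (f u) - ((dipole (fp d)) *~ k) (f u)).
  rewrite -[RHS]/(h (f u) - (dipole d *~ k) u) !mulzE !dipole_at /=.
  by rewrite !(inj_eq f_inj).
Qed.

Lemma corr_image (E : seq (U * U)) x y :
  corr a (map (@dipole V) (map fp E)) (dirac_int (f x) - dirac_int (f y)) =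
  corr a (map (@dipole U) E) (dirac_int x - dirac_int y).
Proof.
rewrite /corr cur_image; last first.
  move=> v nv; rewrite -[LHS]/((v == f x)%:Z - (v == f y)%:Z).
  by case: eqP (nv x) => [->//|_ _]; case: eqP (nv y) => [->//|_ _].
rewrite cur_image//; congr (cur a _ _ / _).
apply/funext => u.
by rewrite -[LHS]/(dirac_int (f x) (f u) - dirac_int (f y) (f u)) !dirac_int_image.
Qed.

End EdgeImages.

(** * Correlations in finite subgraphs and their limit *)

Section Subgraphs.
Variables (R : realType) (V : choiceType) (e : rel V) (beta : R).
Hypotheses (e_irr : irreflexive e) (beta_gt0 : 0 < beta).
Implicit Types (H K : fin_subgraph e) (x y z : V).

Local Notation a := (dual_temp beta).

Definition sg_edges H : seq (V * V) :=
  [seq (val p.1, val p.2) |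
    p <- edge_list (fun u v : sg_vertices H => sg_adj H (val u) (val v))].

Lemma sg_edges_adj H p : p \in sg_edges H -> sg_adj H p.1 p.2.
Proof. by move=> /mapP[q]; rewrite mem_filter => /andP[/andP[+ _] _] ->. Qed.

Lemma adj_sg_edges H u v : sg_adj H u v ->
  ((u, v) \in sg_edges H) || ((v, u) \in sg_edges H).
Proof.
move=> uv; have /and3P[uH vH euv] := sg_sub uv.
have vu := uv; rewrite (sg_sym H) in vu.
case: (ltngtP (enum_rank (FSetSub uH)) (enum_rank (FSetSub vH))) => [lt|lt|eq].
- apply/orP; left; apply/mapP; exists ((FSetSub uH), (FSetSub vH)) => //.
  by rewrite mem_filter /= uv lt mem_index_enum.
- apply/orP; right; apply/mapP; exists ((FSetSub vH), (FSetSub uH)) => //.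
  by rewrite mem_filter /= vu lt mem_index_enum.
- have /(congr1 val) /= uv' := enum_rank_inj (val_inj eq).
  by move: euv; rewrite uv' e_irr.
Qed.

Lemma simple_sg_edges H : simple_edges (sg_edges H).
Proof.
split.
  rewrite map_inj_uniq ?filter_uniq ?index_enum_uniq//.
  by move=> [u v] [u' v'] [/val_inj -> /val_inj ->].
move=> _ /mapP[[u v] + ->]; rewrite mem_filter /= => /andP[/andP[_ uv] _].
apply/mapP => -[[v' u']]; rewrite mem_filter /= => /andP[/andP[_ vu] _].
by case=> /val_inj vv /val_inj uu; move: uv vu; rewrite -vv -uu; lia.
Qed.

Lemma villain_corr_subE H x y : x \in sg_vertices H -> y \in sg_vertices H ->
  villain_corr_sub beta x y H =
  corr a (map (@dipole V) (sg_edges H)) (dirac_int x - dirac_int y).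
Proof.
move=> xH yH; rewrite /villain_corr_sub !insubT villain_corr_finE//.
by rewrite -(corr_image a val_inj).
Qed.

Lemma villain_corr_sub_out H x y :
  ~~ ((x \in sg_vertices H) && (y \in sg_vertices H)) ->
  villain_corr_sub beta x y H = 0.
Proof.
rewrite negb_and /villain_corr_sub => /orP[] h; first by rewrite insubN.
by case: insubP => // u _ _; rewrite insubN.
Qed.

Lemma villain_corr_sub_ge0 x y H : 0 <= villain_corr_sub beta x y H.
Proof.
have [/andP[xH yH]|out] := boolP ((x \in sg_vertices H) && (y \in sg_vertices H)).
  by rewrite villain_corr_subE// corr_ge0// dual_temp_gt0.
by rewrite villain_corr_sub_out.
Qed.

Lemma villain_corr_sub_le1 x y H : villain_corr_sub beta x y H <= 1.
Proof.
have [/andP[xH yH]|out] := boolP ((x \in sg_vertices H) && (y \in sg_vertices H)).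
  rewrite villain_corr_subE//; apply: corr_le1; first exact: dual_temp_gt0.
  exact: fun_int_double_inj.
by rewrite villain_corr_sub_out.
Qed.

(** The identity gives monotonicity in the volume, an automorphism gives the invariance of the
    limit. When [x] or [y] is outside [H] the left side is the default 0, and correlations are
    nonnegative. *)
Lemma villain_corr_sub_mono (f : V -> V) H K x y : injective f ->
  (forall u, u \in sg_vertices H -> f u \in sg_vertices K) ->
  (forall u v, sg_adj H u v -> sg_adj K (f u) (f v)) ->
  villain_corr_sub beta x y H <= villain_corr_sub beta (f x) (f y) K.
Proof.
move=> f_inj vHK eHK.
have [/andP[xH yH]|out] := boolP ((x \in sg_vertices H) && (y \in sg_vertices H));
  last by rewrite villain_corr_sub_out// villain_corr_sub_ge0.
rewrite !villain_corr_subE ?vHK// -(corr_image a f_inj).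
have [uH aH] := simple_sg_edges H.
apply: corr_sub_edges.
- exact: dual_temp_gt0.
- split.
    by rewrite map_inj_uniq// => -[u v] [u' v'] [/f_inj -> /f_inj ->].
  move=> _ /mapP[p pH ->]; apply/mapP => -[q qH] [/f_inj p2 /f_inj p1].
  by have := aH p pH; rewrite /flip p1 p2 -surjective_pairing qH.
- move=> _ /mapP[p pH ->]; apply: adj_sg_edges; apply: eHK.
  exact: sg_edges_adj.
Qed.

Lemma sg_le_corr H K x y : sg_le H K ->
  villain_corr_sub beta x y H <= villain_corr_sub beta x y K.
Proof. by case=> vHK eHK; apply: (@villain_corr_sub_mono id). Qed.

Lemma sg_le_refl H : sg_le H H. Proof. by split. Qed.

Lemma sg_union H K : exists L : fin_subgraph e, sg_le H L /\ sg_le K L.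
Proof.
have s : symmetric (fun u v => sg_adj H u v || sg_adj K u v).
  by move=> u v; rewrite (sg_sym H) (sg_sym K).
have b u v : sg_adj H u v || sg_adj K u v ->
    [&& u \in (sg_vertices H `|` sg_vertices K)%fset,
        v \in (sg_vertices H `|` sg_vertices K)%fset & e u v].
  by rewrite !in_fsetU => /orP[] /sg_sub /and3P[-> -> ->]; rewrite ?orbT.
exists (FinSubgraph s b); split; split=> [u|u v] /=.
- by rewrite in_fsetU => ->.
- by move=> ->.
- by rewrite in_fsetU => ->; rewrite orbT.
- by move=> ->; rewrite orbT.
Qed.

Definition sg_vertex_only (A : {fset V}) : fin_subgraph e :=
  @FinSubgraph V e A (fun _ _ => false) (fun _ _ => erefl)
    (fun u v (h : false) => False_ind _ (notF h)).

#[local] Instance exhaustion_proper : ProperFilter (exhaustion e).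
Proof.
apply: filter_from_proper; last by move=> H _; exists H; exact: sg_le_refl.
apply: filter_from_filter; first by exists (sg_vertex_only fset0).
move=> H K _ _; have [L [HL KL]] := sg_union H K; exists L => // M [vL eL].
case: HL KL => [vHL eHL] [vKL eKL].
by split; [split=> [u /vHL/vL|u v /eHL/eL]|split=> [u /vKL/vL|u v /eKL/eL]].
Qed.

Lemma villain_corrE x y :
  villain_corr e beta x y = sup (range (villain_corr_sub (e := e) beta x y)).
Proof.
set s := sup _; apply: cvg_lim; first exact: Rhausdorff.
have hs : has_sup (range (villain_corr_sub (e := e) beta x y)).
  split; first by eexists; exists (sg_vertex_only fset0).
  by exists 1 => _ [H _ <-]; exact: villain_corr_sub_le1.
apply/cvgrPdist_le => eps eps0.
have [_ [H _ <-] hH] := sup_adherent eps0 hs.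
exists H => // K HK /=; have := sg_le_corr x y HK.
have : villain_corr_sub beta x y K <= s by apply: ub_le_sup; [case: hs|exists K].
by rewrite ler_norml; move: hH; rewrite -/s => ? ? ?; apply/andP; split; lra.
Qed.

Lemma villain_corr_ub x y H : villain_corr_sub beta x y H <= villain_corr e beta x y.
Proof.
rewrite villain_corrE; apply: ub_le_sup; last by exists H.
by exists 1 => _ [K _ <-]; exact: villain_corr_sub_le1.
Qed.

Lemma villain_corr_le x y c : (forall H, villain_corr_sub beta x y H <= c) ->
  villain_corr e beta x y <= c.
Proof.
move=> hc; rewrite villain_corrE; apply: ge_sup.
  by eexists; exists (sg_vertex_only fset0).
by move=> _ [H _ <-].
Qed.

Lemma villain_corr_ge0 x y : 0 <= villain_corr e beta x y.
Proof.
apply: le_trans (villain_corr_ub x y (sg_vertex_only fset0)).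
exact: villain_corr_sub_ge0.
Qed.

Lemma villain_corr_le1 x y : villain_corr e beta x y <= 1.
Proof. by apply: villain_corr_le => H; exact: villain_corr_sub_le1. Qed.

Lemma villain_corrxx x : villain_corr e beta x x = 1.
Proof.
apply/eqP; rewrite eq_le villain_corr_le1 /=.
apply: le_trans (villain_corr_ub x x (sg_vertex_only [fset x]%fset)).
have xx : x \in sg_vertices (sg_vertex_only [fset x]%fset) by rewrite /= in_fset1.
by rewrite villain_corr_subE// subrr corr0// dual_temp_gt0.
Qed.

Lemma villain_corr_aut phi x y : graph_aut e phi ->
  villain_corr e beta (phi x) (phi y) = villain_corr e beta x y.
Proof.
(* The image of a finite subgraph under [psi] competes in the supremum for the image points; the
   reverse inequality applies this to the inverse. *)
have half psi u v : bijective psi -> (forall u v, e (psi u) (psi v) = e u v) ->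
    villain_corr e beta u v <= villain_corr e beta (psi u) (psi v).
  move=> [psi' psiK psi'K] psie; apply: villain_corr_le => H.
  have s : symmetric (fun u v => sg_adj H (psi' u) (psi' v)).
    by move=> w z; rewrite (sg_sym H).
  have b w z : sg_adj H (psi' w) (psi' z) ->
      [&& w \in [fset psi t | t in sg_vertices H]%fset,
      z \in [fset psi t | t in sg_vertices H]%fset & e w z].
    move=> /sg_sub/and3P[wH zH ewz]; apply/and3P; split.
    - by apply/imfsetP; exists (psi' w).
    - by apply/imfsetP; exists (psi' z).
    - by rewrite -(psi'K w) -(psi'K z) psie.
  apply: le_trans (villain_corr_ub _ _ (FinSubgraph s b)).
  apply: villain_corr_sub_mono; first exact: can_inj psiK.
    by move=> w wH /=; apply/imfsetP; exists w.
  by move=> w z /=; rewrite !psiK.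
move=> [bij aut]; apply/eqP; rewrite eq_le half// andbT.
have [phi' phiK phi'K] := bij.
rewrite -{2}(phiK x) -{2}(phiK y); apply: half; first by exists phi.
by move=> u v; rewrite -aut !phi'K.
Qed.

End Subgraphs.
(** * Exponential decay *)

Section Distance.
Variables (V : choiceType) (e : rel V).
Hypothesis e_conn : graph_connected e.
Implicit Types (x y z u v : V).

Lemma graph_dist_walk x y :
  exists p, [/\ path e x p, last x p = y & size p = graph_dist e x y].
Proof.
rewrite /graph_dist; case: pselect => [w|nw].
  by case: ex_minnP => n /asboolP.
have [p [ep lp]] := e_conn x y; case: nw; exists (size p).
by apply/asboolP; exists p.
Qed.

Lemma graph_dist_le x p : path e x p -> (graph_dist e x (last x p) <= size p)%N.
Proof.
move=> ep; have w : walk_of_length e x (last x p) (size p).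
  by apply/asboolP; exists p.
rewrite /graph_dist; case: pselect => [ex|nw]; last by case: nw; exists (size p).
by case: ex_minnP => n _; apply.
Qed.

Lemma graph_distxx x : graph_dist e x x = 0%N.
Proof. by apply/eqP; rewrite -leqn0; exact: (@graph_dist_le x [::]). Qed.

Lemma graph_dist_triangle x y z :
  (graph_dist e x z <= graph_dist e x y + graph_dist e y z)%N.
Proof.
have [p [ep lp <-]] := graph_dist_walk x y; have [q [eq lq <-]] := graph_dist_walk y z.
rewrite -size_cat; have <- : last x (p ++ q) = z by rewrite last_cat lp.
by apply: graph_dist_le; rewrite cat_path ep lp.
Qed.

Lemma graph_dist_edge x u v : e u v -> (graph_dist e x v <= (graph_dist e x u).+1)%N.
Proof.
move=> euv; have := graph_dist_triangle x u v; rewrite -addn1 => /leq_trans; apply.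
by rewrite leq_add2l; apply: (@graph_dist_le u [:: v]); rewrite /= euv.
Qed.

Lemma graph_dist_aut phi x y : graph_aut e phi ->
  graph_dist e (phi x) (phi y) = graph_dist e x y.
Proof.
have half psi u v : (forall u v, e (psi u) (psi v) = e u v) ->
    (graph_dist e (psi u) (psi v) <= graph_dist e u v)%N.
  move=> aut; have [p [ep <- <-]] := graph_dist_walk u v.
  rewrite -last_map -(size_map psi); apply: graph_dist_le.
  by rewrite path_map; apply: sub_path ep => s t /=; rewrite aut.
move=> [[phi' phiK phi'K] aut]; apply/eqP; rewrite eqn_leq half//=.
rewrite -{1}(phiK x) -{1}(phiK y); apply: half => u v.
by rewrite -aut !phi'K.
Qed.

End Distance.

(** * Sums over spheres *)

Section SphereSums.
Variables (R : realType) (V : choiceType) (e : rel V) (beta : R).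
Hypotheses (e_sym : symmetric e) (e_irr : irreflexive e) (e_conn : graph_connected e).
Hypothesis beta_gt0 : 0 < beta.
Implicit Types (x y z : V) (H : fin_subgraph e).

Local Notation G := (villain_corr e beta).
Local Notation d := (graph_dist e).

(** [A] is the open ball of radius [L] around [x]: along an edge the distance grows by at most one,
    so a path leaves [A] through the sphere. Distances are those of the whole graph, and the
    right-hand correlations are raised to infinite volume. *)
Lemma villain_corr_sub_simon H x y L : (0 < L)%N -> (L <= d x y)%N ->
  villain_corr_sub beta x y H <=
  \sum_(z <- [seq z <- enum_fset (sg_vertices H) | d x z == L]) G x z * G z y.
Proof.
move=> L0 Lxy; set S := [seq z <- _ | _].
have SH z : z \in S -> z \in sg_vertices H by rewrite mem_filter => /andP[].
have [/andP[xH yH]|out] := boolP ((x \in sg_vertices H) && (y \in sg_vertices H));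
  last first.
  rewrite villain_corr_sub_out//; apply: sumr_ge0 => z _.
  by rewrite mulr_ge0 ?villain_corr_ge0.
set a := dual_temp beta; have a0 : 0 < a by exact: dual_temp_gt0.
set D := map (@dipole V) (sg_edges H).
pose c u v := cur a D (dirac_int u - dirac_int v).
apply: (@le_trans _ _ (\sum_(z <- S) corr a D (dirac_int x - dirac_int z) *
    corr a D (dirac_int z - dirac_int y))); last first.
  rewrite big_seq [leRHS]big_seq; apply: ler_sum => z /SH zH.
  by apply: ler_pM; rewrite ?corr_ge0// -villain_corr_subE// villain_corr_ub.
rewrite villain_corr_subE// -/D.
have Z0 : 0 < cur a D 0 by exact: cur0_gt0.
rewrite /corr ler_pdivrMr//.
have -> : (\sum_(z <- S) cur a D (dirac_int x - dirac_int z) / cur a D 0 *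
    (cur a D (dirac_int z - dirac_int y) / cur a D 0)) * cur a D 0 =
    (\sum_(z <- S) c x z * c z y) / cur a D 0.
  rewrite !mulr_suml; apply: eq_bigr => z _.
  by rewrite mulrA divfK ?lt0r_neq0// mulrAC.
rewrite ler_pdivlMr// mulrC.
apply: (@cur_simon R V a a0 S (fun z => (d x z < L)%N)).
- by rewrite -leqNgt.
- by move=> z; rewrite mem_filter => /andP[/eqP -> _]; rewrite ltnn.
- apply/allP => p /sg_edges_adj adj; have /and3P[p1H p2H ep] := sg_sub adj.
  rewrite /separated; apply/and3P; split.
  + by apply: contraTneq ep => ->; rewrite e_irr.
  + apply/implyP => /= lt1; have := graph_dist_edge e_conn x ep.
    by rewrite mem_filter p2H andbT orbC -leq_eqVlt => /leq_trans; apply.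
  + apply/implyP => /= lt2; rewrite e_sym in ep.
    have := graph_dist_edge e_conn x ep.
    by rewrite mem_filter p1H andbT orbC -leq_eqVlt => /leq_trans; apply.
- by rewrite graph_distxx// L0.
Qed.

Lemma villain_corr_simon x y L c : (0 < L)%N -> (L <= d x y)%N -> 0 <= c ->
  (forall z, d x z = L -> G z y <= c) -> (sphere_sum e beta L x <= 1%:E)%E ->
  G x y <= c * fine (sphere_sum e beta L x).
Proof.
move=> L0 Lxy c0 Gc s1; apply: villain_corr_le => // H.
apply: le_trans (villain_corr_sub_simon H L0 Lxy) _.
set S := [seq z <- _ | _].
have s0 : (0%:E <= sphere_sum e beta L x)%E.
  by apply: esum_ge0 => z _; rewrite lee_fin villain_corr_ge0.
apply: (@le_trans _ _ (\sum_(z <- S) c * G x z)).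
  rewrite big_seq [leRHS]big_seq; apply: ler_sum => z.
  rewrite mem_filter => /andP[/eqP dz _].
  by rewrite mulrC ler_wpM2r ?villain_corr_ge0// Gc.
rewrite -mulr_sumr ler_wpM2l// -lee_fin fineK; last first.
  by rewrite ge0_fin_numE// (le_lt_trans s1)// ltry.
apply: sum_le_esum; first by rewrite filter_uniq// fset_uniq.
by move=> z; rewrite mem_filter => /andP[/eqP].
Qed.

Lemma sphere_sum0 x : sphere_sum e beta 0 x = 1%E.
Proof.
rewrite /sphere_sum (_ : [set y | _] = [set x]).
  by rewrite esum_set1 ?villain_corrxx// lee_fin.
apply/seteqP; split=> y /=; last by move=> ->; rewrite graph_distxx.
move=> d0; have [p [_ + sp]] := graph_dist_walk e_conn x y.
by move: sp; rewrite d0 => /size0nil -> /=.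
Qed.

Lemma sphere_sum_aut phi L x : graph_aut e phi ->
  sphere_sum e beta L (phi x) = sphere_sum e beta L x.
Proof.
move=> aut; have [[phi' phiK phi'K] _] := aut.
rewrite /sphere_sum (reindex_esum [set y | d x y = L] _ phi).
  by apply: eq_esum => y _; rewrite villain_corr_aut.
split=> [y /= <-|y z _ _|y /= dy]; first by rewrite graph_dist_aut.
  exact: (can_inj phiK).
by exists (phi' y); rewrite ?phi'K//= -(graph_dist_aut e_conn _ _ aut) phi'K.
Qed.

Lemma exponential_decay L (q : R) : (0 < L)%N -> 0 < q < 1 ->
  (forall x, (sphere_sum e beta L x <= q%:E)%E) ->
  exists A xi : R, [/\ 0 < A, 0 < xi &
    forall x y, G x y <= A * expR (- ((d x y)%:R / xi))].
Proof.
move=> L0 /andP[q0 q1] sq.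
(* Each use of Simon's inequality moves [x] to a point at distance [L], reduces the distance to [y]
   by at most [L], and gains a factor [q]. *)
have pow n x y : (n * L <= d x y)%N -> G x y <= q ^+ n.
  elim: n x y => [|n IH] x y h; first by rewrite expr0 villain_corr_le1.
  have s1 : (sphere_sum e beta L x <= 1%:E)%E.
    by apply: le_trans (sq x) _; rewrite lee_fin ltW.
  have s0 : (0%:E <= sphere_sum e beta L x)%E.
    by apply: esum_ge0 => z _; rewrite lee_fin villain_corr_ge0.
  apply: le_trans (villain_corr_simon (c := q ^+ n) L0 _ _ _ s1) _.
  - by apply: leq_trans h; rewrite mulSn leq_addr.
  - by rewrite exprn_ge0// ltW.
  - move=> z dz; apply: IH; have := graph_dist_triangle e_conn x z y.
    by rewrite dz; move: h; rewrite mulSn; lia.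
  rewrite exprSr ler_wpM2l ?exprn_ge0 ?(ltW q0)//.
  have fx : sphere_sum e beta L x \is a fin_num.
    by rewrite ge0_fin_numE// (le_lt_trans s1)// ltry.
  by rewrite -lee_fin fineK.
have lnq : 0 < - ln q by rewrite oppr_gt0 ln_lt0// q0.
(* [q ^ n] with [n] the integer part of [d / L] is at most [q ^ (d / L - 1)]; the prefactor pays for
   the rounding. *)
exists q^-1, (L%:R / - ln q); split.
- by rewrite invr_gt0.
- by rewrite divr_gt0// ltr0n.
move=> x y; set n := (d x y %/ L)%N.
apply: (le_trans (pow n x y _)); first by rewrite leq_trunc_div.
have qE : q = expR (ln q) by rewrite lnK.
rewrite [X in X ^+ _]qE [X in X^-1]qE -expRN -expRM_natr -expRD ler_expR.
have dn : (d x y)%:R <= (n%:R + 1) * L%:R :> R.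
  by rewrite natr1 -natrM ler_nat ltnW// ltn_ceil.
have L1 : 0 < L%:R :> R by rewrite ltr0n.
have -> : (d x y)%:R / (L%:R / - ln q) = (d x y)%:R / L%:R * - ln q.
  by rewrite invf_div mulrCA mulrC -mulrA mulrC.
have : (d x y)%:R / L%:R * - ln q <= (n%:R + 1) * - ln q.
  by rewrite ler_wpM2r ?(ltW lnq)// ler_pdivrMr.
by set u := _ / _ * _; lra.
Qed.

End SphereSums.

(** * Finitely many orbits and the dichotomy *)

Lemma finite_no_limit_point (T : topologicalType) (K E : set T) :
  compact K -> E `<=` K -> limit_point E = set0 -> finite_set E.
Proof.
move=> cK EK lE; apply: contrapT => infE.
(* If [E] is infinite this filter is proper, and a cluster point of it in [K] is a limit point of
   [E], since removing one point from [E] leaves a set of the filter. *)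
pose F := filter_from (@finite_set T) (fun D => E `\` D).
have PF : ProperFilter F.
  apply: filter_from_proper; first apply: filter_from_filter.
  - by exists set0; exact: finite_set0.
  - move=> A B fA fB; exists (A `|` B); first by rewrite finite_setU.
    by move=> x [Ex nx]; split; split=> // h; apply: nx; [left|right].
  - move=> D fD; apply/set0P/negP => /eqP ED; apply: infE.
    by apply: sub_finite_set fD => x Ex; apply: contrapT => nD;
       have : set0 x by rewrite -ED.
have FK : F K by exists set0 => // x [/EK].
have [p [Kp cl]] := cK F PF FK.
have : limit_point E p.
  move=> U Up; have [|y [[Ey yp] Uy]] := cl (E `\ p) U _ Up.
    by exists [set p]; first exact: finite_set1.
  by exists y; split=> //; apply/eqP.
by rewrite lE.
Qed.

Lemma finitely_many_orbits (R : realType) (V : choiceType) (e : rel V)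
    (pos : V -> R * R) (arc : V -> V -> set (R * R)) :
  injective pos -> doubly_periodic e pos arc -> tame pos ->
  exists s : seq V, forall x, exists2 phi, graph_aut e phi & phi x \in s.
Proof.
move=> pos_inj per tm.
pose K : set (R * R) := `[0, 1] `*` `[0, 1].
have cK : compact K by apply: compact_setX; exact: segment_compact.
have fin : finite_set (range pos `&` K).
  apply: finite_no_limit_point cK _ _; first exact: subIsetr.
  apply/seteqP; split=> // p lp; rewrite -tm => U /lp[y [yp [Ey _] Uy]].
  by exists y.
have finV : finite_set [set u | K (pos u)].
  have -> : [set u | K (pos u)] = pos @^-1` (range pos `&` K).
    by apply/seteqP; split=> [u Ku|u []//]; split=> //; exists u.
  by apply: finite_preimage fin => u v _ _; exact: pos_inj.
exists (fset_set [set u | K (pos u)]) => x.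
(* Translating by minus the integer parts brings [x] into the unit square, closed here for the sake
   of compactness. *)
have [phi [aut posphi _]] :=
  per (- Num.floor (pos x).1, - Num.floor (pos x).2).
exists phi => //; rewrite in_fset_set// inE /= posphi.
by split=> /=; rewrite in_itv /=;
  [have := floor_itv (pos x).1|have := floor_itv (pos x).2];
  rewrite !rmorphD !rmorphN /= => /andP[? ?]; apply/andP; split; lra.
Qed.

Lemma ereal_seq_max (R : realType) (T : eqType) (f : T -> \bar R) (s : seq T) x0 :
  x0 \in s -> exists2 x, x \in s & forall y, y \in s -> (f y <= f x)%E.
Proof.
case: s => // x s _; elim: s x => [|y s IH] x.
  by exists x; rewrite ?mem_head// => y; rewrite inE => /eqP->.
have [z zs hz] := IH y.
have [xz|zx] := leP (f x) (f z).
  exists z; first by rewrite in_cons zs orbT.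
  by move=> w; rewrite in_cons => /orP[/eqP->|/hz].
exists x; first by rewrite mem_head.
move=> w; rewrite in_cons => /orP[/eqP->//|/hz wz].
exact: le_trans wz (ltW zx).
Qed.

Theorem lemma1p5 (R : realType) (V : choiceType) (e : rel V)
  (e_sym : symmetric e) (e_irr : irreflexive e)
  (e_conn : graph_connected e)
  (pos : V -> R * R) (arc : V -> V -> set (R * R))
  (e_planar : planar_embedding e pos arc)
  (e_periodic : doubly_periodic e pos arc)
  (e_tame : tame pos)
  (beta : R) (beta_gt0 : 0 < beta) :
  (exists A xi : R, [/\ 0 < A, 0 < xi &
     forall x y : V,
       villain_corr e beta x y <= A * expR (- ((graph_dist e x y)%:R / xi))])
  \/
  (forall L : nat, exists x : V,
     (forall x' : V, (sphere_sum e beta L x' <= sphere_sum e beta L x)%E)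
     /\ (1 <= sphere_sum e beta L x)%E).
Proof.
have [pos_inj _ _] := e_planar.
have [s orbits] := finitely_many_orbits pos_inj e_periodic e_tame.
(* On the empty graph no maximum is attained, but the decay holds vacuously. *)
have [[x0 _]|noV] := pselect (exists x : V, True); last first.
  by left; exists 1, 1; split=> // x; case: noV; exists x.
have max_sum L : exists x, forall x',
    (sphere_sum e beta L x' <= sphere_sum e beta L x)%E.
  have [phi _ phi0] := orbits x0.
  have [x _ hx] := ereal_seq_max (sphere_sum e beta L) phi0.
  exists x => x'; have [psi aut psix'] := orbits x'.
  by rewrite -(sphere_sum_aut e_irr e_conn beta_gt0 L x' aut) hx.
have [|/existsNP[L small]] := pselect (forall L : nat, exists x : V,
     (forall x' : V, (sphere_sum e beta L x' <= sphere_sum e beta L x)%E)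
     /\ (1 <= sphere_sum e beta L x)%E); first by right.
left; have [x hx] := max_sum L.
have x1 : (sphere_sum e beta L x < 1)%E.
  by rewrite ltNge; apply/negP => x1; apply: small; exists x.
(* At radius 0 the sum is the self-correlation 1, so the failing radius is positive. *)
have L0 : (0 < L)%N.
  by rewrite lt0n; apply/eqP => L0; move: x1; rewrite L0 sphere_sum0// ltxx.
have s0 : (0%:E <= sphere_sum e beta L x)%E.
  by apply: esum_ge0 => z _; rewrite lee_fin villain_corr_ge0.
have fins : sphere_sum e beta L x \is a fin_num.
  by rewrite ge0_fin_numE// (lt_trans x1)// ltry.
(* The sum may be 0, for instance over empty spheres, whereas the decay rate uses [ln q]; hence the
   lower cutoff. *)
pose q := Num.max (fine (sphere_sum e beta L x)) 2^-1.
apply: (@exponential_decay R V e beta e_sym e_irr e_conn beta_gt0 L q L0).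
  rewrite lt_max gt_max invr_gt0 ltr0n orbT/= invf_lt1// ltr1n andbT.
  by rewrite -lte_fin fineK.
move=> x'; apply: le_trans (hx x') _; rewrite -(fineK fins) lee_fin.
by rewrite le_max lexx.
Qed.
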